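(* Let $\alpha,\beta>0$ be real numbers with $\alpha,\ \beta,\ \alpha+\beta\notin 2\pi\mathbb{Z}$, and let $t\in(0,\pi)$. Let $g_t$ be the spherical conical metric on $\mathbb{S}^2$ with cone angles $(\alpha,\beta,\alpha+\beta,4\pi)$ obtained by gluing two spherical footballs of angles $\alpha$ and $\beta$ along a slit of length $t$. If $h$ is a triangulated spherical metric on $\mathbb{S}^2$ with the same cone angles (that is, $\alpha$ at $A$, $\beta$ at $B$, $\alpha+\beta$ at $D$ and $4\pi$ at $C$), and $h$ is (sufficiently) close to $g_t$, then $(\mathbb{S}^2,h)$ is isometric to $(\mathbb{S}^2,g_s)$ for some $s$.
   Context: A spherical conical metric on $\mathbb{S}^2$ is a metric of constant curvature $1$ with finitely many conical singularities; near a cone point of angle $\theta_0$ it has the form $dr^2+(\theta_0/2\pi)^2\sin^2 r\,d\theta^2$ with $\theta\in\mathbb{R}/2\pi\mathbb{Z}$. Spherical football of angle $\alpha$: the sphere with metric $dr^2+(\alpha/2\pi)^2\sin^2 r\,d\theta^2$, $r\in[0,\pi]$, $\theta\in\mathbb{R}/2\pi\mathbb{Z}$. It has two cone points (poles) of angle $\alpha$, joined by meridians of length $\pi$. The metrics $g_t$, $0<t<\pi$: take a football of angle $\alpha$ with poles $A$ (north) and $D_1$ (south), and a football of angle $\beta$ with poles $B$ (north) and $D_2$ (south). Cut each open along a segment of a meridian of length $t$ starting at the south pole, and glue the two sides of the first slit to the two sides of the second slit, so as to obtain a sphere. The two south poles $D_1,D_2$ are identified to one cone point $D$ of angle $\alpha+\beta$,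 the other endpoints of the two slits are identified to one cone point $C$ of angle $4\pi$, and $A$, $B$ remain cone points of angles $\alpha$, $\beta$. Triangulated metric: a spherical conical metric on $\mathbb{S}^2$ with four marked points $A,B,C,D$ having the following geodesic decomposition (the same combinatorial decomposition as that of $g_t$; the cone angles and geodesic lengths are not necessarily those of $g_t$). Cutting along a geodesic $AC$, a geodesic $BC$ and two geodesics joining $C$ to $D$ gives two four-sided pieces: one with vertices $A,C_1,D_1,C_2$ in cyclic order and one with vertices $B,C_3,D_2,C_4$ in cyclic order. The points $C_1,\dots,C_4$ all glue back to $C$, and $D_1,D_2$ glue back to $D$; side $AC_1$ is glued to $AC_2$ (common length $\ell_1$), $BC_3$ to $BC_4$ (common length $\ell_2$), $D_1C_2$ to $D_2C_3$ and $D_1C_1$ to $D_2C_4$ (the lengths of these two glued sides are denoted $\ell_3,\ell_4$). Cutting the two pieces further along geodesics $C_1C_2$ (length $\ell_5$) and $C_3C_4$ (length $\ell_6$) gives four spherical geodesic triangles $AC_1C_2$, $D_1C_1C_2$, $BC_3C_4$, $D_2C_3C_4$. For $g_t$, with $AC$ and $BC$ the remaining parts of the cut meridians, one has $\ell_1=\ell_2=\pi-t$ and $\ell_3=\ell_4=t$. Closeness: a triangulated metric $h$ is close to a triangulated metric $g$ if the lengths of all sides of the four geodesic triangles of $h$ are close to the corresponding lengths for $g$. ''If $h$ is close to $g_t$'' means: there is $\delta>0$ (which may depend on $\alpha,\beta,t$) such that the assertion holds whenever all corresponding side lengths differ by less than $\delta$.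
   Formalization: If α or β is an odd multiple of π, only t = π/2 is covered: for other t the geodesic C₁C₂ (or C₃C₄) would run through a pole, so g_t has no decomposition into four geodesic triangles and ''h close to g_t'' is undefined. *)

(* Defs.v *)
From HB Require Import structures.
From mathcomp Require Import all_boot all_order all_algebra.
From mathcomp Require Import all_classical all_reals all_analysis.
Import Order.TTheory GRing.Theory Num.Theory.
Import numFieldNormedType.Exports.

Set Implicit Arguments.
Unset Strict Implicit.
Unset Printing Implicit Defensive.

Local Open Scope classical_set_scope.
Local Open Scope ring_scope.

Section SphericalSurfaces.
Variable R : realType.

Definition dot (u v : 'rV[R]_3) : R := (u *m v^T) 0 0.

Definition rotation (Q : 'M[R]_3) : Prop := Q *m Q^T = 1%:M /\ \det Q = 1.

(* The point of the unit sphere at distance r from the north pole, with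
   longitude phi. In these coordinates the round metric reads
   dr^2 + sin^2 r dphi^2. *)
Definition polar (r phi : R) : 'rV[R]_3 :=
  \row_(j < 3) nth 0 [:: sin r * cos phi; sin r * sin phi; cos r] j.

(* A surface glued from spherical pieces. The piece i is a region of the plane
   carrying the metric pulled back from the unit sphere by its developing map;
   sglue generates the identifications. A point is a pair (i, p) with
   p in sdom i. *)
Record surface := Surface {
  piece : Type;
  sdom : piece -> set (R * R);
  sdev : piece -> R * R -> 'rV[R]_3;
  sglue : piece * (R * R) -> piece * (R * R) -> Prop }.

Definition spoint (X : surface) : Type := (piece X * (R * R))%type.

Definition spoints (X : surface) : set (spoint X) :=
  [set x | sdom x.1 x.2].

(* A geodesic of length L from p to q inside a region D: a path whose
   development is an arc of great circle with unit speed. L may exceed 2 pi. *)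
Definition geodesic (D : set (R * R)) (dev : R * R -> 'rV[R]_3)
    (p q : R * R) (L : R) : Prop :=
  0 <= L /\ exists (g : R -> R * R) (u v : 'rV[R]_3),
    [/\ {within `[0, L], continuous g},
        forall s, 0 <= s <= L -> D (g s),
        g 0 = p /\ g L = q,
        [/\ dot u u = 1, dot v v = 1 & dot u v = 0] &
        forall s, 0 <= s <= L -> dev (g s) = cos s *: u + sin s *: v].

(* Broken geodesics: finitely many geodesics, each in one piece, joined through
   the identifications; the last argument is the total length. *)
Inductive broken_geodesic (X : surface) : spoint X -> spoint X -> R -> Prop :=
| bg_nil x : broken_geodesic x x 0
| bg_step i p q z L M :
    geodesic (sdom i) (sdev i) p q L ->
    broken_geodesic (i, q) z M -> broken_geodesic (i, p) z (L + M)
| bg_glue x y z M :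
    sglue x y \/ sglue y x ->
    broken_geodesic y z M -> broken_geodesic x z M.

(* The length distance, as for polyhedral complexes of constant curvature. It
   is a pseudodistance on spoints X; the surface itself is the quotient in
   which points at distance 0 are identified. *)
Definition sdist (X : surface) (x y : spoint X) : \bar R :=
  ereal_inf [set L%:E | L in [set L | broken_geodesic x y L]].

(* Isometry of the quotient metric spaces. *)
Definition isometric (X Y : surface) : Prop :=
  exists F : spoint X -> spoint Y,
    [/\ forall x, spoints x -> spoints (F x),
        forall x x', spoints x -> spoints x' ->
          sdist (F x) (F x') = sdist x x' &
        forall y, spoints y -> exists2 x, spoints x & sdist (F x) y = 0%E].

(* The football of angle a is cut open along a whole meridian, in coordinates
   (r, phi) with phi = a theta / (2 pi) in [0, a]; the edges r = 0 and r = pi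
   stand for the north and the south pole. *)
Definition lune (a : R) : set (R * R) :=
  [set p | 0 <= p.1 <= pi /\ 0 <= p.2 <= a].

Definition lune_dev (p : R * R) : 'rV[R]_3 := polar p.1 p.2.

Inductive football := footballA | footballB.

Definition football_angle (a b : R) (i : football) : R :=
  match i with footballA => a | footballB => b end.

(* Away from the slit (r <= pi - t) each football is closed up again along its
   own cut meridian; along the slit (pi - t <= r) the two sides of one football
   are glued to the two sides of the other. *)
Inductive football_glue (a b t : R) :
    football * (R * R) -> football * (R * R) -> Prop :=
| fg_pole i r phi phi' :
    r = 0 \/ r = pi ->
    0 <= phi <= football_angle a b i -> 0 <= phi' <= football_angle a b i ->
    football_glue a b t (i, (r, phi)) (i, (r, phi'))
| fg_meridian i r :
    0 <= r <= pi - t ->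
    football_glue a b t (i, (r, 0)) (i, (r, football_angle a b i))
| fg_slit i j r :
    i <> j -> pi - t <= r <= pi ->
    football_glue a b t (i, (r, football_angle a b i)) (j, (r, 0)).

(* The metric g_t. *)
Definition glued_footballs (a b t : R) : surface :=
  @Surface football (fun i => lune (football_angle a b i))
    (fun=> lune_dev) (football_glue a b t).

Definition simplex : set (R * R) :=
  [set p | [/\ 0 <= p.1, 0 <= p.2 & p.1 + p.2 <= 1]].

Definition simplex_interior : set (R * R) :=
  [set p | [/\ 0 < p.1, 0 < p.2 & p.1 + p.2 < 1]].

(* (0, 0), (1, 0), (0, 1), in counterclockwise order *)
Definition vertex (k : 'I_3) : R * R := ((k == 1 :> nat)%:R, (k == 2 :> nat)%:R).

(* The k-th side runs from vertex k to the next one. *)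
Definition side_point (k : 'I_3) (s : R) : R * R :=
  ((1 - s) * (vertex k).1 + s * (vertex (ordS k)).1,
   (1 - s) * (vertex k).2 + s * (vertex (ordS k)).2).

Definition sector (e th : R) : set (R * R) :=
  [set p | 0 <= p.1 < e /\ 0 <= p.2 <= th].

(* Geodesic polar coordinates (r, phi) centred at x, 0 <= phi <= th, valid on a
   neighbourhood of x in the simplex, in which the metric is
   dr^2 + sin^2 r dphi^2; the rays phi = 0 and phi = th are ray0 and ray1, and
   they are one and the same ray exactly when cl holds. *)
Definition polar_chart (dev : R * R -> 'rV[R]_3) (x : R * R) (th : R)
    (cl : bool) (ray0 ray1 : R -> R * R) : Prop :=
  exists (e : R) (Q : 'M[R]_3) (psi : R * R -> R * R),
    [/\ 0 < e < pi /\ rotation Q,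
        {within sector e th, continuous psi},
        psi @` sector e th `<=` simplex /\
          (\forall y \near x, simplex y -> (psi @` sector e th) y),
        forall r phi r' phi', sector e th (r, phi) -> sector e th (r', phi') ->
          psi (r, phi) = psi (r', phi') <->
          r = r' /\ (r = 0 \/ phi = phi' \/ (cl /\ `|phi - phi'| = th)) &
        [/\ forall phi, 0 <= phi <= th -> psi (0, phi) = x,
            forall r, 0 <= r < e -> psi (r, 0) = ray0 r /\ psi (r, th) = ray1 r &
            forall r phi, sector e th (r, phi) ->
              dev (psi (r, phi)) = polar r phi *m Q]].

(* A spherical geodesic triangle: a closed disc with a metric of curvature 1
   and three geodesic sides. The disc being simply connected, the metric is
   given by a developing map to the unit sphere, which need not be injective:
   angles and side lengths are arbitrary positive numbers. Sides are
   parametrized proportionally to arc length, and the developing map preserves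
   orientation; neither restricts the metric. tang k is the angle at vertex k,
   tlen k the length of the side from vertex k to the next vertex. *)
Record triangle := Triangle {
  tdev : R * R -> 'rV[R]_3;
  tlen : 'I_3 -> R;
  tang : 'I_3 -> R;
  tdev_continuous : {within simplex, continuous tdev};
  tlen_gt0 : forall k, 0 < tlen k;
  tang_gt0 : forall k, 0 < tang k;
  t_interior : forall x, simplex_interior x ->
    exists ray, polar_chart tdev x (2 * pi) true ray ray;
  t_side : forall k s, 0 < s < 1 ->
    polar_chart tdev (side_point k s) pi false
      (fun r => side_point k (s + r / tlen k))
      (fun r => side_point k (s - r / tlen k));
  t_vertex : forall k,
    polar_chart tdev (vertex k) (tang k) false
      (fun r => side_point k (r / tlen k))
      (fun r => side_point (ord_pred k) (1 - r / tlen (ord_pred k))) }.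

(* The four triangles, with their vertices 0, 1, 2 in counterclockwise order:
   faceA = (A, C1, C2), faceD1 = (D1, C2, C1),
   faceB = (B, C3, C4), faceD2 = (D2, C4, C3). *)
Inductive face := faceA | faceD1 | faceB | faceD2.

(* e1 = AC, e2 = BC, e3 = D1C2 = D2C3, e4 = D1C1 = D2C4, e5 = C1C2, e6 = C3C4 *)
Inductive edge := e1 | e2 | e3 | e4 | e5 | e6.

Definition face_edge (f : face) (k : 'I_3) : edge :=
  nth e1 match f with
         | faceA  => [:: e1; e5; e1]
         | faceD1 => [:: e3; e5; e4]
         | faceB  => [:: e2; e6; e2]
         | faceD2 => [:: e4; e6; e3]
         end k.

(* A triangulated metric: four triangles whose side lengths match. *)
Record triangulated := Triangulated {
  elen : edge -> R;
  htri : face -> triangle;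
  elenE : forall f k, tlen (htri f) k = elen (face_edge f k) }.

(* Every edge occurs as exactly two sides (f, k), which are glued to each other
   with opposite orientations. *)
Inductive triangle_glue : face * (R * R) -> face * (R * R) -> Prop :=
| tg_edge f k f' k' s :
    (f, k) <> (f', k') -> face_edge f k = face_edge f' k' -> 0 <= s <= 1 ->
    triangle_glue (f, side_point k s) (f', side_point k' (1 - s)).

Definition triangulated_surface (h : triangulated) : surface :=
  @Surface face (fun=> simplex) (fun f => tdev (htri h f)) triangle_glue.

(* The cone angle at a vertex of the triangulation is the sum of the angles of
   all the corners glued there; all the corners other than the corner 0 of each
   face are glued to C. *)
Definition angleA (h : triangulated) : R := tang (htri h faceA) ord0.
Definition angleB (h : triangulated) : R := tang (htri h faceB) ord0.
Definition angleD (h : triangulated) : R :=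
  tang (htri h faceD1) ord0 + tang (htri h faceD2) ord0.
Definition angleC (h : triangulated) : R :=
  \sum_(k < 3 | k != ord0)
    (tang (htri h faceA) k + tang (htri h faceD1) k +
     tang (htri h faceB) k + tang (htri h faceD2) k).

(* l is the family of edge lengths of the geodesic decomposition of g_t. Cutting
   along AC, BC and the two sides of the slit leaves the two lunes, in which
   the points C1, C2 (resp. C3, C4) lie at distance pi - t from the north pole
   on the two sides; e5 and e6 are geodesics of the lunes joining them. The
   length of such a geodesic is determined by a and t. The geodesic exists
   unless a is an odd multiple of pi and t <> pi / 2; in that case C1 and C2 lie
   on a great circle through the poles and the decomposition degenerates. *)
Definition glued_footballs_lengths (a b t : R) (l : edge -> R) : Prop :=
  [/\ l e1 = pi - t /\ l e2 = pi - t,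
      l e3 = t /\ l e4 = t,
      geodesic (lune a) lune_dev (pi - t, 0) (pi - t, a) (l e5) &
      geodesic (lune b) lune_dev (pi - t, 0) (pi - t, b) (l e6)].

End SphericalSurfaces.

(* Main.v *)
Require Import Defs.
From mathcomp Require Import all_boot all_order all_algebra.
From mathcomp Require Import all_classical all_reals all_analysis.
From mathcomp Require Import ring lra.
Import Order.TTheory GRing.Theory Num.Theory.
Import numFieldNormedType.Exports.

Set Implicit Arguments.
Unset Strict Implicit.
Unset Printing Implicit Defensive.

Local Open Scope classical_set_scope.
Local Open Scope ring_scope.

(** Write A, D1 and B, D2 for the apices of the two kites into which the geodesics
    AC, BC and the two geodesics CD cut the surface. Developing the triangles
    along a loop around C composes rotations of the sphere, and this composition
    is trivial because the angle at C is 4 pi. Consequently the rotations about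
    the developments of A, B and D, by the angles alpha, beta and alpha + beta,
    multiply to the identity. The trace of the product of two of them yields
    ([two_kites_cos_gap]) an equation (y + 1) * (...) = 0 for the cosine y of the
    distance between the developments of A and D1, whose second factor is linear
    in y. So y = -1, as for g_t, or y is a second value determined by alpha and
    beta. A metric close to g_t has y close to -1, and this excludes the second
    value unless it is 1 or -1 ([kites_near_base]); it is here that alpha, beta
    and alpha + beta must not be multiples of 2 pi. If y were 1, the two corners
    of the kite at C would be multiples of 2 pi, which is more than the angle 4 pi
    at C allows. What remains is that D1 is antipodal to A and D2 to
    B, that each kite has the angle pi at its two corners at C, and that
    l1 = l2 = pi - l3 and l3 = l4 ([near_lengths_rigid]).

    Each kite is then a digon: a disc of curvature 1 bounded by two geodesics of
    length pi with common end points ([two_triangles_digon], on the developments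
    of [triangle_frames]). A digon of angle a is isometric to the lune cut out of
    the football of angle a ([digon_lune]). As a may exceed 2 pi, the developing
    map need not be injective, and the identification is built as the exponential
    map at the corner A: meridians are lifted to the digon, where they can be
    continued as long as they are shorter than pi ([adm_ray_limit],
    [section_step], [section_exists]); they all end at the other corner
    ([lune_exp_to_south]), and the image is open and closed ([lune_exp_open],
    [lune_exp_onto]).

    The two lunes carry the identifications of g_s with s = l3. It remains to
    compare the length distances. Away from the poles an arc of great circle in a
    triangle lifts to a lune, the inverse of the identification being continuous
    there ([lune_point_arc]). Conversely, nearby points of a triangle are joined
    by a geodesic as long as the distance of their developments on the sphere
    ([triangle_geodesic]). Hence neither of the two maps between the triangles and
    the lunes lengthens broken geodesics ([bg_transfer]); as they are inverse to
    each other up to the identifications, they are isometries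
    ([lunes_isometric]). *)

(** [lra] compares the atoms of all hypotheses pairwise; in long proofs it pays
    to keep only the comparisons that share a variable with the goal, and those
    about [pi]. *)
Ltac shares_variable T G := match T with
  | context [?x] => is_var x;
    lazymatch type of x with realType => fail | _ => idtac end;
    match G with context [x] => idtac end
  end.

Ltac keep_close := repeat match goal with
  | H : ?T |- ?G =>
      lazymatch T with is_true _ => idtac | @eq _ _ _ => idtac end;
      lazymatch T with context [pi] => fail | _ => idtac end;
      tryif shares_variable T G then fail else clear H
  end.

Ltac near_lra := first [solve [keep_close; lra] | lra].
(** * Real induction and compactness *)

Section RealAnalysis.
Variable R : realType.
Implicit Types (a b s u e : R).

(** Real induction: the infimum of the bad points of [a, b] would itself be
    good, and so would the points just to the right of it. *)
Lemma real_induction a b (Q : R -> Prop) :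
  (forall s, a <= s <= b -> (forall u, a <= u < s -> Q u) ->
    Q s /\ exists2 e, 0 < e & forall u, s < u < s + e -> u <= b -> Q u) ->
  forall s, a <= s <= b -> Q s.
Proof.
move=> step s0 s0ab; apply: contrapT => nQ.
pose S := [set u | a <= u <= b /\ ~ Q u].
have Ss0 : S s0 by [].
have lbS : lbound S a by move=> u [/andP[]].
have hi : has_inf S by split; [exists s0 | exists a].
have am : a <= inf S by apply: lb_le_inf => //; exists s0.
have ms : inf S <= s0 by apply: ge_inf => //; exists a.
have mb : inf S <= b by apply: le_trans ms _; case/andP: s0ab.
have [|u /andP[au um]|Qm [e e0 Qe]] := step (inf S).
- by rewrite am mb.
- apply: contrapT => nQu.
  have : inf S <= u.
    by apply: ge_inf; [exists a | split=> //; rewrite au (ltW (lt_le_trans um mb))].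
  by rewrite leNgt um.
have [u Su] := inf_adherent e0 hi.
case: (Su) => /andP[au ub] nQu ue.
have : inf S <= u by apply: ge_inf => //; exists a.
rewrite le_eqVlt => /orP[/eqP E|mu]; first by apply: nQu; rewrite -E.
by apply: nQu; apply: Qe => //; rewrite mu ue.
Qed.

Lemma within_continuousP (U V : pseudoMetricType R) (A : set U) (f : U -> V) :
  {within A, continuous f} <->
  (forall x, A x -> forall e, 0 < e -> exists2 d, 0 < d &
     forall y, A y -> ball x d y -> ball (f x) e (f y)).
Proof.
split=> [/subspace_continuousP fc x Ax e e0|fc].
  have /cvg_ballP/(_ _ e0) := fc _ Ax.
  rewrite near_withinE => /nbhs_ballP[d /= d0 H].
  by exists d => // y Ay xy; apply: H.
apply/subspace_continuousP => x Ax; apply/cvg_ballP => e e0.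
rewrite near_withinE; apply/nbhs_ballP.
have [d d0 H] := fc x Ax e e0.
by exists d => //= y xy Ay; apply: H.
Qed.

(** The form in which compactness is used: points of K that are better and
    better accumulate somewhere in K. *)
Lemma compact_cluster (U : pseudoMetricType R) (K : set U) (S : R -> U -> Prop) :
  compact K -> (forall e e' x, e <= e' -> S e x -> S e' x) ->
  (forall e, 0 < e -> exists2 x, K x & S e x) ->
  exists2 x, K x & forall e, 0 < e -> exists y, [/\ K y, S e y & ball x e y].
Proof.
move=> /compact_near_coveringP cK Smono SK; apply: contrapT => nx.
have H x : K x -> exists2 e, 0 < e & forall y, K y -> ball x e y -> ~ S e y.
  move=> Kx; apply: contrapT => ne; apply: nx; exists x => // e e0.
  apply: contrapT => ny; apply: ne; exists e => // y Ky xy Sy.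
  by apply: ny; exists y.
have K1 : \forall e \near 0^'+, K `<=` (fun y => K y -> ~ S e y).
  apply: cK => x Kx; have [e e0 He] := H x Kx.
  exists (ball x e, [set e' | 0 < e' < e]); first split => /=.
  - exact: nbhsx_ballx.
  - near=> e'; apply/andP; split; first by near: e'; exact: nbhs_right_gt.
    by near: e'; apply: nbhs_right_lt.
  move=> [y e'] /= [xy /andP[_ e'e]] Ky Sy; apply: (He y) => //.
  by apply: Smono Sy; exact: ltW.
have K2 : \forall e \near 0^'+, (0 : R) < e by exact: nbhs_right_gt.
have [e [He e0]] := @filter_ex _ (0:R)^'+ _ _ (filterI K1 K2).
by have [x Kx Sx] := SK e e0; exact: (He x Kx Kx Sx).
Unshelve. all: by end_near. Qed.

End RealAnalysis.

(** * Trigonometry and frames of the unit sphere *)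

Section Frames.
Variable R : realType.
Implicit Types (x y r phi th l : R) (u v w : 'rV[R]_3) (P Q M : 'M[R]_3).

Lemma cos_lt1 x : 0 < x < 2 * pi -> cos x < 1.
Proof.
move=> /andP[x0 xpi].
have s0 : 0 < sin (x / 2) by apply: sin_gt0_pi; apply/andP; split; lra.
have -> : x = x / 2 + x / 2 by lra.
by rewrite cosD; have := cos2Dsin2 (x / 2); nra.
Qed.

Lemma cos_gtN1 x : 0 <= x < pi -> -1 < cos x.
Proof.
move=> /andP[x0 xpi].
have c0 : 0 < cos (x / 2) by apply: cos_gt0_pihalf; apply/andP; split; lra.
have -> : x = x / 2 + x / 2 by lra.
by rewrite cosD; have := cos2Dsin2 (x / 2); nra.
Qed.

Lemma cos_eq1_ge2pi x : 0 < x -> cos x = 1 -> 2 * pi <= x.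
Proof.
by move=> x0 cx; rewrite leNgt; apply/negP => ?; have := @cos_lt1 x; rewrite cx; lra.
Qed.

Lemma cos_eqN1_gepi x : 0 < x -> cos x = -1 -> pi <= x.
Proof.
move=> x0 cx; rewrite leNgt; apply/negP => ?.
by have := @cos_gtN1 x; rewrite cx; lra.
Qed.

Lemma cos_sin_inj x y :
  cos x = cos y -> sin x = sin y -> `|x - y| < 2 * pi -> x = y.
Proof.
move=> cxy sxy; have c1 : cos (x - y) = 1.
  by rewrite cosB cxy sxy; have := cos2Dsin2 y; nra.
move=> dxy; apply/eqP; rewrite -subr_eq0 -normr_eq0; apply/negPn/negP => n0.
have := @cos_lt1 `|x - y|; rewrite cos_norm c1 ltxx dxy lt_neqAle eq_sym n0.
by rewrite normr_ge0 => /(_ isT).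
Qed.

Lemma sin_sub_pi x : sin (pi - x) = sin x.
Proof. by rewrite sinB sinpi cospi; ring. Qed.

Lemma cos_sub_pi x : cos (pi - x) = - cos x.
Proof. by rewrite cosB sinpi cospi; ring. Qed.

Lemma acos_cos_norm x : `|x| <= pi -> acos (cos x) = `|x|.
Proof. by move=> xpi; rewrite -cos_norm cosK// in_itv/= normr_ge0. Qed.

Lemma circle_angle x y : x ^+ 2 + y ^+ 2 = 1 -> exists2 th, 0 <= th <= 2 * pi &
  [/\ cos th = x, sin th = y & 0 <= y -> th <= pi].
Proof.
move=> xy1; have x1 : -1 <= x <= 1 by apply/andP; split; nra.
have xI : x \in `[-1, 1] by rewrite in_itv.
have p0 : 0 < pi :> R := pi_gt0 R.
have := acos_ge0 x1; have := acos_lepi x1 => api a0.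
have sy : sin (acos x) ^+ 2 = y ^+ 2 by rewrite sin2cos2 acosK//; lra.
have s0 : 0 <= sin (acos x) by apply: sin_ge0_pi; rewrite a0.
have [y0|y0] := leP 0 y.
  exists (acos x); first by rewrite a0/=; lra.
  by split=> //; [rewrite acosK | nra].
exists (2 * pi - acos x); first by apply/andP; split; lra.
have -> : 2 * pi - acos x = - acos x + pi *+ 2 by lra.
rewrite cosD2pi sinD2pi cosN sinN acosK//; split=> //; first by nra.
Qed.

Definition c0 : 'I_3 := ord0.
Definition c1 : 'I_3 := Ordinal (isT : (1 < 3)%N).
Definition c2 : 'I_3 := Ordinal (isT : (2 < 3)%N).

Lemma ord3P (i : 'I_3) : [\/ i = c0, i = c1 | i = c2].
Proof.
by case: i => [[|[|[|//]]] ?];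
  [apply: Or31|apply: Or32|apply: Or33]; apply: val_inj.
Qed.

Lemma sum3 (F : 'I_3 -> R) : \sum_(i < 3) F i = F c0 + F c1 + F c2.
Proof.
rewrite !big_ord_recl big_ord0 addr0 addrA.
by congr (F _ + F _ + F _); apply: val_inj.
Qed.

Lemma row3P u v :
  u 0 c0 = v 0 c0 -> u 0 c1 = v 0 c1 -> u 0 c2 = v 0 c2 -> u = v.
Proof.
by move=> e0 e1 e2; apply/rowP => j; case: (ord3P j) => ->.
Qed.

Lemma mulmx3 m n (A : 'M[R]_(m, 3)) (B : 'M[R]_(3, n)) i j :
  (A *m B) i j = A i c0 * B c0 j + A i c1 * B c1 j + A i c2 * B c2 j.
Proof. by rewrite mxE sum3. Qed.

Lemma dotE u v : dot u v = u 0 c0 * v 0 c0 + u 0 c1 * v 0 c1 + u 0 c2 * v 0 c2.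
Proof. by rewrite /dot mulmx3 !mxE. Qed.

Definition mat3 (s : seq (seq R)) : 'M[R]_3 := \matrix_(i, j) nth 0 (nth [::] s i) j.

(** Rotation of a frame about its third vector. *)
Definition Zrot th := mat3 [:: [:: cos th; sin th; 0]; [:: - sin th; cos th; 0]; [:: 0; 0; 1]].

(** The frame at a point of a geodesic is (direction of travel, left normal,
    point). [Yrot r] moves it by r along the geodesic, and [Eflip l] turns it
    into the frame seen from the other end of a side of length l. *)
Definition Yrot r := mat3 [:: [:: cos r; 0; - sin r]; [:: 0; 1; 0]; [:: sin r; 0; cos r]].

Definition Eflip l := mat3 [:: [:: - cos l; 0; sin l]; [:: 0; -1; 0]; [:: sin l; 0; cos l]].

Lemma matrix3P P Q :
  (forall i j, i \in [:: c0; c1; c2] -> j \in [:: c0; c1; c2] -> P i j = Q i j) -> P = Q.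
Proof.
move=> H; apply/matrixP => i j; apply: H; rewrite !inE.
  by case: (ord3P i) => ->.
by case: (ord3P j) => ->.
Qed.

Lemma polarE r phi : (polar r phi 0 c0 = sin r * cos phi) *
  (polar r phi 0 c1 = sin r * sin phi) * (polar r phi 0 c2 = cos r).
Proof. by rewrite !mxE. Qed.

End Frames.

Ltac mx3 := apply: matrix3P => i j; rewrite !inE;
  move=> /or3P[]/eqP-> /or3P[]/eqP->; rewrite ?mulmx3 !mxE /=.
Ltac row3 := apply: row3P; rewrite ?mulmx3 !mxE /=.

Section FrameAlgebra.
Variable R : realType.
Implicit Types (x y r phi th l : R) (u v w : 'rV[R]_3) (P Q M : 'M[R]_3).

Lemma ZrotD x y : Zrot x *m Zrot y = Zrot (x + y).
Proof. by mx3; rewrite ?sinD ?cosD; ring. Qed.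

Lemma Zrot0 : Zrot 0 = 1%:M :> 'M[R]_3.
Proof. by mx3; rewrite ?sin0 ?cos0 ?oppr0. Qed.

Lemma Yrot0 : Yrot 0 = 1%:M :> 'M[R]_3.
Proof. by mx3; rewrite ?sin0 ?cos0 ?oppr0. Qed.

Lemma EflipK l : Eflip l *m Eflip l = 1%:M.
Proof. by mx3; have := cos2Dsin2 l; lra. Qed.

Lemma Zrot_pi_flip l : Zrot pi *m Eflip l = Yrot l.
Proof. by mx3; rewrite ?sinpi ?cospi; ring. Qed.

Lemma Eflip_Yrot l r : Eflip l *m Yrot r = Eflip (l + r).
Proof. by mx3; rewrite ?sinD ?cosD; ring. Qed.

Lemma Yrot_Eflip l r : Yrot r *m Eflip l = Eflip (l - r).
Proof. by mx3; rewrite ?sinB ?cosB; ring. Qed.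

Lemma YrotD r l : Yrot r *m Yrot l = Yrot (r + l).
Proof. by mx3; rewrite ?sinD ?cosD; ring. Qed.

Lemma polar_Zrot r phi th : polar r phi *m Zrot th = polar r (phi + th).
Proof. by row3; rewrite ?sinD ?cosD; ring. Qed.

Lemma polar_Yrot r l : polar r 0 *m Yrot l = polar (r + l) 0.
Proof. by row3; rewrite ?sinD ?cosD ?sin0 ?cos0; ring. Qed.

Lemma polar_Eflip r l : polar r 0 *m Eflip l = polar (l - r) 0.
Proof. by row3; rewrite ?sinB ?cosB ?sin0 ?cos0; ring. Qed.

Lemma polar_Eflip_pi r phi : polar r phi *m Eflip pi = polar (pi - r) (- phi).
Proof. by row3; rewrite ?sin_sub_pi ?cos_sub_pi ?sinN ?cosN ?sinpi ?cospi; ring. Qed.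

Lemma det3 a b c d e f g h k :
  \det (mat3 [:: [:: a; b; c]; [:: d; e; f]; [:: g; h; k]] : 'M[R]_3) =
  a * (e * k - f * h) - b * (d * k - f * g) + c * (d * h - e * g).
Proof.
rewrite (expand_det_row _ ord0) !big_ord_recl big_ord0 /cofactor.
rewrite !(expand_det_row _ ord0) !big_ord_recl !big_ord0 /cofactor !det_mx11.
rewrite !mxE /= /bump /= !expr0 !expr1 ?expr2; ring.
Qed.

End FrameAlgebra.

Section Rotations.
Variable R : realType.
Implicit Types (x y r phi th l e d : R) (u v w : 'rV[R]_3) (P Q M : 'M[R]_3).

Lemma rotationM P Q : rotation P -> rotation Q -> rotation (P *m Q).
Proof.
move=> [PP dP] [QQ dQ]; split; last by rewrite det_mulmx dP dQ mulr1.
by rewrite trmx_mul mulmxA -(mulmxA P) QQ mulmx1.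
Qed.

Lemma rotationTK Q : rotation Q -> Q^T *m Q = 1%:M.
Proof. by move=> [/mulmx1C]. Qed.

Lemma rotation_tr Q : rotation Q -> rotation Q^T.
Proof. by move=> rQ; split; rewrite ?trmxK ?det_tr; [exact: rotationTK|case: rQ]. Qed.

Lemma rotation_Zrot th : rotation (Zrot th).
Proof.
split; last by rewrite det3; have := cos2Dsin2 th; lra.
have -> : (Zrot th)^T = Zrot (- th) by mx3; rewrite ?sinN ?cosN ?opprK.
by rewrite ZrotD subrr Zrot0.
Qed.

Lemma rotation_Yrot r : rotation (Yrot r).
Proof.
split; last by rewrite det3; have := cos2Dsin2 r; lra.
have -> : (Yrot r)^T = Yrot (- r) by mx3; rewrite ?sinN ?cosN ?opprK.
by rewrite YrotD subrr Yrot0.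
Qed.

Lemma rotation_Eflip l : rotation (Eflip l).
Proof.
split; last by rewrite det3; have := cos2Dsin2 l; lra.
have -> : (Eflip l)^T = Eflip l by mx3.
exact: EflipK.
Qed.

Lemma dot_rotation Q u v : rotation Q -> dot (u *m Q) (v *m Q) = dot u v.
Proof. by move=> [QQ _]; rewrite /dot trmx_mul mulmxA -(mulmxA u) QQ mulmx1. Qed.

Lemma rotation_mulr_inj Q u v : rotation Q -> u *m Q = v *m Q -> u = v.
Proof.
by move=> [QQ _] /(congr1 (mulmx^~ Q^T)); rewrite -!mulmxA QQ !mulmx1.
Qed.

Lemma rotation_fix02 M : rotation M ->
  (forall j, M c0 j = (1%:M : 'M[R]_3) c0 j) ->
  (forall j, M c2 j = (1%:M : 'M[R]_3) c2 j) -> M = 1%:M.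
Proof.
move=> [MM dM] M0 M2.
have a0 : M c1 c0 = 0.
  have : (M *m M^T) c1 c0 = 0 by rewrite MM mxE.
  by rewrite mulmx3 ![_^T _ _]mxE !M0 !mxE/= => <-; ring.
have a2 : M c1 c2 = 0.
  have : (M *m M^T) c1 c2 = 0 by rewrite MM mxE.
  by rewrite mulmx3 ![_^T _ _]mxE !M2 !mxE/= => <-; ring.
have ME : M = mat3 [:: [:: 1; 0; 0]; [:: 0; M c1 c1; 0]; [:: 0; 0; 1]].
  apply: matrix3P => i j; rewrite !inE.
  by move=> /or3P[]/eqP-> /or3P[]/eqP->; rewrite ?M0 ?M2 ?a0 ?a2 !mxE.
have a1 : M c1 c1 = 1 by move: dM; rewrite ME det3 -ME => <-; ring.
by rewrite ME a1; mx3.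
Qed.

(** The middle vector of a direct orthonormal frame is determined by the other
    two. *)
Lemma rotation_eq P Q : rotation P -> rotation Q ->
  (forall j, P c0 j = Q c0 j) -> (forall j, P c2 j = Q c2 j) -> P = Q.
Proof.
move=> rP rQ e0 e2.
have Mi i : (forall j, P i j = Q i j) ->
    forall j, (P *m Q^T) i j = (1%:M : 'M[R]_3) i j.
  move=> ei j; have <- : (Q *m Q^T) i j = (1%:M : 'M[R]_3) i j by case: rQ => ->.
  by rewrite !mulmx3 !ei.
have M1 : P *m Q^T = 1%:M.
  by apply: rotation_fix02; [apply: rotationM => //; exact: rotation_tr|exact: Mi..].
have : P *m Q^T *m Q = Q by rewrite M1 mul1mx.
by rewrite -mulmxA rotationTK// mulmx1.
Qed.

Lemma polar0_frame r Q : polar r 0 *m Q = sin r *: row c0 Q + cos r *: row c2 Q.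
Proof. by apply/rowP => j; rewrite mulmx3 !mxE /= sin0 cos0; ring. Qed.

(** Two positions less than pi apart span the plane of a great circle, so they
    determine its frame. *)
Lemma frame_eq P Q r s : rotation P -> rotation Q -> 0 < s - r < pi ->
  polar r 0 *m P = polar r 0 *m Q -> polar s 0 *m P = polar s 0 *m Q -> P = Q.
Proof.
move=> rP rQ /sin_gt0_pi; rewrite sinB => s0 er es.
have coord j : sin r * P c0 j + cos r * P c2 j = sin r * Q c0 j + cos r * Q c2 j /\
   sin s * P c0 j + cos s * P c2 j = sin s * Q c0 j + cos s * Q c2 j.
  by split; [move/rowP: er => /(_ j) | move/rowP: es => /(_ j)];
     rewrite !polar0_frame !mxE.
have cr := cos2Dsin2 r; have cs := cos2Dsin2 s.
apply: rotation_eq => // j; have [h1 h2] := coord j.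
  have h : (sin s * cos r - cos s * sin r) * (P c0 j - Q c0 j) = 0.
    have -> : (sin s * cos r - cos s * sin r) * (P c0 j - Q c0 j) =
      cos r * ((sin s * P c0 j + cos s * P c2 j) - (sin s * Q c0 j + cos s * Q c2 j))
      - cos s * ((sin r * P c0 j + cos r * P c2 j) - (sin r * Q c0 j + cos r * Q c2 j))
      by ring.
    by rewrite h1 h2; ring.
  by move/eqP: h; rewrite mulf_eq0 gt_eqF//= subr_eq0 => /eqP.
have h : (sin s * cos r - cos s * sin r) * (P c2 j - Q c2 j) = 0.
  have -> : (sin s * cos r - cos s * sin r) * (P c2 j - Q c2 j) =
    sin s * ((sin r * P c0 j + cos r * P c2 j) - (sin r * Q c0 j + cos r * Q c2 j))
    - sin r * ((sin s * P c0 j + cos s * P c2 j) - (sin s * Q c0 j + cos s * Q c2 j))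
    by ring.
  by rewrite h1 h2; ring.
by move/eqP: h; rewrite mulf_eq0 gt_eqF//= subr_eq0 => /eqP.
Qed.

Lemma dot_polar r phi r' phi' : dot (polar r phi) (polar r' phi') =
  cos r * cos r' + sin r * sin r' * cos (phi - phi').
Proof. by rewrite dotE !polarE cosB; ring. Qed.

Lemma dot_polar_unit r phi : dot (polar r phi) (polar r phi) = 1.
Proof. by rewrite dot_polar subrr cos0 mulr1 -!expr2 cos2Dsin2. Qed.

Lemma dot_polar_center r phi phi' : dot (polar 0 phi) (polar r phi') = cos r.
Proof. by rewrite dot_polar sin0 cos0 !mul0r mul1r addr0. Qed.

Lemma polar_center phi phi' : polar 0 phi = polar 0 phi' :> 'rV[R]_3.
Proof. by apply: row3P; rewrite !polarE ?sin0 ?mul0r. Qed.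

Lemma polar_opp r : polar r pi = polar (- r) 0 :> 'rV[R]_3.
Proof.
by apply: row3P; rewrite !polarE ?sinN ?cosN ?sinpi ?cospi ?sin0 ?cos0; ring.
Qed.

Lemma polar_surj w : dot w w = 1 ->
  exists r, exists2 th, w = polar r th &
    [/\ 0 <= r <= pi, 0 <= th <= 2 * pi & 0 <= w 0 c1 -> th <= pi].
Proof.
rewrite dotE => w1.
have z1 : -1 <= w 0 c2 <= 1 by apply/andP; split; nra.
pose r := acos (w 0 c2).
have cr : cos r = w 0 c2 by rewrite /r acosK// in_itv.
have rpi : 0 <= r <= pi by rewrite acos_ge0//= acos_lepi.
have s0 : 0 <= sin r by exact: sin_ge0_pi.
have cs := cos2Dsin2 r.
have [sE|sN] := eqVneq (sin r) 0.
  exists r, 0; last by split; rewrite ?lexx//=; have := pi_gt0 R; lra.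
  by apply: row3P; rewrite polarE ?cr// sE mul0r; move: cs; rewrite sE cr; nra.
have [|th th2 [ct st thp]] := @circle_angle R (w 0 c0 / sin r) (w 0 c1 / sin r).
  rewrite !expr_div_n -mulrDl.
  have -> : w 0 c0 ^+ 2 + w 0 c1 ^+ 2 = sin r ^+ 2 by move: cs; rewrite cr; nra.
  by rewrite divff// expf_neq0.
exists r, th.
  by apply: row3P; rewrite polarE ?ct ?st ?cr// mulrC divfK.
by split=> // w0; apply: thp; rewrite divr_ge0.
Qed.

Lemma polar_inj r phi r' phi' : 0 <= r <= pi -> 0 <= r' <= pi ->
  polar r phi = polar r' phi' ->
  r = r' /\ (sin r = 0 \/ cos phi = cos phi' /\ sin phi = sin phi').
Proof.
move=> r0 r0' E.
have Er : r = r'.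
  by apply: cos_inj; rewrite ?in_itv//; move/rowP: E => /(_ c2); rewrite !polarE.
split=> //; subst r'; have [->|s0] := eqVneq (sin r) 0; [by left | right].
by split; apply: (mulfI s0); move/rowP: E => E;
  [have := E c0 | have := E c1]; rewrite !polarE.
Qed.

Lemma angle_eq_or_turn x y : 0 <= x <= 2 * pi -> 0 <= y <= 2 * pi ->
  cos x = cos y -> sin x = sin y ->
  [\/ x = y, x = 0 /\ y = 2 * pi | x = 2 * pi /\ y = 0].
Proof.
move=> x0 y0 cxy sxy; have [lt|] := ltP `|x - y| (2 * pi).
  by apply: Or31; exact: cos_sin_inj.
rewrite ler_normr => /orP[|] h; [apply: Or33 | apply: Or32]; lra.
Qed.

(** Unit vectors at distance less than d in every coordinate have inner product
    at least 1 - 3 d^2 / 2. *)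
Lemma close_dot e : 0 < e -> exists2 d, 0 < d &
  forall v w, dot v v = 1 -> dot w w = 1 -> ball v d w -> 1 - e < dot v w.
Proof.
move=> e0; exists (Num.min 1 (e / 2)); first by rewrite lt_min ltr01 divr_gt0.
move=> v w; rewrite !dotE => v1 w1 [_ H].
have sq j : (v 0 j - w 0 j) ^+ 2 <= e / 2.
  have := H 0 j; rewrite /ball/= lt_min => /andP[h1 h2].
  rewrite -(real_normK (num_real (v 0 j - w 0 j))) expr2; have := normr_ge0 (v 0 j - w 0 j); nra.
have := sq c0; have := sq c1; have := sq c2; lra.
Qed.

Lemma mulmx_ball (Q : 'M[R]_3) e : 0 < e -> exists2 d, 0 < d &
  forall v w, ball v d w -> ball (v *m Q) e (w *m Q).
Proof.
move=> e0.
pose K := \sum_(i < 3) \sum_(j < 3) `|Q i j|.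
have QK i j : `|Q i j| <= K.
  rewrite /K (bigD1 i)//= (bigD1 j)//= -addrA lerDl addr_ge0//.
    by rewrite sumr_ge0.
  by rewrite sumr_ge0// => ? _; rewrite sumr_ge0.
have K0 : 0 <= K by apply: le_trans (QK 0 0).
exists (e / (3 * (K + 1))); first by rewrite divr_gt0// mulr_gt0//; lra.
move=> v w [_ H]; split=> // i j; rewrite /ball/= !mulmx3.
have hk k : `|(v i k - w i k) * Q k j| <= e / (3 * (K + 1)) * K.
  by rewrite normrM ler_pM// ltW//; exact: H.
have -> : v i c0 * Q c0 j + v i c1 * Q c1 j + v i c2 * Q c2 j -
  (w i c0 * Q c0 j + w i c1 * Q c1 j + w i c2 * Q c2 j) =
  (v i c0 - w i c0) * Q c0 j + (v i c1 - w i c1) * Q c1 j + (v i c2 - w i c2) * Q c2 j.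
  by ring.
apply: (le_lt_trans (ler_normD _ _)).
apply: (le_lt_trans (lerD (ler_normD _ _) (lexx _))).
apply: (le_lt_trans (lerD (lerD (hk _) (hk _)) (hk _))).
have -> : e / (3 * (K + 1)) * K + e / (3 * (K + 1)) * K + e / (3 * (K + 1)) * K =
  e * (K / (K + 1)) by field; lra.
by rewrite gtr_pMr// ltr_pdivrMr; lra.
Qed.

Lemma polar_ball (p : R * R) e : 0 < e -> exists2 d, 0 < d &
  forall q, ball p d q -> ball (polar p.1 p.2) e (polar q.1 q.2).
Proof.
move=> e0.
have C (f : R -> R) (x : R) : continuous f -> exists2 d, 0 < d &
    forall y, `|x - y| < d -> `|f x - f y| < e / 2.
  move=> /(_ x)/cvg_ballP/(_ (e / 2)); rewrite divr_gt0// => /(_ isT).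
  by move/nbhs_ballP => [d d0 H]; exists d => // y xy; exact: (H y).
have [d1 d10 H1] := C sin p.1 (@continuous_sin R).
have [d2 d20 H2] := C cos p.1 (@continuous_cos R).
have [d3 d30 H3] := C sin p.2 (@continuous_sin R).
have [d4 d40 H4] := C cos p.2 (@continuous_cos R).
exists (Num.min (Num.min d1 d2) (Num.min d3 d4)); first by rewrite !lt_min d10 d20 d30.
move=> q [q1 q2]; move: q1 q2; rewrite /ball/= !lt_min.
move=> /andP[/andP[/H1 h1 /H2 h2] _] /andP[_ /andP[/H3 h3 /H4 h4]].
split=> // i j; rewrite ord1 /ball/=.
have prod (a b a' b' : R) : `|a| <= 1 -> `|b'| <= 1 -> `|a - a'| < e / 2 ->
    `|b - b'| < e / 2 -> `|a * b - a' * b'| < e.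
  move=> a1 b1 ha hb; have -> : a * b - a' * b' = a * (b - b') + (a - a') * b' by ring.
  apply: (le_lt_trans (ler_normD _ _)); rewrite !normrM.
  have := normr_ge0 a; have := normr_ge0 (b - b'); have := normr_ge0 (a - a').
  have := normr_ge0 b'; nra.
by case: (ord3P j) => ->; rewrite !polarE;
  [apply: prod; rewrite ?sin_max ?cos_max | apply: prod; rewrite ?sin_max ?cos_max
  | lra].
Qed.

End Rotations.

(** * Geodesic triangles *)

Section Charts.
Variable R : realType.
Implicit Types (r phi th l s e d : R) (u v w : 'rV[R]_3) (P Q M : 'M[R]_3).
Implicit Types (x y p q : R * R).

(** The condition on a polar chart, with its radius, frame and map exposed. *)
Definition chart_in (dev : R * R -> 'rV[R]_3) x th (cl : bool)
    (ray0 ray1 : R -> R * R) e Q (psi : R * R -> R * R) : Prop :=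
  [/\ 0 < e < pi /\ rotation Q,
      {within sector e th, continuous psi},
      psi @` sector e th `<=` simplex (R := R) /\
        (\forall y \near x, simplex y -> (psi @` sector e th) y),
      forall r phi r' phi', sector e th (r, phi) -> sector e th (r', phi') ->
        psi (r, phi) = psi (r', phi') <->
        r = r' /\ (r = 0 \/ phi = phi' \/ (cl /\ `|phi - phi'| = th)) &
      [/\ forall phi, 0 <= phi <= th -> psi (0, phi) = x,
          forall r, 0 <= r < e -> psi (r, 0) = ray0 r /\ psi (r, th) = ray1 r &
          forall r phi, sector e th (r, phi) ->
            dev (psi (r, phi)) = polar r phi *m Q]].

Lemma chart_ray0 dev x th cl ray0 ray1 e Q psi r : 0 <= th ->
  chart_in dev x th cl ray0 ray1 e Q psi -> 0 <= r < e ->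
  dev (ray0 r) = polar r 0 *m Q.
Proof.
move=> th0 [_ _ _ _ [_ /(_ r) H D]] re.
by have [<- _] := H re; apply: D; split=> //=; rewrite lexx.
Qed.

Lemma chart_ray1 dev x th cl ray0 ray1 e Q psi r : 0 <= th ->
  chart_in dev x th cl ray0 ray1 e Q psi -> 0 <= r < e ->
  dev (ray1 r) = polar r th *m Q.
Proof.
move=> th0 [_ _ _ _ [_ /(_ r) H D]] re.
by have [_ <-] := H re; apply: D; split=> //=; rewrite lexx th0.
Qed.

(** The part of a polar chart that survives the gluing of two charts along a
    common ray: the rays fill a neighbourhood of the centre, and shrink to it
    uniformly. *)
Definition fan_map (D : set (R * R)) (dev : R * R -> 'rV[R]_3) x th
    (ray0 ray1 : R -> R * R) Q e (psi : R * R -> R * R) : Prop :=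
  [/\ forall r phi, sector e th (r, phi) ->
        D (psi (r, phi)) /\ dev (psi (r, phi)) = polar r phi *m Q,
      exists2 d, 0 < d & forall y, D y -> ball x d y ->
        exists r phi, sector e th (r, phi) /\ psi (r, phi) = y,
      forall d, 0 < d -> exists2 d', 0 < d' & forall r phi,
        sector e th (r, phi) -> r < d' -> ball x d (psi (r, phi)),
      forall phi, 0 <= phi <= th -> psi (0, phi) = x &
      forall r, 0 <= r < e -> psi (r, 0) = ray0 r /\ psi (r, th) = ray1 r].

Definition fan D dev x th ray0 ray1 Q : Prop :=
  rotation Q /\ exists e psi, 0 < e < pi /\ fan_map D dev x th ray0 ray1 Q e psi.

Lemma chart_fan dev x th cl ray0 ray1 e Q psi : 0 <= th ->
  chart_in dev x th cl ray0 ray1 e Q psi ->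
  fan (simplex (R := R)) dev x th ray0 ray1 Q.
Proof.
move=> th0 [[e0 rQ] psiC [psiS psiN] psiI [psi0 psiR psiD]]; split=> //.
exists e, psi; split=> //; split=> //.
- by move=> r phi s; split; [apply: psiS; exists (r, phi) | exact: psiD].
- move/nbhs_ballP: psiN => [d /= d0 H]; exists d => // y Dy xy.
  by have [[r phi] s E] := H y xy Dy; exists r, phi.
move=> d d0.
(* the rays shrink uniformly because their directions form a compact set *)
apply: contrapT => nd.
have cK : compact (`[0 : R, th] : set R) := @segment_compact R 0 th.
pose S (t phi : R) := exists2 r, r < t & sector e th (r, phi) /\ ~ ball x d (psi (r, phi)).
have [t t' phi tt' [r rt H]|t t0|phi] := @compact_cluster R R _ S cK.
- by exists r => //; exact: lt_le_trans rt tt'.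
- apply: contrapT => nphi; apply: nd; exists t => // r phi s rt.
  apply: contrapT => nb; apply: nphi; exists phi; last by exists r.
  by rewrite /= in_itv; case: s.
rewrite /= in_itv/= => phiI cl0.
have s0 : sector e th (0, phi) by split=> //=; rewrite lexx; case/andP: e0.
have [t t0 Ht] := (within_continuousP _ _).1 psiC _ s0 d d0.
have [phi' [_ [r rt [s nb]] pp]] := cl0 t t0.
apply: nb; rewrite -(psi0 phi)//; apply: Ht => //.
split=> //=; rewrite /ball/= sub0r normrN ger0_norm//.
by case: s => /andP[].
Qed.

(** This is how a point of a triangle is joined to the nearby ones inside the
    triangle, at the distance of their developments. *)
Lemma chart_geodesic dev x th cl ray0 ray1 e Q psi r phi :
  chart_in dev x th cl ray0 ray1 e Q psi -> sector e th (r, phi) ->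
  geodesic (simplex (R := R)) dev x (psi (r, phi)) r.
Proof.
move=> [[e0 rQ] psiC [psiS _] _ [psi0 _ psiD]] s.
have [/= /andP[r0 re] phiI] := s; split=> //.
have sE t : 0 <= t <= r -> sector e th (t, phi).
  by move=> /andP[t0 tr]; split=> //=; rewrite t0/= (le_lt_trans tr).
exists (fun t => psi (t, phi)), (polar 0 0 *m Q), (polar (pi / 2) phi *m Q); split.
- apply/within_continuousP => t; rewrite /= in_itv/= => /sE st eps eps0.
  have [d d0 H] := (within_continuousP _ _).1 psiC _ st eps eps0.
  exists d => // t'; rewrite /= in_itv/= => /sE st' tt'.
  by apply: H => //; split=> //=; exact: ballxx.
- by move=> t /sE st; apply: psiS; exists (t, phi).
- by rewrite psi0.
- split; rewrite !dot_rotation// ?dot_polar_unit// dot_polar_center.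
  exact: cos_pihalf.
move=> t /sE st; rewrite psiD// !scalemxAl -mulmxDl; congr (_ *m _).
by apply: row3P; rewrite !mxE/= ?cos_pihalf ?sin_pihalf ?sin0 ?cos0; ring.
Qed.

End Charts.

Section Triangles.
Variable R : realType.
Implicit Types (r phi th l s e d : R) (u v w : 'rV[R]_3) (P Q M : 'M[R]_3).
Implicit Types (x y p q : R * R) (T : triangle R) (k : 'I_3).

Lemma ord_predSK k : ord_pred (ordS k) = k.
Proof. by case: (ord3P k) => ->; apply: val_inj. Qed.

Lemma side_point0 k : side_point k 0 = vertex R k.
Proof. by rewrite /side_point subr0 !mul1r !mul0r !addr0; case: (vertex _ k). Qed.

Lemma side_point1 k : side_point k 1 = vertex R (ordS k).
Proof. by rewrite /side_point subrr !mul1r !mul0r !add0r; case: (vertex _ _). Qed.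

Definition vertex_chart T k e Q psi :=
  chart_in (tdev T) (vertex R k) (tang T k) false
    (fun r => side_point k (r / tlen T k))
    (fun r => side_point (ord_pred k) (1 - r / tlen T (ord_pred k))) e Q psi.

Lemma side_near_vertex T k : exists e Q psi, vertex_chart T k e Q psi.
Proof. exact: t_vertex. Qed.

(** The great circles read off in the charts along a side agree on overlaps, hence
    with the one read off at its start. *)
Lemma side_great_circle T k e Q psi : vertex_chart T k e Q psi ->
  forall r, 0 <= r <= tlen T k -> tdev T (side_point k (r / tlen T k)) = polar r 0 *m Q.
Proof.
set l := tlen T k; move=> ch0; have l0 : 0 < l := tlen_gt0 T k.
have [[/andP[e0 epi] rQ] _ _ _ _] := ch0.
apply: real_induction => s /andP[s0 sl] IH.
have near s' : 0 < s' <= l -> forall e', 0 < e' < pi -> exists a b,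
    [/\ 0 < b < e', 0 < a < e', 0 < a - b < pi, 0 <= s' - a < s' & 0 <= s' - b < s'].
  move=> /andP[s'0 s'l] e' /andP[e'0 e'pi].
  exists (Num.min s' (e' / 2)), (Num.min s' (e' / 2) / 2).
  have h1 : 0 < Num.min s' (e' / 2) by rewrite lt_min s'0 divr_gt0.
  have h2 : Num.min s' (e' / 2) <= s' by rewrite ge_min lexx.
  have h3 : Num.min s' (e' / 2) <= e' / 2 by rewrite ge_min lexx orbT.
  by split; near_lra.
have [s00|sN] := eqVneq s 0.
  rewrite s00 in IH *.
  have h r : 0 <= r < e -> tdev T (side_point k (r / l)) = polar r 0 *m Q.
    by move=> re; rewrite (chart_ray0 _ ch0)// ltW//; exact: tang_gt0.
  split; first by apply: h; rewrite lexx.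
  by exists e => // r /andP[r0]; rewrite add0r => re _; apply: h; rewrite ltW.
have sgt : 0 < s by rewrite lt_neqAle eq_sym sN.
have [sE|sNl] := eqVneq s l.
  rewrite sE; split; last by exists 1 => // u /andP[]; rewrite ltNge => /negP.
  have [e' [Q' [psi' ch1]]] := side_near_vertex T (ordS k).
  have [[e'0 rQ'] _ _ _ _] := ch1.
  have th0 : 0 <= tang T (ordS k) by rewrite ltW//; exact: tang_gt0.
  have h r : 0 <= r < e' ->
      tdev T (side_point k (1 - r / l)) = polar r 0 *m (Zrot (tang T (ordS k)) *m Q').
    move=> re; rewrite mulmxA polar_Zrot add0r -(chart_ray1 th0 ch1 re).
    by rewrite ord_predSK.
  have [||a [b [b0 a0 ab ia ib]]] := near l _ e' => //; first by rewrite l0/=.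
  have eqn c : 0 < c < e' -> 0 <= l - c < l ->
      polar c 0 *m (Zrot (tang T (ordS k)) *m Q') = polar c 0 *m (Eflip l *m Q).
    move=> c0 ic; rewrite -h; last by near_lra.
    rewrite mulmxA polar_Eflip -IH ?sE//; congr (tdev T (side_point k _)).
    by field; near_lra.
  have E : Zrot (tang T (ordS k)) *m Q' = Eflip l *m Q.
    by apply: frame_eq ab _ _;
      [apply: rotationM => //; exact: rotation_Zrot
      |apply: rotationM => //; exact: rotation_Eflip|exact: eqn..].
  have -> : l / l = 1 - 0 / l by field; near_lra.
  rewrite h; last by near_lra.
  by rewrite E mulmxA polar_Eflip subr0.
have slt : s < l by rewrite lt_neqAle sNl.
have sl01 : 0 < s / l < 1 by rewrite divr_gt0//= ltr_pdivrMr// mul1r.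
have [e' [Q' [psi' ch1]]] := t_side T k sl01.
have [[e'0 rQ'] _ _ _ _] := ch1.
have p0 : 0 <= pi :> R := pi_ge0 R.
have h1 r : 0 <= r < e' -> tdev T (side_point k ((s + r) / l)) = polar r 0 *m Q'.
  by move=> re; rewrite mulrDl -(chart_ray0 p0 ch1 re).
have h2 r : 0 <= r < e' -> tdev T (side_point k ((s - r) / l)) = polar (- r) 0 *m Q'.
  by move=> re; rewrite -polar_opp mulrBl -(chart_ray1 p0 ch1 re).
have [||a [b [b0 a0 ab ia ib]]] := near s _ e' => //; first by near_lra.
have eqn c : 0 < c < e' -> 0 <= s - c < s ->
    polar (- c) 0 *m Q' = polar (- c) 0 *m (Yrot s *m Q).
  move=> c0 ic; rewrite -h2; last by near_lra.
  by rewrite mulmxA polar_Yrot (addrC (- c)) IH.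
have E : Q' = Yrot s *m Q.
  apply: (@frame_eq _ _ _ (- a) (- b)) => //.
  - by apply: rotationM => //; exact: rotation_Yrot.
  - by rewrite opprK addrC.
  - exact: eqn.
  - exact: eqn.
split.
  have := h1 0; rewrite lexx/= addr0 => ->; last by near_lra.
  by rewrite E mulmxA polar_Yrot add0r.
exists e'; first by near_lra.
move=> r rs rl; have -> : r = s + (r - s) by ring.
rewrite h1; last by near_lra.
by rewrite E mulmxA polar_Yrot (addrC (r - s)).
Qed.

(** The frames at the vertices: going once around the triangle, one turns by
    the angle at every corner. *)
Lemma triangle_frames T : exists Q : 'I_3 -> 'M[R]_3,
  [/\ forall k, rotation (Q k),
      forall k, exists e psi, vertex_chart T k e (Q k) psi,
      forall k r, 0 <= r <= tlen T k ->
        tdev T (side_point k (r / tlen T k)) = polar r 0 *m Q k,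
      forall k, Eflip (tlen T k) *m Q k = Zrot (tang T (ordS k)) *m Q (ordS k) &
      forall k s, 0 < s < 1 -> fan (simplex (R := R)) (tdev T) (side_point k s) pi
        (fun r => side_point k (s + r / tlen T k))
        (fun r => side_point k (s - r / tlen T k)) (Yrot (s * tlen T k) *m Q k)].
Proof.
have /choice[Q QP] k : exists Q, exists e psi, vertex_chart T k e Q psi.
  by have [e [Q [psi H]]] := side_near_vertex T k; exists Q, e, psi.
have rQ k : rotation (Q k) by have [e [psi [[]]]] := QP k.
have GC k : forall r, 0 <= r <= tlen T k ->
    tdev T (side_point k (r / tlen T k)) = polar r 0 *m Q k.
  by have [e [psi H]] := QP k; exact: side_great_circle H.
exists Q; split=> // k; last first.
  move=> s s01; set l := tlen T k; have l0 : 0 < l := tlen_gt0 T k.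
  have [e [Q' [psi ch]]] := t_side T k s01.
  have [[e0 rQ'] _ _ _ _] := ch.
  have p0 : 0 <= pi :> R := pi_ge0 R.
  suff <- : Q' = Yrot (s * l) *m Q k by exact: chart_fan ch.
  have sl : 0 < l - s * l by nra.
  have sl0 : 0 <= s * l by nra.
  have h r : 0 <= r < e -> r <= l - s * l ->
      polar r 0 *m Q' = polar r 0 *m (Yrot (s * l) *m Q k).
    move=> re rl; rewrite mulmxA polar_Yrot -(chart_ray0 p0 ch re) -GC -/l; last by near_lra.
    by congr (tdev T (side_point k _)); rewrite -/l; field; near_lra.
  pose c := Num.min (e / 2) (l - s * l).
  have c0 : 0 < c by rewrite lt_min sl andbT; near_lra.
  have h1 : c <= e / 2 by rewrite ge_min lexx.
  have h2 : c <= l - s * l by rewrite ge_min lexx orbT.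
  apply: (@frame_eq _ _ _ 0 c) => //; [|near_lra|apply: h; near_lra|apply: h; near_lra].
  by apply: rotationM => //; exact: rotation_Yrot.
set l := tlen T k; have l0 : 0 < l := tlen_gt0 T k.
have [e [psi ch]] := QP (ordS k).
have [[e0 _] _ _ _ _] := ch.
have th0 : 0 <= tang T (ordS k) by rewrite ltW//; exact: tang_gt0.
have h r : 0 <= r < e -> r <= l -> polar r 0 *m (Eflip l *m Q k) =
    polar r 0 *m (Zrot (tang T (ordS k)) *m Q (ordS k)).
  move=> re rl; rewrite !mulmxA polar_Eflip polar_Zrot add0r -(chart_ray1 th0 ch re).
  rewrite ord_predSK -GC -/l; last by near_lra.
  by congr (tdev T (side_point k _)); rewrite -/l; field; near_lra.
pose c := Num.min (e / 2) l.
have c0 : 0 < c by rewrite lt_min l0 andbT; near_lra.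
have h1 : c <= e / 2 by rewrite ge_min lexx.
have h2 : c <= l by rewrite ge_min lexx orbT.
apply: (@frame_eq _ _ _ 0 c) => //; [| |near_lra|apply: h; near_lra|apply: h; near_lra];
  apply: rotationM => //; [exact: rotation_Eflip|exact: rotation_Zrot].
Qed.

Lemma simplexP x : simplex x <->
  [\/ simplex_interior x, exists k s, 0 < s < 1 /\ x = side_point k s |
      exists k, x = vertex R k].
Proof.
split; last first.
  case=> [[]|[k [s [s01 ->]]]|[k ->]]; first by move=> h1 h2 h3; split; exact: ltW.
    by case: (ord3P k) => ->; split=> /=; rewrite /vertex/=; nra.
  by case: (ord3P k) => ->; split=> /=; rewrite /vertex/=; near_lra.
case: x => a b [/= a0 b0 ab].
have side (k : 'I_3) s : 0 <= s <= 1 -> (a, b) = side_point k s ->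
    [\/ simplex_interior (a, b), exists k s, 0 < s < 1 /\ (a, b) = side_point k s |
      exists k, (a, b) = vertex R k].
  move=> /andP[s0 s1] E; have [s00|sN] := eqVneq s 0.
    by apply: Or33; exists k; rewrite E s00 side_point0.
  have [s11|sN1] := eqVneq s 1.
    by apply: Or33; exists (ordS k); rewrite E s11 side_point1.
  by apply: Or32; exists k, s; rewrite !lt_neqAle eq_sym sN sN1 s0 s1.
have [a00|aN] := eqVneq a 0.
  apply: (side c2 (1 - b)); first by near_lra.
  by rewrite /side_point /vertex/= a00; congr (_, _); ring.
have [b00|bN] := eqVneq b 0.
  apply: (side c0 a); first by near_lra.
  by rewrite /side_point /vertex/= b00; congr (_, _); ring.
have [abE|abN] := eqVneq (a + b) 1.
  apply: (side c1 b); first by near_lra.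
  by rewrite /side_point /vertex/=; congr (_, _); near_lra.
by apply: Or31; split=> /=; rewrite lt_neqAle ?[_ == a]eq_sym ?[_ == b]eq_sym ?aN ?bN ?abN.
Qed.

Lemma simplex_chart T x : simplex x ->
  exists th cl ray0 ray1 e Q psi, 0 <= th /\
    chart_in (tdev T) x th cl ray0 ray1 e Q psi.
Proof.
move=> /simplexP[/(t_interior T)[ray [e [Q [psi H]]]]|[k [s [s01 ->]]]|[k ->]].
- by exists (2 * pi), true, ray, ray, e, Q, psi; split=> //; rewrite mulr_ge0// pi_ge0.
- have [e [Q [psi H]]] := t_side T k s01.
  by exists pi, false; do 2 eexists; exists e, Q, psi; split; [exact: pi_ge0 | exact: H].
have [e [Q [psi H]]] := side_near_vertex T k.
by exists (tang T k), false; do 2 eexists; exists e, Q, psi; split;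
  [rewrite ltW//; exact: tang_gt0 | exact: H].
Qed.

Lemma triangle_geodesic T x : simplex x -> exists2 d, 0 < d &
  forall y, simplex y -> ball x d y ->
    geodesic (simplex (R := R)) (tdev T) x y (acos (dot (tdev T x) (tdev T y))).
Proof.
move=> /(simplex_chart T)[th [cl [ray0 [ray1 [e [Q [psi [th0 H]]]]]]]].
have [[e0 rQ] _ [_ psiN] _ [psi0 _ psiD]] := H.
move/nbhs_ballP: psiN => [d /= d0 Hd]; exists d => // y Sy xy.
have [[r phi] s E] := Hd y xy Sy; rewrite -E.
have s0 : sector e th (0, 0) by split=> /=; near_lra.
have := psiD _ _ s0; rewrite psi0; last by near_lra.
move=> ->; rewrite psiD// dot_rotation// dot_polar_center cosK.
  exact: chart_geodesic H s.
by rewrite in_itv/=; case: s => /= ? _; near_lra.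
Qed.

End Triangles.

(** * Holonomy *)

Section Holonomy.
Variable R : realType.
Implicit Types (r phi th l s e d : R).

Lemma tr_Zrot th : (Zrot th)^T = Zrot (- th) :> 'M[R]_3.
Proof. by mx3; rewrite ?sinN ?cosN ?opprK. Qed.

Lemma tr_Eflip l : (Eflip l)^T = Eflip l :> 'M[R]_3.
Proof. by mx3. Qed.

Lemma ZrotNK th : Zrot (- th) *m Zrot th = 1%:M :> 'M[R]_3.
Proof. by rewrite ZrotD addNr Zrot0. Qed.

Lemma ZrotKN th : Zrot th *m Zrot (- th) = 1%:M :> 'M[R]_3.
Proof. by rewrite ZrotD subrr Zrot0. Qed.

(** Going once around a triangle: two sides and the three angles determine the
    third side. *)
Lemma triangle_holonomy (T : triangle R) : Eflip (tlen T c1) =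
  Zrot (tang T c2) *m Eflip (tlen T c2) *m Zrot (tang T c0) *m
    Eflip (tlen T c0) *m Zrot (tang T c1).
Proof.
have [Q [rQ _ _ H _]] := triangle_frames T.
have H0 := H c0; have H1 := H c1; have H2 := H c2.
have -> : Zrot (tang T c1) =
    Eflip (tlen T c0) *m Q c0 *m (Q c1)^T :> 'M[R]_3.
  rewrite H0 -mulmxA (_ : ordS c0 = c1); last exact: val_inj.
  by case: (rQ c1) => -> _; rewrite mulmx1.
rewrite -!mulmxA (mulmxA (Eflip (tlen T c0))) EflipK mul1mx.
rewrite (mulmxA (Zrot (tang T c0))).
have -> : Zrot (tang T c0) *m Q c0 = Eflip (tlen T c2) *m Q c2 :> 'M[R]_3.
  by rewrite H2 (_ : ordS c2 = c0)//; exact: val_inj.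
rewrite (mulmxA (Eflip (tlen T c2))) (mulmxA (Eflip (tlen T c2))) EflipK mul1mx.
rewrite mulmxA.
have -> : Zrot (tang T c2) *m Q c2 = Eflip (tlen T c1) *m Q c1 :> 'M[R]_3.
  by rewrite H1 (_ : ordS c1 = c2)//; exact: val_inj.
by rewrite -mulmxA; case: (rQ c1) => -> _; rewrite mulmx1.
Qed.

(** The holonomy relation of the kite glued, along the side joining their
    vertices 1 and 2, from a triangle with apex angle a and legs l, and a
    triangle with apex angle d and legs m3, m4. The total angles at the two
    ends of that side are C1 and C2. *)
Definition kite (l m3 m4 a d C1 C2 : R) := Eflip m4 *m Zrot d *m Eflip m3 =
  Zrot (- C1) *m Eflip l *m Zrot (- a) *m Eflip l *m Zrot (- C2).

Lemma glued_triangles_kite (S T : triangle R) :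
  tlen S c0 = tlen S c2 -> tlen S c1 = tlen T c1 ->
  kite (tlen S c0) (tlen T c0) (tlen T c2) (tang S c0) (tang T c0)
    (tang S c1 + tang T c2) (tang S c2 + tang T c1).
Proof.
move=> S02 ST; have HT := triangle_holonomy T.
have HS : (Eflip (tlen S c1))^T = (Zrot (tang S c2) *m Eflip (tlen S c2) *m
  Zrot (tang S c0) *m Eflip (tlen S c0) *m Zrot (tang S c1))^T.
  by congr (_^T); exact: triangle_holonomy.
rewrite tr_Eflip !trmx_mul !tr_Eflip !tr_Zrot ST HT in HS.
rewrite /kite !opprD (addrC (- tang S c1)) -!ZrotD.
have -> : Eflip (tlen T c2) *m Zrot (tang T c0) *m Eflip (tlen T c0) =
    Zrot (- tang T c2) *m (Zrot (tang T c2) *m Eflip (tlen T c2) *m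
    Zrot (tang T c0) *m Eflip (tlen T c0) *m Zrot (tang T c1)) *m Zrot (- tang T c1).
  by rewrite !mulmxA ZrotNK mul1mx -!mulmxA ZrotKN mulmx1.
by rewrite HS -S02 -!mulmxA.
Qed.

Definition cos_gap (l m C : R) := cos l * cos m + sin l * sin m * cos C.

Lemma flip_turn_flip22 l m C : (Eflip l *m Zrot C *m Eflip m) c2 c2 = cos_gap l m C.
Proof. by rewrite !mulmx3 !mxE/= /cos_gap; ring. Qed.

(** The inner product of the developments of the two apices of a kite, read off
    at either of the two other corners. *)
Lemma kite_cos_gap l m3 m4 a d C1 C2 : kite l m3 m4 a d C1 C2 ->
  cos_gap l m4 C1 = cos_gap l m3 C2.
Proof.
move=> K; pose M := Eflip l *m Zrot C1 *m (Eflip m4 *m Zrot d *m Eflip m3) *m Eflip m3.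
have E1 : M = Eflip l *m Zrot C1 *m Eflip m4 *m Zrot d.
  by rewrite /M -!mulmxA EflipK mulmx1.
have E2 : M = Zrot (- a) *m (Eflip l *m Zrot (- C2) *m Eflip m3).
  rewrite /M K -!mulmxA (mulmxA (Zrot C1)) ZrotKN mul1mx.
  by rewrite (mulmxA (Eflip l)) EflipK mul1mx.
have e1 : M c2 c2 = cos_gap l m4 C1.
  rewrite E1 [LHS]mulmx3 flip_turn_flip22.
  by rewrite ![Zrot _ _ _]mxE/=; ring.
have e2 : M c2 c2 = cos_gap l m3 (- C2).
  rewrite E2 [LHS]mulmx3 flip_turn_flip22.
  by rewrite ![Zrot _ _ _]mxE/=; ring.
by rewrite -e1 e2 /cos_gap cosN.
Qed.

(** Of the rotation M between the two axes only the entry y = M c2 c2 matters: it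
    equals the opposite 2 x 2 minor, and since the rows and columns have norm 1 it
    determines the sums of squares that occur in the trace. *)
Lemma trace_formula l m C a b : let y := cos_gap l m C in
  \tr (Zrot a *m (Eflip l *m Zrot C *m Eflip m) *m Zrot b *m
        (Eflip l *m Zrot C *m Eflip m)^T) =
  cos a * cos b * (1 + y ^+ 2) - 2 * (sin a * sin b) * y
  + (cos a + cos b) * (1 - y ^+ 2) + y ^+ 2.
Proof.
move=> y; set M := Eflip l *m Zrot C *m Eflip m.
have rM : rotation M.
  apply: rotationM; last exact: rotation_Eflip.
  by apply: rotationM; [exact: rotation_Eflip | exact: rotation_Zrot].
have M22 : M c2 c2 = y by exact: flip_turn_flip22.
have minor : M c0 c0 * M c1 c1 - M c0 c1 * M c1 c0 = y.
  rewrite /M !mulmx3 !mxE/= /y /cos_gap; have cs := cos2Dsin2 C.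
  transitivity (cos l * cos m * (cos C ^+ 2 + sin C ^+ 2) + sin l * sin m * cos C).
    by ring.
  by rewrite cs mulr1.
clearbody M.
have row_ i : M i c0 ^+ 2 + M i c1 ^+ 2 + M i c2 ^+ 2 = 1.
  have : (M *m M^T) i i = 1 by case: rM => -> _; rewrite mxE eqxx.
  by rewrite mulmx3 ![M^T _ _]mxE -!expr2.
have col_ i : M c0 i ^+ 2 + M c1 i ^+ 2 + M c2 i ^+ 2 = 1.
  have : (M^T *m M) i i = 1 by rewrite rotationTK// mxE eqxx.
  by rewrite mulmx3 ![M^T _ _]mxE -!expr2.
have h3 : M c0 c2 ^+ 2 + M c1 c2 ^+ 2 = 1 - y ^+ 2.
  by have := col_ c2; rewrite M22; lra.
have h4 : M c2 c0 ^+ 2 + M c2 c1 ^+ 2 = 1 - y ^+ 2.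
  by have := row_ c2; rewrite M22; lra.
have h1 : M c0 c0 ^+ 2 + M c0 c1 ^+ 2 + M c1 c0 ^+ 2 + M c1 c1 ^+ 2 = 1 + y ^+ 2.
  by have := row_ c0; have := row_ c1; lra.
rewrite /mxtrace sum3 !mulmx3 ![M^T _ _]mxE ![Zrot _ _ _]mxE/=.
rewrite -h1 -h3 -{1}minor -M22.
have -> : (cos a + cos b) * (M c0 c2 ^+ 2 + M c1 c2 ^+ 2) =
  cos a * (M c0 c2 ^+ 2 + M c1 c2 ^+ 2) + cos b * (M c2 c0 ^+ 2 + M c2 c1 ^+ 2).
  by rewrite h3 h4; ring.
by rewrite M22; ring.
Qed.

(** The cone point C carries no holonomy, its angle being 4 pi. Hence the
    rotations about the three other cone points multiply to the identity, and
    the trace of one of them, written as a product of the other two, gives an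
    equation for the angle between the axes of these. *)
Lemma two_kites_cos_gap l1 l2 l3 l4 a b d1 d2 C1 C2 C3 C4 :
  kite l1 l3 l4 a d1 C1 C2 -> kite l2 l4 l3 b d2 C3 C4 ->
  d1 + d2 = a + b -> C1 + C2 + C3 + C4 = 4 * pi ->
  let y := cos_gap l1 l4 C1 in
  (y + 1) * ((y - 1) * (1 - cos a) * (1 - cos (a + b)) - 2 * (sin a * sin (a + b))) = 0.
Proof.
move=> K1 K2 dd CC y.
set X := Eflip l1 *m Zrot C1 *m Eflip l4.
have ZC : Zrot (- C2) *m Zrot (- C3) = Zrot (C1 + C4) :> 'M[R]_3.
  rewrite ZrotD; have -> : C1 + C4 = - C2 + - C3 + pi *+ 2 + pi *+ 2 by lra.
  by rewrite /Zrot !cosD2pi !sinD2pi.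
have prod : Eflip l4 *m Zrot (a + b) *m Eflip l4 =
  Zrot (- C1) *m Eflip l1 *m Zrot (- a) *m Eflip l1 *m Zrot (C1 + C4)
    *m (Eflip l2 *m Zrot (- b) *m Eflip l2 *m Zrot (- C4)).
  transitivity ((Eflip l4 *m Zrot d1 *m Eflip l3) *m (Eflip l3 *m Zrot d2 *m Eflip l4)).
    rewrite -!mulmxA (mulmxA (Eflip l3)) EflipK mul1mx.
    by rewrite (mulmxA (Zrot d1)) ZrotD dd.
  by rewrite K1 K2 -ZC -!mulmxA.
have conj : Zrot a *m X *m Zrot (a + b) *m X^T =
  (Eflip l1 *m Zrot (C1 + C4) *m Eflip l2) *m Zrot (- b) *m
  (Eflip l2 *m Zrot (- (C1 + C4)) *m Eflip l1).
  rewrite /X !trmx_mul !tr_Eflip tr_Zrot.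
  transitivity (Zrot a *m Eflip l1 *m Zrot C1 *m
    (Eflip l4 *m Zrot (a + b) *m Eflip l4) *m Zrot (- C1) *m Eflip l1).
    by rewrite !mulmxA.
  rewrite prod opprD (addrC (- C1)) -!ZrotD -!mulmxA.
  rewrite (mulmxA (Zrot C1) (Zrot (- C1))) ZrotKN mul1mx.
  rewrite (mulmxA (Eflip l1) (Eflip l1)) EflipK mul1mx.
  by rewrite (mulmxA (Zrot a) (Zrot (- a))) ZrotKN mul1mx.
have tr1 : \tr (Zrot a *m X *m Zrot (a + b) *m X^T) = 1 + 2 * cos b.
  rewrite conj mxtrace_mulC !mulmxA -(mulmxA _ (Eflip l1) (Eflip l1)) EflipK mulmx1.
  rewrite -(mulmxA (Eflip l2) (Zrot _) (Zrot _)) ZrotNK mulmx1 EflipK mul1mx.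
  by rewrite /mxtrace sum3 !mxE/= cosN; ring.
have := trace_formula l1 l4 C1 a (a + b); rewrite /= -/X -/y tr1 => E.
have cb : cos b = cos (a + b) * cos a + sin (a + b) * sin a.
  by rewrite -cosB; congr cos; ring.
by rewrite cb in E; lra.
Qed.

Lemma cos1_turn (x : R) : 0 < x -> cos x = 1 -> exists k : int, x = 2 * pi * k%:~R.
Proof.
move=> x0 cx; have p0 : 0 < 2 * pi :> R by have := pi_gt0 R; lra.
pose n := Num.truncn (x / (2 * pi)).
have /andP[n1 n2] := @truncn_itv R (x / (2 * pi)) (ltW (divr_gt0 x0 p0)).
rewrite -/n ler_pdivlMr// in n1; rewrite -/n ltr_pdivrMr// in n2.
exists n; rewrite mulrC -[RHS]/(n%:R * (2 * pi)).
apply/eqP; rewrite -subr_eq0; apply: contrapT => /negP nz.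
have h : 0 < x - n%:R * (2 * pi) < 2 * pi.
  rewrite lt_neqAle eq_sym nz/= subr_ge0 n1 ltrBlDl.
  by move: n2; rewrite -addn1 natrD mulrDl mul1r.
have := cos_lt1 h; have -> : cos (x - n%:R * (2 * pi)) = cos x.
  have -> : n%:R * (2 * pi) = (pi *+ 2) *+ n :> R by rewrite -(mulr_natl (pi *+ 2)) -(mulr_natl pi 2).
  by rewrite -[in RHS](subrK ((pi *+ 2) *+ n) x) (periodicn (@cosD2pi R)).
by rewrite cx ltxx.
Qed.

Lemma cos_gap1 l m C : 0 < l < pi -> 0 < m < pi ->
  cos_gap l m C = 1 -> cos C = 1.
Proof.
move=> lp mp; have sl := sin_gt0_pi lp; have sm := sin_gt0_pi mp.
rewrite /cos_gap => E; have c1 := cos_le1 C.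
have := cos_le1 (l - m); rewrite cosB => h.
have p0 : 0 < sin l * sin m by exact: mulr_gt0.
by apply/eqP; rewrite eq_le c1/=; nra.
Qed.

Lemma cos_gapN1 l m C : 0 < l < pi -> 0 < m < pi ->
  cos_gap l m C = -1 -> cos C = -1 /\ l + m = pi.
Proof.
move=> lp mp; have sl := sin_gt0_pi lp; have sm := sin_gt0_pi mp.
rewrite /cos_gap => E; have c1 := cos_geN1 C.
have := cos_geN1 (l + m); rewrite cosD => h.
have p0 : 0 < sin l * sin m by exact: mulr_gt0.
have cC : cos C = -1 by apply/eqP; rewrite eq_le c1 andbT; nra.
split=> //; rewrite cC in E.
have clm : cos (l + m) = -1 by rewrite cosD; lra.
have : cos `|l + m - pi| = 1 by rewrite cos_norm cosB clm cospi sinpi; ring.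
have [/eqP|n0] := eqVneq (l + m - pi) 0; first by rewrite subr_eq0 => /eqP.
have p1 := pi_gt0 R.
have h1 : `|l + m - pi| < 2 * pi by rewrite ltr_norml; apply/andP; split; lra.
by move=> E1; have := @cos_lt1 R `|l + m - pi|; rewrite E1 ltxx normr_gt0 n0 h1 => /(_ isT).
Qed.

(** The inner product y of the two apices of the first kite, as a function of
    the lengths alone: its product with a nonzero factor is polynomial in the
    sines and cosines of the lengths, because the cosine law gives the angles
    d1, d2 at D up to sign and their sum a + b fixes the sign. *)
Definition gap_poly (a b l1 l2 l3 l4 : R) :=
  let p := sin l1 * cos l1 * (1 - cos a) in
  let q := sin l1 * sin a in
  let D1 := cos l1 ^+ 2 + sin l1 ^+ 2 * cos a - cos l3 * cos l4 in
  let D2 := cos l2 ^+ 2 + sin l2 ^+ 2 * cos b - cos l3 * cos l4 in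
  sin (a + b) * (p ^+ 2 + q ^+ 2) * (cos l1 * cos l3)
  + sin (a + b) * p * sin l1 * (sin l3 ^+ 2 * cos l4 - cos l3 * D1)
  - q * sin l1 * (D2 - cos (a + b) * D1).

Lemma kite_cos_law l m3 m4 a d C1 C2 : kite l m3 m4 a d C1 C2 ->
  sin m3 * sin m4 * cos d = cos l ^+ 2 + sin l ^+ 2 * cos a - cos m3 * cos m4.
Proof.
move=> K; have := congr1 (fun M : 'M[R]_3 => M c2 c2) K.
by rewrite /= !mulmx3 !mxE/= ?cosN ?sinN; lra.
Qed.

Lemma kite_cos_corner l m3 m4 a d C1 C2 : kite l m3 m4 a d C1 C2 ->
  let p := sin l * cos l * (1 - cos a) in
  let q := sin l * sin a in
  (p ^+ 2 + q ^+ 2) * cos C2 =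
  (sin m3 * cos m4 - cos m3 * sin m4 * cos d) * p - sin m4 * sin d * q.
Proof.
move=> K p q; have e0 := congr1 (fun M : 'M[R]_3 => M c2 c0) K.
have e1 := congr1 (fun M : 'M[R]_3 => M c2 c1) K.
move: e0 e1; rewrite /= !mulmx3 !mxE/= ?cosN ?sinN => e0 e1.
have -> : sin m3 * cos m4 - cos m3 * sin m4 * cos d = p * cos C2 + q * sin C2.
  by rewrite /p /q; lra.
have -> : sin m4 * sin d = p * sin C2 - q * cos C2 by rewrite /p /q; lra.
ring.
Qed.

Lemma gap_polyP a b l1 l2 l3 l4 d1 d2 C1 C2 C3 C4 :
  kite l1 l3 l4 a d1 C1 C2 -> kite l2 l4 l3 b d2 C3 C4 -> d1 + d2 = a + b ->
  gap_poly a b l1 l2 l3 l4 = sin (a + b) *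
    ((sin l1 * cos l1 * (1 - cos a)) ^+ 2 + (sin l1 * sin a) ^+ 2) * cos_gap l1 l3 C2.
Proof.
move=> K1 K2 dd; have := kite_cos_corner K1; rewrite /=.
rewrite /gap_poly /cos_gap -(kite_cos_law K1).
have -> : cos l2 ^+ 2 + sin l2 ^+ 2 * cos b - cos l3 * cos l4 =
    sin l3 * sin l4 * cos d2 by have := kite_cos_law K2; lra.
set p := sin l1 * cos l1 * _; set q := sin l1 * sin a => E.
have -> : cos d2 = cos (a + b) * cos d1 + sin (a + b) * sin d1.
  by rewrite -cosB -dd; congr cos; ring.
transitivity (sin (a + b) * (p ^+ 2 + q ^+ 2) * (cos l1 * cos l3) +
  sin (a + b) * (sin l1 * sin l3) * ((p ^+ 2 + q ^+ 2) * cos C2)); last by ring.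
by rewrite E; ring.
Qed.

Lemma gap_poly_base a b t : gap_poly a b (pi - t) (pi - t) t t = - (sin (a + b) *
    ((sin (pi - t) * cos (pi - t) * (1 - cos a)) ^+ 2 + (sin (pi - t) * sin a) ^+ 2)).
Proof.
rewrite /gap_poly sin_sub_pi cos_sub_pi !sqrrN; have := cos2Dsin2 t.
set s := sin t; set c := cos t => cs.
have -> : c ^+ 2 + s ^+ 2 * cos a - c * c = s ^+ 2 * cos a by ring.
have -> : c ^+ 2 + s ^+ 2 * cos b - c * c = s ^+ 2 * cos b by ring.
have cb : cos b = cos (a + b) * cos a + sin (a + b) * sin a.
  by rewrite -cosB; congr cos; ring.
have -> : s ^+ 2 * cos b - cos (a + b) * (s ^+ 2 * cos a) =
  s ^+ 2 * (sin (a + b) * sin a) by rewrite cb; ring.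
have -> : s * - c * (1 - cos a) = - (s * c * (1 - cos a)) by ring.
set S := sin (a + b); set P := 1 - cos a; set A := sin a.
have -> : cos a = 1 - P by rewrite /P; ring.
have c2 : c ^+ 2 = 1 - s ^+ 2 by lra.
transitivity (- (S * ((s * c * P) ^+ 2 * (c ^+ 2 + s ^+ 2) + (s * A) ^+ 2 * (c ^+ 2 + s ^+ 2)))).
  ring.
by rewrite cs; ring.
Qed.

Definition cont_at (X : topologicalType) (z : X) (f : X -> R) := f x @[x --> z] --> f z.

Lemma cont_at_cst (X : topologicalType) (z : X) c : cont_at z (fun=> c).
Proof. exact: cvg_cst. Qed.

Lemma cont_atD (X : topologicalType) (z : X) (f g : X -> R) :
  cont_at z f -> cont_at z g -> cont_at z (fun x => f x + g x).
Proof. exact: cvgD. Qed.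

Lemma cont_atN (X : topologicalType) (z : X) (f : X -> R) :
  cont_at z f -> cont_at z (fun x => - f x).
Proof. exact: cvgN. Qed.

Lemma cont_atM (X : topologicalType) (z : X) (f g : X -> R) :
  cont_at z f -> cont_at z g -> cont_at z (fun x => f x * g x).
Proof. exact: cvgM. Qed.

Lemma cont_at_sqr (X : topologicalType) (z : X) (f : X -> R) :
  cont_at z f -> cont_at z (fun x => f x ^+ 2).
Proof. by move=> cf; apply: cont_atM. Qed.

Lemma cont_at_comp (X : topologicalType) (z : X) (f : R -> R) (g : X -> R) :
  {for g z, continuous f} -> cont_at z g -> cont_at z (fun x => f (g x)).
Proof. by move=> cf cg; apply: (cvg_comp _ _ cg cf). Qed.

Lemma cont_at_sin (X : topologicalType) (z : X) (g : X -> R) :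
  cont_at z g -> cont_at z (fun x => sin (g x)).
Proof. by apply: cont_at_comp; exact: continuous_sin. Qed.

Lemma cont_at_cos (X : topologicalType) (z : X) (g : X -> R) :
  cont_at z g -> cont_at z (fun x => cos (g x)).
Proof. by apply: cont_at_comp; exact: continuous_cos. Qed.

End Holonomy.

Ltac cont_poly := lazymatch goal with
  | |- cont_at _ (fun x => @?f x + @?g x) => apply: (cont_atD (f := f) (g := g)); cont_poly
  | |- cont_at _ (fun x => - @?f x) => apply: (cont_atN (f := f)); cont_poly
  | |- cont_at _ (fun x => @?f x * @?g x) => apply: (cont_atM (f := f) (g := g)); cont_poly
  | |- cont_at _ (fun x => @?f x ^+ 2) => apply: (cont_at_sqr (f := f)); cont_poly
  | |- cont_at _ (fun x => sin (@?f x)) => apply: (cont_at_sin (g := f)); cont_poly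
  | |- cont_at _ (fun x => cos (@?f x)) => apply: (cont_at_cos (g := f)); cont_poly
  | |- cont_at _ (fun x => fst _) => idtac
  | |- cont_at _ (fun x => snd _) => idtac
  | |- cont_at _ (fun x => ?c) => exact: cont_at_cst
  | _ => idtac
  end.

Section Rigidity.
Variable R : realType.
Implicit Types (r phi th l s e d : R).

Lemma gap_poly_near (a b t c : R) :
  gap_poly a b (pi - t) (pi - t) t t - c * (sin (a + b) *
    ((sin (pi - t) * cos (pi - t) * (1 - cos a)) ^+ 2 + (sin (pi - t) * sin a) ^+ 2)) != 0 ->
  exists2 d, 0 < d & forall l1 l2 l3 l4,
    `|l1 - (pi - t)| < d -> `|l2 - (pi - t)| < d -> `|l3 - t| < d -> `|l4 - t| < d ->
    gap_poly a b l1 l2 l3 l4 - c * (sin (a + b) *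
    ((sin l1 * cos l1 * (1 - cos a)) ^+ 2 + (sin l1 * sin a) ^+ 2)) != 0.
Proof.
move=> nz.
pose H (z : R * R * (R * R)) := gap_poly a b z.1.1 z.1.2 z.2.1 z.2.2 - c * (sin (a + b) *
    ((sin z.1.1 * cos z.1.1 * (1 - cos a)) ^+ 2 + (sin z.1.1 * sin a) ^+ 2)).
pose z0 := ((pi - t, pi - t), (t, t)) : R * R * (R * R).
have cH : cont_at z0 H.
  rewrite /H /gap_poly /=.
  cont_poly; first [apply: (@cvg_comp _ _ _ fst fst _ (nbhs z0.1)); exact: cvg_fst
    |apply: (@cvg_comp _ _ _ fst snd _ (nbhs z0.1)); [exact: cvg_fst|exact: cvg_snd]
    |apply: (@cvg_comp _ _ _ snd fst _ (nbhs z0.2)); [exact: cvg_snd|exact: cvg_fst]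
    |apply: (@cvg_comp _ _ _ snd snd _ (nbhs z0.2)); exact: cvg_snd].
have /cvg_ballP/(_ `|H z0|) := cH; rewrite normr_gt0 => /(_ nz).
move=> /nbhs_ballP[d /= d0 Hd]; exists d => // l1 l2 l3 l4 h1 h2 h3 h4.
apply/eqP => E; have hb : ball z0 d ((l1, l2), (l3, l4)).
  by split; split; rewrite /ball/= distrC.
by have := Hd _ hb; rewrite /ball/= [H (_, _)]E subr0 ltxx.
Qed.

(** If the axes of A and D coincide but point the same way, the corners of the
    first kite are even multiples of pi, which leaves too little angle at C. *)
Lemma corners_of_gap (l1 l2 l3 l4 a b d1 d2 C1 C2 C3 C4 : R) :
  0 < l1 < pi -> 0 < l2 < pi -> 0 < l3 < pi -> 0 < l4 < pi ->
  0 < C1 -> 0 < C2 -> 0 < C3 -> 0 < C4 -> C1 + C2 + C3 + C4 = 4 * pi ->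
  kite l1 l3 l4 a d1 C1 C2 -> kite l2 l4 l3 b d2 C3 C4 ->
  cos_gap l1 l4 C1 ^+ 2 = 1 -> cos_gap l2 l3 C3 ^+ 2 = 1 ->
  and (and4 (l1 + l3 = pi) (l1 + l4 = pi) (l2 + l3 = pi) (l2 + l4 = pi))
    (and4 (C1 = pi) (C2 = pi) (C3 = pi) (C4 = pi)).
Proof.
move=> l1p l2p l3p l4p C10 C20 C30 C40 CC K1 K2 g1 g2.
have p0 := pi_gt0 R.
have E1 := kite_cos_gap K1; have E2 := kite_cos_gap K2.
have dich (l m m' C C' : R) : 0 < l < pi -> 0 < m < pi -> 0 < m' < pi -> 0 < C -> 0 < C' ->
    cos_gap l m C = cos_gap l m' C' -> cos_gap l m C ^+ 2 = 1 ->
    2 * pi <= C /\ 2 * pi <= C' \/ and4 (pi <= C) (pi <= C') (l + m = pi) (l + m' = pi).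
  move=> lp mp mp' C0 C0' E /eqP; rewrite sqrf_eq1 => /orP[]/eqP g.
    left; split; apply: cos_eq1_ge2pi => //; first exact: cos_gap1 g.
    by apply: (@cos_gap1 R l m'); rewrite -?E.
  have [cC lm] := cos_gapN1 lp mp g; rewrite E in g.
  have [cC' lm'] := cos_gapN1 lp mp' g.
  by right; split=> //; exact: cos_eqN1_gepi.
have D1 := dich _ _ _ _ _ l1p l4p l3p C10 C20 E1 g1.
have D2 := dich _ _ _ _ _ l2p l3p l4p C30 C40 E2 g2.
clear K1 K2 E1 E2 g1 g2 dich.
case: D1 => [[]|[]] ? ? => [|? ?]; case: D2 => [[]|[]] ? ? => [|? ?];
  by split; split; near_lra.
Qed.

(** The angles at A, B and D are not multiples of 2 pi. Unless one of them is an
    odd multiple of pi, the apices A and D of a kite near the given one are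
    nearly antipodal, and [two_kites_cos_gap] leaves a discrete set of values for
    their distance; otherwise the equation itself puts the three axes on one
    line. *)
Lemma kites_near_base (a b t : R) : 0 < t < pi -> cos a != 1 -> cos b != 1 ->
  cos (a + b) != 1 -> exists2 d, 0 < d & forall l1 l2 l3 l4,
    `|l1 - (pi - t)| < d -> `|l2 - (pi - t)| < d -> `|l3 - t| < d -> `|l4 - t| < d ->
    forall d1 d2 C1 C2 C3 C4,
    kite l1 l3 l4 a d1 C1 C2 -> kite l2 l4 l3 b d2 C3 C4 ->
    d1 + d2 = a + b -> C1 + C2 + C3 + C4 = 4 * pi -> cos_gap l1 l4 C1 ^+ 2 = 1.
Proof.
move=> tp a1 b1 ab1; have p0 := pi_gt0 R.
have ca := cos_le1 a; have cab := cos_le1 (a + b).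
have a10 : 0 < 1 - cos a by rewrite subr_gt0 lt_neqAle a1.
have ab10 : 0 < 1 - cos (a + b) by rewrite subr_gt0 lt_neqAle ab1.
have b10 : 0 < 1 - cos b by rewrite subr_gt0 lt_neqAle b1 cos_le1.
have csa := cos2Dsin2 a; have csb := cos2Dsin2 b; have csab := cos2Dsin2 (a + b).
have cbE : cos b = cos (a + b) * cos a + sin (a + b) * sin a.
  by rewrite -cosB; congr cos; ring.
have sbE : sin b = sin (a + b) * cos a - cos (a + b) * sin a.
  by rewrite -sinB; congr sin; ring.
have eqy l1 l2 l3 l4 d1 d2 C1 C2 C3 C4 :
    kite l1 l3 l4 a d1 C1 C2 -> kite l2 l4 l3 b d2 C3 C4 ->
    d1 + d2 = a + b -> C1 + C2 + C3 + C4 = 4 * pi ->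
    let y := cos_gap l1 l4 C1 in y = -1 \/
    (y - 1) * (1 - cos a) * (1 - cos (a + b)) = 2 * (sin a * sin (a + b)).
  move=> K1 K2 dd CC y; have /= /eqP := two_kites_cos_gap K1 K2 dd CC.
  rewrite mulf_eq0 -/y => /orP[]/eqP h; [left|right]; lra.
have [sz|sN] := eqVneq (sin a * sin (a + b)) 0.
  exists 1 => // l1 l2 l3 l4 _ _ _ _ d1 d2 C1 C2 C3 C4 K1 K2 dd CC.
  have [->|] := eqy _ _ _ _ _ _ _ _ _ _ K1 K2 dd CC; first by rewrite sqrrN expr1n.
  rewrite sz mulr0 => /eqP; rewrite !mulf_eq0 (gt_eqF a10) (gt_eqF ab10) !orbF subr_eq0.
  by move=> /eqP ->; rewrite expr1n.
have [sbz|sbN] := eqVneq (sin b) 0.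
  exists 1 => // l1 l2 l3 l4 _ _ _ _ d1 d2 C1 C2 C3 C4 K1 K2 dd CC.
  have [->|] := eqy _ _ _ _ _ _ _ _ _ _ K1 K2 dd CC; first by rewrite sqrrN expr1n.
  have cb : cos b = -1.
    have : cos b ^+ 2 = 1 by rewrite -csb sbz; ring.
    by move/eqP; rewrite sqrf_eq1 (negbTE b1) /= => /eqP.
  rewrite cosD sinD cb sbz => E.
  have sa0 : sin a != 0 by apply: contraNneq sN => ->; rewrite mul0r.
  have : (cos_gap l1 l4 C1 + 1) * sin a ^+ 2 = 0.
    have := E; have -> : sin a ^+ 2 = (1 - cos a) * (1 + cos a) by lra.
    by lra.
  move/eqP; rewrite mulf_eq0 expf_eq0/= (negbTE sa0) orbF addr_eq0 => /eqP ->.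
  by rewrite sqrrN expr1n.
pose c := 1 + 2 * (sin a * sin (a + b)) / ((1 - cos a) * (1 - cos (a + b))).
have ab0 : (1 - cos a) * (1 - cos (a + b)) != 0 by rewrite gt_eqF// mulr_gt0.
have cN : c != -1.
  apply/eqP => cE.
  have h : sin a * sin (a + b) = - ((1 - cos a) * (1 - cos (a + b))).
    have : (c - 1) * ((1 - cos a) * (1 - cos (a + b))) = 2 * (sin a * sin (a + b)).
      by rewrite /c; field; rewrite ?(gt_eqF a10) ?(gt_eqF ab10).
    by rewrite cE; lra.
  have h2 : (1 - cos a) * (1 - cos (a + b)) = (1 + cos a) * (1 + cos (a + b)).
    apply: (mulfI ab0); transitivity ((sin a * sin (a + b)) ^+ 2); first by rewrite h; ring.
    by rewrite exprMn !sin2cos2; ring.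
  have h3 : cos (a + b) = - cos a by lra.
  have h4 : sin (a + b) = - sin a.
    have sa0 : sin a != 0 by apply: contraNneq sN => ->; rewrite mul0r.
    by apply: (mulfI sa0); rewrite h h3; lra.
  by move/eqP: sbN; apply; rewrite sbE h3 h4; ring.
pose q0 := (sin (pi - t) * cos (pi - t) * (1 - cos a)) ^+ 2 + (sin (pi - t) * sin a) ^+ 2.
have st : 0 < sin t := sin_gt0_pi tp.
have q00 : 0 < q0.
  have sa0 : sin a != 0 by apply: contraNneq sN => ->; rewrite mul0r.
  rewrite /q0 sin_sub_pi ltr_wpDl ?sqr_ge0// exprn_even_gt0//=.
  by rewrite mulf_eq0 (gt_eqF st) (negbTE sa0).
have sab0 : sin (a + b) != 0 by apply: contraNneq sN => ->; rewrite mulr0.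
have [|d dgt Hd] := @gap_poly_near a b t c.
  rewrite gap_poly_base -/q0.
  have -> : - (sin (a + b) * q0) - c * (sin (a + b) * q0) = - ((1 + c) * (sin (a + b) * q0)).
    by ring.
  rewrite oppr_eq0 !mulf_neq0 ?(gt_eqF q00)//.
  by rewrite addrC addr_eq0.
exists d => // l1 l2 l3 l4 h1 h2 h3 h4 d1 d2 C1 C2 C3 C4 K1 K2 dd CC.
have [->|E] := eqy _ _ _ _ _ _ _ _ _ _ K1 K2 dd CC; first by rewrite sqrrN expr1n.
have := Hd l1 l2 l3 l4 h1 h2 h3 h4.
rewrite (gap_polyP K1 K2 dd) -(kite_cos_gap K1).
have -> : cos_gap l1 l4 C1 = c.
  rewrite /c -E; field.
  by rewrite (gt_eqF a10) (gt_eqF ab10).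
by rewrite mulrC subrr eqxx.
Qed.

(** With sides at C shorter than pi, two apices at distance 0 or pi force every
    corner of the kite at C to be a positive multiple of pi, and the total angle
    4 pi leaves pi for each. *)
Lemma near_lengths_rigid (a b t : R) : 0 < t < pi ->
  cos a != 1 -> cos b != 1 -> cos (a + b) != 1 ->
  exists2 d, 0 < d & forall l1 l2 l3 l4,
    `|l1 - (pi - t)| < d -> `|l2 - (pi - t)| < d -> `|l3 - t| < d -> `|l4 - t| < d ->
    forall d1 d2 C1 C2 C3 C4, 0 < C1 -> 0 < C2 -> 0 < C3 -> 0 < C4 ->
    kite l1 l3 l4 a d1 C1 C2 -> kite l2 l4 l3 b d2 C3 C4 ->
    d1 + d2 = a + b -> C1 + C2 + C3 + C4 = 4 * pi ->
    and5 (0 < l3 < pi) (l4 = l3) (l1 = pi - l3) (l2 = pi - l3)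
      (and4 (C1 = pi) (C2 = pi) (C3 = pi) (C4 = pi)).
Proof.
move=> tp a1 b1 ab1; have p0 := pi_gt0 R.
have [d dgt Hd] := kites_near_base tp a1 b1 ab1.
have [|d' dgt' Hd'] := kites_near_base tp b1 a1; first by rewrite addrC.
pose m := Num.min (Num.min d d') (Num.min t (pi - t)).
have md : m <= d by rewrite /m !ge_min lexx.
have md' : m <= d' by rewrite /m !ge_min lexx orbT.
have mt : m <= t by rewrite /m !ge_min lexx !orbT.
have mpt : m <= pi - t by rewrite /m !ge_min lexx !orbT.
exists m; first by rewrite /m !lt_min dgt dgt' /=; near_lra.
move=> l1 l2 l3 l4 h1 h2 h3 h4 d1 d2 C1 C2 C3 C4 C10 C20 C30 C40 K1 K2 dd CC.
have bounds l r : `|l - r| < m -> m <= r -> m <= pi - r -> 0 < l < pi.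
  by rewrite ltr_norml => /andP[? ?] ? ?; near_lra.
have l1p : 0 < l1 < pi by apply: bounds h1 _ _; near_lra.
have l2p : 0 < l2 < pi by apply: bounds h2 _ _; near_lra.
have l3p : 0 < l3 < pi by apply: bounds h3 _ _; near_lra.
have l4p : 0 < l4 < pi by apply: bounds h4 _ _; near_lra.
have g1 : cos_gap l1 l4 C1 ^+ 2 = 1.
  by apply: (Hd _ _ _ _ _ _ _ _ _ _ _ _ _ _ K1 K2 dd CC); exact: lt_le_trans md.
have g2 : cos_gap l2 l3 C3 ^+ 2 = 1.
  by apply: (Hd' _ _ _ _ _ _ _ _ _ _ _ _ _ _ K2 K1); rewrite ?(addrC d2) ?(addrC b)//;
    [exact: lt_le_trans md'..|near_lra].
have [[e1 e2 e3 e4] eC] := corners_of_gap l1p l2p l3p l4p C10 C20 C30 C40 CC K1 K2 g1 g2.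
by split=> //; near_lra.
Qed.

End Rigidity.

(** * Local inversion of the developing map *)

Section LocalInversion.
Variable R : realType.
Implicit Types (r phi th s e d : R) (u v w : 'rV[R]_3) (P Q M : 'M[R]_3).
Implicit Types (x y p q : R * R) (D : set (R * R)).

Lemma fan_center D dev x th ray0 ray1 Q : 0 <= th ->
  fan D dev x th ray0 ray1 Q -> D x /\ dev x = polar 0 0 *m Q.
Proof.
move=> th0 [rQ [e [psi [e0 [H _ _ H0 _]]]]].
have s0 : sector e th (0, 0) by split=> /=; near_lra.
by have := H _ _ s0; rewrite H0//; near_lra.
Qed.

Lemma fan_inj D dev x th ray0 ray1 Q :
  fan D dev x th ray0 ray1 Q -> th < 2 * pi \/ th = 2 * pi /\ ray0 = ray1 ->
  exists2 d, 0 < d & forall y z, D y -> D z -> ball x d y -> ball x d z ->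
    dev y = dev z -> y = z.
Proof.
move=> [rQ [e [psi [e0 [H [d d0 Hd] _ H0 Hray]]]]] hth; exists d => // y z Dy Dz xy xz.
have [r [phi [s <-]]] := Hd y Dy xy; have [r' [phi' [s' <-]]] := Hd z Dz xz.
have [_ ->] := H _ _ s; have [_ ->] := H _ _ s'.
move=> /(rotation_mulr_inj rQ).
have [/= hr hp] := s; have [/= hr' hp'] := s'.
have thpi : th <= 2 * pi by case: hth => [/ltW//|[->]].
have rI : 0 <= r <= pi by near_lra.
have rI' : 0 <= r' <= pi by near_lra.
move=> /(polar_inj rI rI')[E]; rewrite -{}E in hr' s' *.
move=> [sr|[cphi sphi]].
  have r0 : r = 0.
    apply/eqP; rewrite eq_le leNgt andbC; case/andP: hr => -> _ /=; apply/negP => r0.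
    by have := @sin_gt0_pi R r; rewrite sr ltxx r0 /= => /(_ ltac:(near_lra)).
  by rewrite r0 !H0.
have pI : 0 <= phi <= 2 * pi by near_lra.
have pI' : 0 <= phi' <= 2 * pi by near_lra.
have [_ hR] := Hray r hr; have [hL _] := Hray r hr.
case: (angle_eq_or_turn pI pI' cphi sphi) => [->//|[e1 e2]|[e1 e2]].
  have th2 : th = 2 * pi by near_lra.
  case: hth => [?|[_ Er]]; first by exfalso; near_lra.
  by move: hR; rewrite th2 e1 e2 hL Er.
have th2 : th = 2 * pi by near_lra.
case: hth => [?|[_ Er]]; first by exfalso; near_lra.
by move: hR; rewrite th2 e1 e2 hL Er.
Qed.

(** A fan with total angle 2 pi, or pi on the inner side of a side, develops
    onto a neighbourhood of its centre in the sphere, respectively in the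
    hemisphere. *)
Lemma fan_surj D dev x th ray0 ray1 Q : fan D dev x th ray0 ray1 Q -> 0 <= th ->
  forall e, 0 < e -> exists2 d, 0 < d & forall v, dot v v = 1 -> ball (dev x) d v ->
    th = 2 * pi \/ (th = pi /\ 0 <= (v *m Q^T) 0 c1) ->
    exists y, [/\ D y, ball x e y & dev y = v].
Proof.
move=> F th0 e e0; have [_ devx] := fan_center th0 F.
have [rQ [e1 [psi [e10 [H _ Hs _ _]]]]] := F.
have [d d0 Hd] := Hs e e0.
pose r0 := Num.min d e1.
have r00 : 0 < r0 by rewrite lt_min d0; case/andP: e10.
have r0d : r0 <= d by rewrite ge_min lexx.
have r0e : r0 <= e1 by rewrite ge_min lexx orbT.
have cr0 : cos r0 < 1 by apply: cos_lt1; have := pi_gt0 R; near_lra.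
have [d' d'0 Hd'] := @close_dot R (1 - cos r0) ltac:(near_lra).
exists d' => // v v1 xv hth; pose w := v *m Q^T.
have vw : v = w *m Q by rewrite /w -mulmxA rotationTK// mulmx1.
have w1 : dot w w = 1 by rewrite /w dot_rotation//; exact: rotation_tr.
have [r [phi wE [rI phiI phiI']]] := polar_surj w1.
have rr : r < r0.
  have := Hd' _ _ _ v1 xv; rewrite devx {1}dot_rotation// dot_polar_unit => /(_ erefl).
  rewrite vw dot_rotation// wE dot_polar_center => cr.
  have : cos r0 < cos r by near_lra.
  by rewrite ltr_cos// in_itv/=; near_lra.
have s : sector e1 th (r, phi).
  split=> /=; first by near_lra.
  by case: hth => [->|[-> hv]]; [near_lra | have := phiI' hv; near_lra].
have [Dy Ey] := H _ _ s.
exists (psi (r, phi)); split=> //; first by apply: Hd => //; near_lra.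
by rewrite Ey -wE -vw.
Qed.

Lemma fan_half D dev x ray0 ray1 Q : fan D dev x pi ray0 ray1 Q ->
  exists2 d, 0 < d & forall y, D y -> ball x d y -> 0 <= (dev y *m Q^T) 0 c1.
Proof.
move=> [rQ [e [psi [e0 [H [d d0 Hd] _ _ _]]]]]; exists d => // y Dy xy.
have [r [phi [s <-]]] := Hd y Dy xy; have [_ ->] := H _ _ s.
rewrite -mulmxA; case: rQ => -> _; rewrite mulmx1 polarE.
by case: s => /= h1 h2; rewrite mulr_ge0// sin_ge0_pi; near_lra.
Qed.

Lemma continuous_ball (f : R -> R) (x : R) : {for x, continuous f} -> forall e, 0 < e ->
  exists2 d, 0 < d & forall y : R, `|x - y| < d -> `|f x - f y| < e.
Proof.
move=> /cvg_ballP H e /H /nbhs_ballP[d d0 Hd]; exists d => // y; exact: Hd.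
Qed.

Lemma asin0 : asin 0 = 0 :> R.
Proof.
rewrite -[in LHS](@sin0 R) sinK// in_itv/=; have := pi_gt0 R; near_lra.
Qed.

(** Polar coordinates on the open half-sphere of positive first coordinate; there
    the longitude is an arc sine. *)
Lemma half_sphere_polar (X Y Z : R) : 0 < X -> X ^+ 2 + Y ^+ 2 + Z ^+ 2 = 1 ->
  let S := sin (acos Z) in
  and5 (-1 < Z < 1) (0 < S) (X <= S) (-1 < Y / S < 1)
    [/\ cos (acos Z) = Z, sin (asin (Y / S)) = Y / S & cos (asin (Y / S)) = X / S].
Proof.
move=> X0 w1; have Z1 : -1 < Z < 1 by apply/andP; split; nra.
have ZI : -1 <= Z <= 1 by lra.
have cr : cos (acos Z) = Z by rewrite acosK// in_itv.
have sr0 : 0 <= sin (acos Z) by apply: sin_ge0_pi; rewrite acos_ge0//= acos_lepi.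
have sr2 : sin (acos Z) ^+ 2 = X ^+ 2 + Y ^+ 2 by rewrite sin2cos2 cr; lra.
move: (sin (acos Z)) sr0 sr2 => S sr0 sr2 /=.
have srX : X <= S by nra.
have S0 : 0 < S by lra.
have YS : -1 < Y / S < 1.
  by rewrite ltr_pdivlMr// ltr_pdivrMr//; apply/andP; split; nra.
have YI : -1 <= Y / S <= 1 by lra.
split=> //; split=> //; first by rewrite asinK// in_itv.
rewrite cos_asin//.
have -> : 1 - (Y / S) ^+ 2 = (X / S) ^+ 2.
  by rewrite !expr_div_n; apply/eqP; rewrite subr_eq -mulrDl -sr2 divff// expf_neq0// gt_eqF.
by rewrite sqrtr_sqr ger0_norm// divr_ge0// ltW.
Qed.

(** Away from the poles the polar coordinates of a unit vector near polar p can
    be chosen near p: the colatitude is an arc cosine, the longitude an arc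
    sine. *)
Lemma polar_local_inverse p e : 0 < p.1 < pi -> 0 < e -> exists2 d, 0 < d &
  forall v, dot v v = 1 -> ball (polar p.1 p.2) d v ->
    exists q, ball p e q /\ v = polar q.1 q.2.
Proof.
move=> pI e0; have sp := sin_gt0_pi pI.
have cp : -1 < cos p.1 < 1.
  by rewrite cos_gtN1 ?cos_lt1//; have := pi_gt0 R; near_lra.
have [da da0 Ha] := continuous_ball (continuous_acos cp) e0.
have z1 : -1 < (0 : R) < 1 by apply/andP; split; near_lra.
have [ds ds0 Hs] := continuous_ball (continuous_asin z1) e0.
pose e' := Num.min (Num.min da (sin p.1 / 2)) (Num.min (ds * (sin p.1 / 2)) (Num.min (1 - cos p.1) (1 + cos p.1))).
have e'0 : 0 < e' by rewrite !lt_min da0 !mulr_gt0 ?divr_gt0//=; near_lra.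
have e1 : e' <= da by rewrite /e' !ge_min lexx.
have e2 : e' <= sin p.1 / 2 by rewrite /e' !ge_min lexx ?orbT.
have e3 : e' <= ds * (sin p.1 / 2) by rewrite /e' !ge_min lexx ?orbT.
have e4 : e' <= 1 - cos p.1 by rewrite /e' !ge_min lexx ?orbT.
have e5 : e' <= 1 + cos p.1 by rewrite /e' !ge_min lexx ?orbT.
have [d d0 Hd] := @mulmx_ball R (Zrot (- p.2)) _ e'0.
exists d => // v v1 /Hd; rewrite polar_Zrot subrr.
set w := v *m Zrot (- p.2); move=> [_ bw].
have vw : v = w *m Zrot p.2 by rewrite /w -mulmxA ZrotD addNr Zrot0 mulmx1.
have w1 : dot w w = 1 by rewrite /w dot_rotation//; exact: rotation_Zrot.
have := bw 0 c0; have := bw 0 c1; have := bw 0 c2; clear bw.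
rewrite /ball/= !polarE sin0 cos0 mulr0 mulr1 sub0r normrN => b2 b1 b0.
clearbody w; move: w1; rewrite dotE.
set X := w 0 c0 in b0 *; set Y := w 0 c1 in b1 *; set Z := w 0 c2 in b2 * => w1.
have X0 : sin p.1 / 2 < X by move: b0; rewrite ltr_norml; near_lra.
have [|//|Z1 S0 srX YS [cr sD cD]] := @half_sphere_polar X Y Z; first by near_lra.
set S := sin (acos Z) in S0 srX YS sD cD.
exists (acos Z, p.2 + asin (Y / S)); split; first split; rewrite /ball/=.
- have -> : p.1 = acos (cos p.1) by rewrite cosK// in_itv/=; near_lra.
  by apply: Ha; near_lra.
- have -> : p.2 - (p.2 + asin (Y / S)) = asin 0 - asin (Y / S) by rewrite asin0; ring.
  apply: Hs; rewrite sub0r normrN normrM normfV (gtr0_norm S0) ltr_pdivrMr//.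
  by apply: lt_le_trans b1 _; apply: le_trans e3 _; rewrite ler_pM2l//; near_lra.
rewrite vw addrC -polar_Zrot; congr (_ *m _).
apply: row3P; rewrite polarE ?sD ?cD ?cr// -/S -/X -/Y mulrC divfK// gt_eqF//.
Qed.

End LocalInversion.

(** * Digons are lunes *)

Section Digon.
Variable R : realType.
Implicit Types (r phi th s t u c e d : R) (v w : 'rV[R]_3) (P Q M : 'M[R]_3).
Implicit Types (x y p q : R * R).

Definition square : set (R * R) := [set p | 0 <= p.1 <= 1 /\ 0 <= p.2 <= 1].

(** The two halves of the boundary of the square, from (0, 0) to (1, 1), and
    the longitudes to which they develop. *)
Definition on (b : bool) x := if b then x.1 = 0 \/ x.2 = 1 else x.2 = 0 \/ x.1 = 1.
Definition long (a : R) (b : bool) := if b then a else 0.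

Definition corner_chart x th e (psi : R * R -> R * R) :=
  [/\ {within sector e th, continuous psi},
      forall r phi, sector e th (r, phi) -> square (psi (r, phi)),
      exists2 d, 0 < d & forall y, square y -> ball x d y ->
        exists r phi, sector e th (r, phi) /\ psi (r, phi) = y,
      forall r phi r' phi', sector e th (r, phi) -> sector e th (r', phi') ->
        psi (r, phi) = psi (r', phi') -> r = r' /\ (r = 0 \/ phi = phi') &
      forall phi, 0 <= phi <= th -> psi (0, phi) = x].

(** A disc of curvature 1 bounded by two geodesics of length pi from (0, 0) to
    (1, 1), developed so that (0, 0) goes to the north pole and the sides to
    the meridians 0 and a. *)
Record digon (a : R) (dev : R * R -> 'rV[R]_3) (side : bool -> R -> R * R) : Prop := Digon {
  dg_gt0 : 0 < a;
  dg_cont : forall x, square x -> forall e, 0 < e -> exists2 d, 0 < d &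
    forall y, square y -> ball x d y -> ball (dev x) e (dev y);
  dg_int : forall x, square x -> (forall b, ~ on b x) ->
    exists Q ray, fan square dev x (2 * pi) ray ray Q;
  dg_side : forall b r, 0 <= r <= pi ->
    [/\ square (side b r), on b (side b r) & dev (side b r) = polar r (long a b)];
  dg_side_cont : forall b, {within `[0, pi], continuous (side b)};
  dg_side_surj : forall b x, square x -> on b x -> exists2 r, 0 <= r <= pi & x = side b r;
  dg_side_fan : forall b r, 0 < r < pi -> exists ray0 ray1,
    fan square dev (side b r) pi ray0 ray1 (if b then Eflip r *m Zrot a else Yrot r);
  dg_A : exists e psi, [/\ 0 < e < pi, corner_chart (0, 0) a e psi,
    forall b r, 0 <= r < e -> psi (r, long a b) = side b r &
    forall r phi, sector e a (r, phi) -> dev (psi (r, phi)) = polar r phi];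
  dg_D : exists th e psi, [/\ 0 < e < pi /\ 0 < th, corner_chart (1, 1) th e psi,
    forall r, 0 <= r < e ->
      psi (r, 0) = side true (pi - r) /\ psi (r, th) = side false (pi - r) &
    forall r phi, sector e th (r, phi) -> dev (psi (r, phi)) = polar (pi - r) (a - phi)] }.

Lemma ball2_eq x y : (forall e, 0 < e -> ball x e y) -> x = y.
Proof.
have h (s t : R) : (forall e, 0 < e -> `|s - t| < e) -> s = t.
  move=> H; apply/eqP; rewrite -subr_eq0 -normr_eq0; apply/negPn/negP => n0.
  by have := H `|s - t|; rewrite ltxx lt_neqAle eq_sym n0 normr_ge0 => /(_ isT).
by case: x => x1 x2; case: y => y1 y2 H; congr (_, _); apply: h => e e0; case: (H e e0).
Qed.

Lemma ball2_half x y z e : ball x (e / 2) y -> ball y (e / 2) z -> ball x e z.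
Proof. by move=> h1 h2; rewrite (splitr e); exact: ball_triangle h1 h2. Qed.

Lemma compact_square : compact square.
Proof.
have -> : square = `[0, 1]%classic `*` `[0, 1]%classic.
  by apply/seteqP; split=> x; rewrite /= !in_itv.
by apply: compact_setX; exact: segment_compact.
Qed.

Lemma compact_lune (a : R) : compact (lune a).
Proof.
have -> : lune a = `[0, pi]%classic `*` `[0, a]%classic.
  by apply/seteqP; split=> x; rewrite /= !in_itv.
by apply: compact_setX; exact: segment_compact.
Qed.

(** Real induction: where the paths agree, they agree for a while longer, the
    development being injective nearby. *)
Lemma unique_lift_right (dev : R * R -> 'rV[R]_3) (D : set (R * R)) (f g : R -> R * R) s t :
  {within `[s, t], continuous f} -> {within `[s, t], continuous g} ->
  (forall u, s <= u <= t -> D (f u) /\ D (g u)) ->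
  (forall u, s <= u <= t -> dev (f u) = dev (g u)) ->
  (forall u, s <= u <= t -> exists2 d, 0 < d & forall y z, D y -> D z ->
     ball (f u) d y -> ball (f u) d z -> dev y = dev z -> y = z) ->
  f s = g s -> forall u, s <= u <= t -> f u = g u.
Proof.
move=> /within_continuousP cf /within_continuousP cg HD Hdev Hinj fs.
apply: real_induction => u uI IH.
have uI' : (`[s, t]%classic : set R) u by rewrite /= in_itv.
have fu : f u = g u.
  have [us|su] := eqVneq u s; first by rewrite us.
  apply: ball2_eq => e e0.
  have [d1 d10 H1] := cf u uI' (e / 2) ltac:(lra).
  have [d2 d20 H2] := cg u uI' (e / 2) ltac:(lra).
  have su' : s < u by rewrite lt_neqAle eq_sym su; case/andP: uI.
  pose c := Num.max s (u - Num.min d1 d2 / 2).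
  have m0 : 0 < Num.min d1 d2 by rewrite lt_min d10.
  have m1 : Num.min d1 d2 <= d1 by rewrite ge_min lexx.
  have m2 : Num.min d1 d2 <= d2 by rewrite ge_min lexx orbT.
  have c1 : s <= c by rewrite le_max lexx.
  have c2 : u - Num.min d1 d2 / 2 <= c by rewrite le_max lexx orbT.
  have c3 : c < u by rewrite gt_max su'/=; lra.
  have cI : (`[s, t]%classic : set R) c by rewrite /= in_itv/=; lra.
  have cd1 : ball u d1 c by rewrite /ball/= ger0_norm; lra.
  have cd2 : ball u d2 c by rewrite /ball/= ger0_norm; lra.
  apply: (@ball2_half _ (f c)); first exact: H1.
  by rewrite IH; [apply: ball_sym; exact: H2 | lra].
split=> //; have [d d0 Hd] := Hinj u uI.
have [d1 d10 H1] := cf u uI' d d0; have [d2 d20 H2] := cg u uI' d d0.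
exists (Num.min d1 d2); first by rewrite lt_min d10.
have m1 : Num.min d1 d2 <= d1 by rewrite ge_min lexx.
have m2 : Num.min d1 d2 <= d2 by rewrite ge_min lexx orbT.
move=> c uc ct; have cI : s <= c <= t by lra.
have cI' : (`[s, t]%classic : set R) c by rewrite /= in_itv.
have [Df Dg] := HD c cI; apply: Hd => //; last exact: Hdev.
  by apply: H1 => //; rewrite /ball/= distrC ger0_norm; lra.
by rewrite fu; apply: H2 => //; rewrite /ball/= distrC ger0_norm; lra.
Qed.

Lemma unique_lift (dev : R * R -> 'rV[R]_3) (D : set (R * R)) (f g : R -> R * R) s t c :
  {within `[s, t], continuous f} -> {within `[s, t], continuous g} ->
  (forall u, s <= u <= t -> D (f u) /\ D (g u)) ->
  (forall u, s <= u <= t -> dev (f u) = dev (g u)) ->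
  (forall u, s <= u <= t -> exists2 d, 0 < d & forall y z, D y -> D z ->
     ball (f u) d y -> ball (f u) d z -> dev y = dev z -> y = z) ->
  s <= c <= t -> f c = g c -> forall u, s <= u <= t -> f u = g u.
Proof.
move=> cf cg HD Hdev Hinj cI fc u uI.
have sub (h : R -> R * R) : {within `[s, t], continuous h} ->
    {within `[c, t], continuous h} /\ {within `[- c, - s], continuous (h \o -%R)}.
  move=> /within_continuousP ch; split; apply/within_continuousP => v;
    rewrite /= in_itv/= => vI e e0.
    have [|d d0 H] := ch v _ e e0; first by rewrite /= in_itv/=; lra.
    by exists d => // z; rewrite /= in_itv/= => zI; apply: H; rewrite /= in_itv/=; lra.
  have [|d d0 H] := ch (- v) _ e e0; first by rewrite /= in_itv/=; lra.
  exists d => // z; rewrite /= in_itv/= => zI vz; apply: H; first by rewrite /= in_itv/=; lra.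
  by move: vz; rewrite /ball/= -normrN; congr (`|_| < _); ring.
have [cfr cfl] := sub _ cf; have [cgr cgl] := sub _ cg.
have [cu|uc] := leP c u.
  apply: (unique_lift_right cfr cgr _ _ _ fc); last (by lra); move=> v vI.
  - by apply: HD; lra.
  - by apply: Hdev; lra.
  - by apply: Hinj; lra.
rewrite -(opprK u); apply: (unique_lift_right cfl cgl) => [v vI|v vI|v vI||]/=.
- by apply: HD; lra.
- by apply: Hdev; lra.
- by apply: Hinj; lra.
- by rewrite opprK.
- by lra.
Qed.

End Digon.

Section Lifting.
Variable R : realType.
Implicit Types (r phi th s t u c e d : R) (b : bool) (v w : 'rV[R]_3) (P Q M : 'M[R]_3).
Implicit Types (x y p q : R * R) (g : R * R -> R * R).

Lemma ball3_eq v w : (forall e, 0 < e -> ball v e w) -> v = w.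
Proof.
move=> H; apply/rowP => j; apply/eqP; rewrite -subr_eq0 -normr_eq0; apply/negPn/negP => n0.
have [|_ /(_ 0 j)] := H `|v 0 j - w 0 j|.
  by rewrite lt_neqAle eq_sym n0 normr_ge0.
by rewrite /ball/= ltxx.
Qed.

Lemma ballS (T : pseudoMetricType R) (x y : T) d e : d <= e -> ball x d y -> ball x e y.
Proof. by move=> de; exact: le_ball. Qed.

Lemma min4 (e1 e2 e3 e4 : R) : 0 < e1 -> 0 < e2 -> 0 < e3 -> 0 < e4 ->
  exists d, [/\ 0 < d, d <= e1, d <= e2, d <= e3 & d <= e4].
Proof.
move=> h1 h2 h3 h4; exists (Num.min (Num.min e1 e2) (Num.min e3 e4)).
by split; rewrite ?lt_min ?h1 ?h2 ?h3 ?h4// ?ge_min ?lexx ?orbT.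
Qed.

Lemma off_side b x : square x -> ~ on b x ->
  exists2 d, 0 < d & forall y, ball x d y -> ~ on b y.
Proof.
have off0 (z : R * R) : square z -> ~ on false z ->
    exists2 d, 0 < d & forall y, ball z d y -> ~ on false y.
  move=> [z1 z2] o0.
  have h1 : 0 < z.2.
    by rewrite lt_neqAle eq_sym; case/andP: z2 => -> _; rewrite andbT; apply/eqP => E; apply: o0; left.
  have h2 : z.1 < 1.
    by rewrite lt_neqAle; case/andP: z1 => _ ->; rewrite andbT; apply/eqP => E; apply: o0; right.
  have [d [d0 d1 d2 _ _]] := @min4 z.2 (1 - z.1) 1 1 h1 ltac:(near_lra) ltac:(near_lra) ltac:(near_lra).
  exists d => // y [b1 b2]; move: b1 b2; rewrite /ball/= => b1 b2.
  by case=> E; [move: b2 | move: b1]; rewrite E ltr_norml; near_lra.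
case: b => [[x1 x2] o|]; last exact: off0.
have [d d0 H] := off0 (x.2, x.1) (conj x2 x1) o; exists d => // y [b1 b2].
exact: (H (y.2, y.1)).
Qed.

Variables (a : R) (dev : R * R -> 'rV[R]_3) (side : bool -> R -> R * R).
Hypothesis dg : digon a dev side.

(** At a point of a side the region is the half-plane on the inner side of the
    meridian; for longitudes close to that of the side, this bounds the
    longitude. *)
Lemma side_half b r : 0 < r < pi -> exists ray0 ray1 Q,
  fan (@square R) dev (side b r) pi ray0 ray1 Q /\
  forall s phi, (polar s phi *m Q^T) 0 c1 = sin s * sin (if b then a - phi else phi).
Proof.
move=> rI; have [ray0 [ray1 F]] := dg_side_fan dg b rI.
exists ray0, ray1; eexists; split; first exact: F.
move=> s phi; case: b F => _; rewrite mulmx3 ![_^T _ _]mxE ?mulmx3.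
  by rewrite ![Eflip _ _ _]mxE ![Zrot _ _ _]mxE/= !polarE sinB; ring.
by rewrite ![Yrot _ _ _]mxE/= !polarE; ring.
Qed.

Lemma corners_polar r phi x : square x -> on false x -> on true x -> 0 < r < pi ->
  dev x <> polar r phi.
Proof.
move=> [x1 x2] o0 o1 rI; have p0 := pi_gt0 R; have a0 := dg_gt0 dg.
have cr : -1 < cos r < 1.
  by rewrite cos_gtN1 ?cos_lt1//; near_lra.
have : x = (0, 0) \/ x = (1, 1).
  case: x x1 x2 o0 o1 => y1 y2 /= h1 h2 o0 o1.
  case: o0 => /= E0; case: o1 => /= E1; [by rewrite E0 E1; left| exfalso; near_lra | exfalso; near_lra |].
  by rewrite E0 E1; right.
case=> ->.
  have [e [psi [e0 [_ _ _ _ H0] _ H]]] := dg_A dg.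
  have s00 : sector e a (0, 0) by split=> /=; near_lra.
  rewrite -(H0 0); last by near_lra.
  by rewrite H// => /rowP/(_ c2); rewrite !polarE cos0; near_lra.
have [th [e [psi [[e0 th0] [_ _ _ _ H0] _ H]]]] := dg_D dg.
have s00 : sector e th (0, 0) by split=> /=; near_lra.
rewrite -(H0 0); last by near_lra.
by rewrite H// => /rowP/(_ c2); rewrite !polarE subr0 cospi; near_lra.
Qed.

Lemma on_polar b r phi x : square x -> on b x -> 0 < r < pi -> dev x = polar r phi ->
  [/\ forall b', b' != b -> ~ on b' x, x = side b r,
      cos phi = cos (long a b) & sin phi = sin (long a b)].
Proof.
move=> Sx ob rI E.
have o1 b' : b' != b -> ~ on b' x.
  by case: b b' ob => -[] // ob _ o1; [move: (E) | move: (E)]; exact: corners_polar.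
have [r' r'I x0] := dg_side_surj dg Sx ob.
have [_ _] := dg_side dg b r'I; rewrite -x0 E => E'.
have rI0 : 0 <= r <= pi by near_lra.
have [rr []] := polar_inj rI0 r'I E'; have sr := sin_gt0_pi rI; first by near_lra.
by rewrite rr => -[].
Qed.

Definition injective_near x := exists2 d, 0 < d &
  forall y z, square y -> square z -> ball x d y -> ball x d z -> dev y = dev z -> y = z.

Lemma sideP x : (exists b, on b x) \/ forall b, ~ on b x.
Proof.
have [ o0|o0] := pselect (on false x); first by left; exists false.
have [ o1|o1] := pselect (on true x); first by left; exists true.
by right; case.
Qed.

Lemma interior_injective_near x : square x -> (forall b, ~ on b x) -> injective_near x.
Proof. by move=> Sx o; have [Q [ray F]] := dg_int dg Sx o; apply: (fan_inj F); right. Qed.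

Lemma polar_injective_near x r phi : square x -> 0 < r < pi -> dev x = polar r phi ->
  injective_near x.
Proof.
move=> Sx rI E; have p0 := pi_gt0 R.
have [[b o]|o] := sideP x; last exact: interior_injective_near.
have [_ -> _ _] := on_polar Sx o rI E; have [ray0 [ray1 [Q [F _]]]] := side_half b rI.
by apply: (fan_inj F); left; near_lra.
Qed.

(** A point p of the lune and a point x of the digon that may correspond to it:
    they have the same development, and x lies on a side only if p lies on the
    side of the same name. The second condition is what lets nearby points of
    the lune be lifted as well. *)
Definition adm p x := [/\ 0 < p.1 < pi, 0 <= p.2 <= a, square x,
  dev x = polar p.1 p.2 & forall b, on b x -> p.2 = long a b].

Lemma adm_injective_near p x : adm p x -> injective_near x.
Proof. by case=> p1 _ Sx E _; exact: polar_injective_near E. Qed.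

Lemma adm_lift p x : adm p x -> forall e, 0 < e -> exists2 d, 0 < d &
  forall q, 0 <= q.2 <= a -> ball p d q -> exists y, adm q y /\ ball x e y.
Proof.
move=> [p1 p2 Sx E h] e e0; have pi0 := pi_gt0 R.
have [[b o]|o] := sideP x.
  have [ o' xE _ _] := on_polar Sx o p1 E; have p2b := h b o.
  have [e1 e10 He1] := off_side Sx (o' (~~ b) ltac:(by case: (b))).
  have [m [m0 me me1 _ _]] := min4 e0 e10 e0 e0.
  have [ray0 [ray1 [Q [F half]]]] := side_half b p1; rewrite -xE in F.
  have [d1 d10 H1] := fan_surj F (pi_ge0 R) m0.
  have [d2 d20 H2] := polar_ball p d10.
  have [d [d0 dd2 dp1 dp2 dpi]] := @min4 d2 p.1 (pi - p.1) pi d20 ltac:(near_lra) ltac:(near_lra) pi0.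
  exists d => // q q2 pq; case: (pq); rewrite /ball/= !ltr_norml => b1 b2.
  have q1 : 0 < q.1 < pi by near_lra.
  have [|||y [Sy xy Ey]] := H1 (polar q.1 q.2).
  - exact: dot_polar_unit.
  - by rewrite E; apply: H2; exact: ballS pq.
  - right; split=> //; rewrite half mulr_ge0// sin_ge0_pi//; try near_lra.
    by case: (b) p2b => /= ?; near_lra.
  exists y; split; last exact: ballS xy.
  split=> // b' oy; have [E'|n] := eqVneq b' b; last first.
    have E' : b' = ~~ b by case: b' b n {oy o o' p2b He1 half F xE} => -[].
    by have := He1 y (ballS me1 xy); rewrite -E'.
  have [_ _ cq sq] := on_polar Sy oy q1 Ey.
  by apply: cos_sin_inj => //; rewrite E' ltr_norml -p2b; near_lra.
have [Q [ray F]] := dg_int dg Sx o.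
have [e1 e10 He1] := off_side Sx (o false); have [e2 e20 He2] := off_side Sx (o true).
have [m [m0 me me1 me2 _]] := min4 e0 e10 e20 e0.
have [|d1 d10 H1] := fan_surj F _ m0; first by near_lra.
have [d2 d20 H2] := polar_ball p d10.
have [d [d0 dd2 dp1 dp2 _]] := @min4 d2 p.1 (pi - p.1) pi d20 ltac:(near_lra) ltac:(near_lra) pi0.
exists d => // q q2 pq; case: (pq); rewrite /ball/= !ltr_norml => b1 b2.
have q1 : 0 < q.1 < pi by near_lra.
have [|||y [Sy xy Ey]] := H1 (polar q.1 q.2).
- exact: dot_polar_unit.
- by rewrite E; apply: H2; exact: ballS pq.
- by left.
exists y; split; last exact: ballS xy.
split=> // -[] oy; first by have := He2 y (ballS me2 xy).
by have := He1 y (ballS me1 xy).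
Qed.

(** If the limit were on a side with another longitude, the ray would already have
    run along that side, because the development is injective nearby. *)
Lemma adm_ray_limit r phi x : 0 < r < pi -> 0 <= phi <= a -> square x ->
  (forall e, 0 < e -> exists s y, [/\ r - e < s < r, adm (s, phi) y & ball x e y]) ->
  adm (r, phi) x.
Proof.
move=> rI phiI Sx H.
have E : dev x = polar r phi.
  apply: ball3_eq => e e0.
  have [d1 d10 H1] := dg_cont dg Sx (e := e / 2) ltac:(near_lra).
  have [d2 d20 H2] := @polar_ball R (r, phi) (e / 2) ltac:(near_lra).
  have [d [d0 dd1 dd2 _ _]] := min4 d10 d20 d10 d20.
  have [s [y [sI [/= _ _ Sy Ey _] xy]]] := H d d0.
  rewrite (splitr e); apply: (@ball_triangle _ _ (dev y)); first exact/H1/(ballS dd1).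
  rewrite Ey; apply: ball_sym; apply: (H2 (s, phi)); split; rewrite /ball/=.
    by rewrite ger0_norm; near_lra.
  by rewrite subrr normr0.
have [d d0 Hd] := polar_injective_near Sx rI E.
split=> // b o; have [_ xE cp sp] := on_polar Sx o rI E.
have rI' : (`[0, pi]%classic : set R) r by rewrite /= in_itv/=; near_lra.
have [d1 d10 H1] := (within_continuousP _ _).1 (@dg_side_cont _ _ _ _ dg b) r rI' d d0.
have [d2 [d20 dd d1d dr _]] := @min4 d d1 r 1 d0 d10 ltac:(near_lra) ltac:(near_lra).
have [s [y [sI [/= sp1 _ Sy Ey h] xy]]] := H d2 d20.
have sI' : 0 <= s <= pi by near_lra.
have [Ss os Es] := dg_side dg b sI'.
have xs : ball x d (side b s).
  rewrite xE; apply: H1; first by rewrite /= in_itv.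
  by rewrite /ball/= ger0_norm; near_lra.
suff ys : y = side b s by apply: h; rewrite ys.
apply: Hd => //; first exact: ballS xy.
by rewrite Ey Es; apply: row3P; rewrite !polarE ?cp ?sp.
Qed.

End Lifting.

Section Exponential.
Variable R : realType.
Implicit Types (r phi th s t u c e d b : R) (v w : 'rV[R]_3) (P Q M : 'M[R]_3).
Implicit Types (x y p q : R * R) (g : R * R -> R * R).
Variables (a : R) (dev : R * R -> 'rV[R]_3) (side : bool -> R -> R * R).
Hypothesis dg : digon a dev side.
Variables (eA : R) (psi : R * R -> R * R).
Hypothesis eA_bounds : 0 < eA < pi.
Hypothesis psi_chart : corner_chart (0, 0) a eA psi.
Hypothesis psi_rays : forall k r, 0 <= r < eA -> psi (r, long a k) = side k r.
Hypothesis psi_dev : forall r phi, sector eA a (r, phi) -> dev (psi (r, phi)) = polar r phi.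

Lemma long_bounds k : 0 <= long a k <= a.
Proof. by have a0 := dg_gt0 dg; case: k => /=; near_lra. Qed.

Lemma chart_adm r phi : 0 < r < eA -> 0 <= phi <= a -> adm a dev (r, phi) (psi (r, phi)).
Proof.
move=> rI phiI; have [_ psiS _ psiI _] := psi_chart; have eA0 := eA_bounds.
have s : sector eA a (r, phi) by split=> //=; near_lra.
have rpi : 0 < r < pi by near_lra.
have rI' : 0 <= r < eA by near_lra.
split=> //; [exact: psiS | exact: psi_dev |] => k o /=.
have [_ xE _ _] := on_polar dg (psiS _ _ s) o rpi (psi_dev s).
rewrite -psi_rays// in xE; have sk : sector eA a (r, long a k).
  by have := long_bounds k; split=> //=; near_lra.
by have [_ [|//]] := psiI _ _ _ _ s sk xE; near_lra.
Qed.

Definition box b phi d p := [/\ 0 < p.1 <= b, 0 <= p.2 <= a & `|phi - p.2| < d].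

(** The exponential map from the corner, up to radius b and in the directions
    close to phi. *)
Definition section_to b phi d g :=
  [/\ forall p, box b phi d p -> adm a dev p (g p),
      forall p, box b phi d p -> forall e, 0 < e -> exists2 d', 0 < d' &
        forall q, box b phi d q -> ball p d' q -> ball (g p) e (g q) &
      forall p, box b phi d p -> p.1 <= eA / 2 -> g p = psi p].

Lemma section_start phi : section_to (eA / 2) phi 1 psi.
Proof.
have eA0 := eA_bounds; split=> //.
  by move=> [r th] []/= h1 h2 h3; apply: chart_adm; near_lra.
have [psiC _ _ _ _] := psi_chart.
have sec q : box (eA / 2) phi 1 q -> sector eA a q by move=> [h1 h2 h3]; split; near_lra.
move=> p /sec sp e e0; have [d d0 H] := (within_continuousP _ _).1 psiC p sp e e0.
by exists d => // q /sec sq; exact: H.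
Qed.

Lemma section_unique b phi d g b' phi' d' g' p :
  section_to b phi d g -> section_to b' phi' d' g' -> box b phi d p -> box b' phi' d' p ->
  g p = g' p.
Proof.
have eA0 := eA_bounds; move=> [A C P] [A' C' P'] B B'; have [pr|rp] := leP p.1 (eA / 2).
  by rewrite P ?P'.
have BI s : eA / 2 <= s <= p.1 -> box b phi d (s, p.2) /\ box b' phi' d' (s, p.2).
  by move=> sI; case: B => ? ? ?; case: B' => ? ? ?; split; split=> //=; near_lra.
have -> : p = (p.1, p.2) by case: p {B B' rp BI}.
suff H : forall s, eA / 2 <= s <= p.1 -> g (s, p.2) = g' (s, p.2) by apply: H; near_lra.
refine (@unique_lift_right _ dev (@square R) (fun s => g (s, p.2)) (fun s => g' (s, p.2))
  (eA / 2) p.1 _ _ _ _ _ _).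
- apply/within_continuousP => s; rewrite /= in_itv/= => sI e e0; have [Bs _] := BI s sI.
  have [d1 d10 H] := C _ Bs e e0; exists d1 => // t; rewrite /= in_itv/= => tI st.
  by have [Bt _] := BI t tI; apply: H => //; split=> //=; exact: ballxx.
- apply/within_continuousP => s; rewrite /= in_itv/= => sI e e0; have [_ Bs] := BI s sI.
  have [d1 d10 H] := C' _ Bs e e0; exists d1 => // t; rewrite /= in_itv/= => tI st.
  by have [_ Bt] := BI t tI; apply: H => //; split=> //=; exact: ballxx.
- by move=> s /BI[Bs Bs']; split; [case: (A _ Bs) | case: (A' _ Bs')].
- by move=> s /BI[Bs Bs'] /=; case: (A _ Bs) => _ _ _ -> _; case: (A' _ Bs') => _ _ _ ->.
- by move=> s /BI[Bs Bs']; exact: (adm_injective_near dg (A _ Bs)).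
- have [|Bs Bs'] := BI (eA / 2); first by near_lra.
  by rewrite P ?P' /=.
Qed.

(** The local inverse of the development at x, obtained from [adm_lift], continues
    the section past s. *)
Lemma section_step s phi x : adm a dev (s, phi) x -> exists2 e, 0 < e &
  forall b d g, 0 < d -> section_to b phi d g -> eA / 2 <= b -> s - e < b <= s ->
  ball x e (g (b, phi)) -> forall b', b <= b' < s + e ->
  exists d' g', 0 < d' /\ section_to b' phi d' g'.
Proof.
move=> Ax; have [/= sI phiI Sx _ _] := Ax.
have [eta eta0 inj] := adm_injective_near dg Ax.
have heta : 0 < eta / 2 by near_lra.
have [d0 d00 lift] := adm_lift dg Ax heta.
pose sigma q := xget (0, 0) [set y | adm a dev q y /\ ball x (eta / 2) y].
have sigmaP q : 0 <= q.2 <= a -> ball (s, phi) d0 q ->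
    adm a dev q (sigma q) /\ ball x (eta / 2) (sigma q).
  move=> q2 qb; have [y Hy] := lift q q2 qb.
  by rewrite /sigma; case: xgetP => [z -> [? ?]//|/(_ y)].
have adm_eq q y z : adm a dev q y -> adm a dev q z -> ball x eta y -> ball x eta z -> y = z.
  move=> [_ _ Sy Ey _] [_ _ Sz Ez _] xy xz; apply: inj => //; by rewrite Ey.
have sigmaC q : 0 <= q.2 <= a -> ball (s, phi) d0 q -> forall e, 0 < e ->
    exists2 d', 0 < d' & forall q', 0 <= q'.2 <= a -> ball (s, phi) d0 q' ->
      ball q d' q' -> ball (sigma q) e (sigma q').
  move=> q2 qb e e0; have [Aq bq] := sigmaP q q2 qb.
  have [m [m0 me meta _ _]] := min4 e0 heta e0 e0.
  have [d' d'0 H] := adm_lift dg Aq m0; exists d' => // q' q2' qb' qq'.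
  have [y [Ay by_]] := H q' q2' qq'; have [Aq' bq'] := sigmaP q' q2' qb'.
  suff -> : sigma q' = y by exact: ballS by_.
  apply: adm_eq Aq' Ay _ _; first by apply: ballS bq'; near_lra.
  exact: (ball2_half bq (ballS meta by_)).
have [e [e0 ed0 eeta _ _]] := min4 d00 heta d00 d00.
exists e => // b d g d_gt0 [A C P] bA bs xg b' bb'.
have eA0 := eA_bounds.
have Bb : box b phi d (b, phi) by split=> //=; [near_lra | rewrite subrr normr0].
have [d2 d20 Hd2] := C _ Bb _ heta.
have [d' [d'0 d'd d'2 d'e _]] := min4 d_gt0 d20 e0 d_gt0.
have glue q : box b phi d q -> q.1 = b -> `|phi - q.2| < d' -> g q = sigma q.
  move=> Bq q1 q2; have [_ q2I _] := Bq.
  have qb : ball (s, phi) d0 q.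
    by split; rewrite /ball/= ?q1; [rewrite ger0_norm; near_lra | near_lra].
  have [Aq bq] := sigmaP q q2I qb.
  apply: adm_eq (A _ Bq) Aq _ _; last by apply: ballS bq; near_lra.
  apply: (ball2_half (ballS eeta xg)); apply: Hd2 => //.
  by split; rewrite /ball/= ?q1 ?subrr ?normr0//; near_lra.
have B1 q : box b' phi d' q -> q.1 <= b -> box b phi d q.
  by move=> [? ? ?] ?; split=> //; near_lra.
have B2 q : box b' phi d' q -> b <= q.1 -> 0 <= q.2 <= a /\ ball (s, phi) d0 q.
  move=> [q1 q2 q3] bq; split=> //; split; rewrite /ball/=; last by near_lra.
  by rewrite ltr_norml; near_lra.
exists d', (fun q => if q.1 <= b then g q else sigma q); split=> //; split.
- move=> q Bq; case: leP => qb; first exact/A/B1.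
  by have [q2 qd] := B2 q Bq (ltW qb); case: (sigmaP q q2 qd).
- move=> q Bq eps eps0; have [qb|qb|qb] := ltgtP q.1 b.
  + have [d3 d30 H3] := C q (B1 q Bq (ltW qb)) eps eps0.
    have [d4 [d40 d43 d4b _ _]] := @min4 _ d3 (b - q.1) 1 1 d30 ltac:(near_lra) ltac:(near_lra) ltac:(near_lra).
    exists d4 => // q' Bq' qq'; have [q1 _] := qq'.
    move: q1; rewrite /ball/= ltr_norml => q1.
    have q'b : q'.1 <= b by near_lra.
    by rewrite q'b; apply: H3; [exact: B1 | exact: ballS qq'].
  + have [q2 qd] := B2 q Bq (ltW qb).
    have [d3 d30 H3] := sigmaC q q2 qd eps eps0.
    have [d4 [d40 d43 d4b _ _]] := @min4 _ d3 (q.1 - b) 1 1 d30 ltac:(near_lra) ltac:(near_lra) ltac:(near_lra).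
    exists d4 => // q' Bq' qq'; have [q1 _] := qq'.
    move: q1; rewrite /ball/= ltr_norml => q1.
    have q'b : b < q'.1 by near_lra.
    rewrite leNgt q'b /=; have [q2' qd'] := B2 q' Bq' (ltW q'b).
    by apply: H3 => //; exact: ballS qq'.
  have qb' : q.1 <= b by rewrite qb.
  have bq' : b <= q.1 by rewrite qb.
  have Bq1 := B1 q Bq qb'; have [q2 qd] := B2 q Bq bq'.
  have gs : g q = sigma q by apply: glue => //; case: Bq.
  have [d3 d30 H3] := C q Bq1 eps eps0; have [d4 d40 H4] := sigmaC q q2 qd eps eps0.
  have [d5 [d50 d53 d54 _ _]] := min4 d30 d40 d30 d40.
  exists d5 => // q' Bq' qq'; case: leP => q'b.
    by apply: H3; [exact: B1 | exact: ballS qq'].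
  rewrite gs; have [q2' qd'] := B2 q' Bq' (ltW q'b).
  by apply: H4 => //; exact: ballS qq'.
move=> q Bq qA; have -> : q.1 <= b by near_lra.
by apply: P => //; apply: B1 => //; near_lra.
Qed.

(** Real induction on the radius: the end points of the lifted rays accumulate
    somewhere in the square, the limit is admissible by [adm_ray_limit], and
    [section_step] continues the rays past it. *)
Lemma section_exists b phi : eA / 2 <= b < pi -> 0 <= phi <= a ->
  exists d g, 0 < d /\ section_to b phi d g.
Proof.
move=> bI phiI; have eA0 := eA_bounds; have [_ psiS _ _ _] := psi_chart.
suff H : forall s, eA / 2 <= s <= b -> exists d g, 0 < d /\ section_to s phi d g.
  by apply: H; near_lra.
apply: real_induction => s sI IH.
have [x [e [e0 Ae step]]] : exists x e, [/\ 0 < e, adm a dev (s, phi) x &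
    forall b', s <= b' < s + e -> exists d g, 0 < d /\ section_to b' phi d g].
  have [sE|sN] := eqVneq s (eA / 2).
    have Ax : adm a dev (s, phi) (psi (s, phi)) by apply: chart_adm; near_lra.
    have [e e0 He] := section_step Ax.
    exists (psi (s, phi)), e; split=> // b' hb'.
    apply: (He s 1 psi) => //; try near_lra.
      by rewrite {1}sE; exact: section_start.
    exact: ballxx.
  have sA : eA / 2 < s by rewrite lt_neqAle eq_sym sN; case/andP: sI.
  pose S e y := exists u d g, [/\ s - e < u < s, eA / 2 <= u, 0 < d,
    section_to u phi d g & y = g (u, phi)].
  have [||x Sx Hx] := @compact_cluster R _ _ S (@compact_square R).
  - move=> e e' y ee' [u [d [g [uI uA d0 Hg yE]]]]; exists u, d, g; split=> //; near_lra.
  - move=> e e0; pose u := Num.max (eA / 2) (s - e / 2).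
    have u1 : eA / 2 <= u by rewrite le_max lexx.
    have u2 : s - e / 2 <= u by rewrite le_max lexx orbT.
    have u3 : u < s by rewrite gt_max sA/=; near_lra.
    have [|d [g [d0 Hg]]] := IH u; first by near_lra.
    have Bu : box u phi d (u, phi) by split=> //=; [near_lra | rewrite subrr normr0].
    exists (g (u, phi)); first by case: Hg => /(_ _ Bu)[].
    by exists u, d, g; split=> //; near_lra.
  have Ax : adm a dev (s, phi) x.
    apply: (adm_ray_limit dg) => //; first by near_lra.
    move=> e e0; have [y [Sy [u [d [g [uI uA d0 [A _ _] yE]]]] xy]] := Hx e e0.
    have Bu : box u phi d (u, phi) by split=> //=; [near_lra | rewrite subrr normr0].
    by exists u, y; split=> //; rewrite yE; exact: A.
  have [e e0 He] := section_step Ax; exists x, e; split=> // b' hb'.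
  have [y [Sy [u [d [g [uI uA d0 Hg yE]]]] xy]] := Hx e e0.
  by apply: (He u d g) => //; rewrite -?yE//; near_lra.
split; first by apply: step; near_lra.
by exists e => // u us ub; apply: step; near_lra.
Qed.

Definition ray_end p := xget (0, 0) [set y | exists d g,
  [/\ 0 < d, section_to (Num.max (eA / 2) p.1) p.2 d g & y = g p]].

(** The exponential map from (0, 0). *)
Definition lune_exp p : R * R :=
  if p.1 <= 0 then (0, 0) else if p.1 < pi then ray_end p else (1, 1).

Lemma lune_expE b phi d g p : b < pi -> section_to b phi d g -> box b phi d p ->
  lune_exp p = g p.
Proof.
move=> bpi Hg B; have [p1 p2 p3] := B; have eA0 := eA_bounds.
have h0 : (p.1 <= 0) = false by apply/negbTE; rewrite -ltNge; case/andP: p1.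
have h1 : p.1 < pi by near_lra.
rewrite /lune_exp h0 h1.
pose c := Num.max (eA / 2) p.1.
have c1 : eA / 2 <= c by rewrite le_max lexx.
have c2 : p.1 <= c by rewrite le_max lexx orbT.
have c3 : c < pi by rewrite gt_max; apply/andP; split; near_lra.
have [|d' [g' [d'0 Hg']]] := @section_exists c p.2 _ p2; first by near_lra.
have Bc e : 0 < e -> box c p.2 e p by split=> //; [near_lra | rewrite subrr normr0].
rewrite /ray_end; case: xgetP => [y -> [d2 [g2 [d20 Hg2 ->]]]|/(_ (g' p))].
  by apply: (section_unique Hg2 Hg) => //; exact: Bc.
by case; exists d', g'.
Qed.

Lemma lune_exp_chart p : sector eA a p -> p.1 <= eA / 2 -> lune_exp p = psi p.
Proof.
move=> [p1 p2] pe; have eA0 := eA_bounds; have [_ _ _ _ psi0] := psi_chart.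
have [p0|p0] := leP p.1 0.
  have E : p = (0, p.2) by rewrite [LHS]surjective_pairing; congr (_, _); near_lra.
  by rewrite /lune_exp p0 E psi0.
apply: (lune_expE _ (section_start p.2)); first by near_lra.
by split=> //; [near_lra | rewrite subrr normr0; near_lra].
Qed.

Lemma lune_exp_adm p : 0 < p.1 < pi -> 0 <= p.2 <= a -> adm a dev p (lune_exp p).
Proof.
move=> p1 p2; have eA0 := eA_bounds.
pose c := Num.max (eA / 2) p.1.
have c1 : eA / 2 <= c by rewrite le_max lexx.
have c2 : p.1 <= c by rewrite le_max lexx orbT.
have c3 : c < pi by rewrite gt_max; apply/andP; split; near_lra.
have [|d [g [d0 Hg]]] := @section_exists c p.2 _ p2; first by near_lra.
have B : box c p.2 d p by split=> //; [near_lra | rewrite subrr normr0].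
by rewrite (lune_expE c3 Hg B); case: Hg => A _ _; exact: A.
Qed.

Lemma lune_exp_continuous p : lune a p -> p.1 < pi -> forall e, 0 < e ->
  exists2 d, 0 < d & forall q, lune a q -> ball p d q -> ball (lune_exp p) e (lune_exp q).
Proof.
move=> [p1 p2] ppi e e0; have eA0 := eA_bounds; have [psiC _ _ _ _] := psi_chart.
have [p0|p0] := leP p.1 0.
  have sp : sector eA a p by split=> //; near_lra.
  have [d d0 H] := (within_continuousP _ _).1 psiC p sp e e0.
  have [d' [d'0 d'd d'A _ _]] := @min4 _ d (eA / 2) 1 1 d0 ltac:(near_lra) ltac:(near_lra) ltac:(near_lra).
  exists d' => // q [q1 q2] pq; have [b1 _] := pq; move: b1; rewrite /ball/= ltr_norml => b1.
  have sq : sector eA a q by split=> //; near_lra.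
  by rewrite !lune_exp_chart//; [apply: H => //; exact: ballS pq | near_lra | near_lra].
pose c := Num.max (eA / 2) ((p.1 + pi) / 2).
have c1 : eA / 2 <= c by rewrite le_max lexx.
have c2 : (p.1 + pi) / 2 <= c by rewrite le_max lexx orbT.
have c3 : c < pi by rewrite gt_max; apply/andP; split; near_lra.
have [|d [g [d0 Hg]]] := @section_exists c p.2 _ p2; first by near_lra.
have B : box c p.2 d p by split=> //; [near_lra | rewrite subrr normr0].
have [_ C _] := Hg; have [d1 d10 H] := C p B e e0.
have [d' [d'0 d'1 d'd d'p d'c]] := @min4 _ d1 d p.1 (c - p.1) d10 d0 p0 ltac:(near_lra).
exists d' => // q [q1 q2] pq; have [b1 b2] := pq; move: b1 b2; rewrite /ball/= => b1 b2.
have Bq : box c p.2 d q by split=> //; [move: b1; rewrite ltr_norml; near_lra | near_lra].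
rewrite (lune_expE c3 Hg B) (lune_expE c3 Hg Bq).
by apply: H => //; exact: ballS pq.
Qed.


Local Notation G := lune_exp.

Lemma lune_exp_injective_near p : 0 < p.1 < pi -> 0 <= p.2 <= a -> injective_near dev (G p).
Proof. by move=> p1 p2; exact: (adm_injective_near dg (lune_exp_adm p1 p2)). Qed.

Lemma lune_exp_north p : p.1 = 0 -> G p = (0, 0).
Proof. by move=> p0; rewrite /lune_exp p0 lexx. Qed.

Lemma lune_exp_south p : p.1 = pi -> G p = (1, 1).
Proof. by move=> p0; rewrite /lune_exp p0 leNgt pi_gt0 ltxx. Qed.

Lemma polar_south phi phi' : polar pi phi = polar pi phi' :> 'rV[R]_3.
Proof. by apply: row3P; rewrite !polarE ?sinpi ?mul0r. Qed.

Lemma dev_north phi : dev (0, 0) = polar 0 phi.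
Proof.
have [_ _ _ _ psi0] := psi_chart; have a0 := dg_gt0 dg; have eA0 := eA_bounds.
have s : sector eA a (0, 0) by split=> /=; near_lra.
by have := psi_dev s; rewrite psi0; [move=> ->; exact: polar_center | near_lra].
Qed.

Lemma dev_south phi : dev (1, 1) = polar pi phi.
Proof.
have [th [e [psiD [[e0 th0] [_ _ _ _ psi0] _ H]]]] := dg_D dg.
have s : sector e th (0, 0) by split=> /=; near_lra.
have := H _ _ s; rewrite psi0; last by near_lra.
by rewrite subr0 => ->; exact: polar_south.
Qed.

Lemma lune_exp_square_dev p : lune a p -> square (G p) /\ dev (G p) = polar p.1 p.2.
Proof.
move=> [p1 p2].
have [p0|pN0] := eqVneq p.1 0.
  rewrite lune_exp_north// p0; split; last exact: dev_north.
  by split=> /=; rewrite lexx ler01.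
have [ppi|pNpi] := eqVneq p.1 pi.
  rewrite lune_exp_south// ppi; split; last exact: dev_south.
  by split=> /=; rewrite lexx ler01.
have p1' : 0 < p.1 < pi by rewrite !lt_neqAle eq_sym pN0 pNpi.
by have [_ _ Sx E _] := lune_exp_adm p1' p2.
Qed.

Lemma lune_exp_ray phi s t : 0 <= phi <= a -> 0 <= s -> t < pi ->
  {within `[s, t], continuous (fun u => G (u, phi))}.
Proof.
move=> phiI s0' tpi; apply/within_continuousP => u; rewrite /= in_itv/= => uI e e0.
have lu : lune a (u, phi) by split=> //=; near_lra.
have [|d d0 H] := lune_exp_continuous lu _ e0; first by rewrite /=; near_lra.
exists d => // v; rewrite /= in_itv/= => vI uv; apply: H; first by split=> //=; near_lra.
by split=> //=; exact: ballxx.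
Qed.

Lemma lune_exp_parallel r : 0 <= r < pi -> {within `[0, a], continuous (fun u => G (r, u))}.
Proof.
move=> rI; apply/within_continuousP => u; rewrite /= in_itv/= => uI e e0.
have lu : lune a (r, u) by split=> //=; near_lra.
have [|d d0 H] := lune_exp_continuous lu _ e0; first by rewrite /=; near_lra.
exists d => // v; rewrite /= in_itv/= => vI uv; apply: H; first by split=> //=; near_lra.
by split=> //=; exact: ballxx.
Qed.

Lemma lune_exp_unique_ray phi (f : R -> R * R) r : 0 <= phi <= a -> 0 < r < pi ->
  {within `[0, r], continuous f} ->
  (forall u, 0 < u <= r -> square (f u) /\ dev (f u) = polar u phi) ->
  forall c, 0 < c <= r -> f c = G (c, phi) -> forall u, 0 < u <= r -> f u = G (u, phi).
Proof.
move=> phiI rI cf Hf c cI fc u uI.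
pose m := Num.min c u.
have m1 : m <= c by rewrite ge_min lexx.
have m2 : m <= u by rewrite ge_min lexx orbT.
have m0 : 0 < m by rewrite lt_min; apply/andP; split; near_lra.
have cf' : {within `[m, r], continuous f}.
  move/within_continuousP: cf => cf; apply/within_continuousP => t.
  rewrite /= in_itv/= => tI e e0; have [|d d0 H] := cf t _ e e0; first by rewrite /= in_itv/=; near_lra.
  by exists d => // t'; rewrite /= in_itv/= => tI'; apply: H; rewrite /= in_itv/=; near_lra.
have cG := @lune_exp_ray phi m r phiI (ltW m0) ltac:(near_lra).
have lu s : m <= s <= r -> lune a (s, phi) by move=> sI; split=> /=; near_lra.
have E := @unique_lift _ dev (@square R) (fun s => G (s, phi)) f m r c cG cf'.
apply: esym; apply: E; [|(move=> s sI)..|near_lra|exact: esym|near_lra].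
- move=> s sI; have [? _] := lune_exp_square_dev (lu s sI).
  by split=> //; case: (Hf s) => //; near_lra.
- by have [_ ->] := lune_exp_square_dev (lu s sI); case: (Hf s) => //; near_lra.
- by apply: lune_exp_injective_near => /=; near_lra.
Qed.

Lemma lune_exp_sides k r : 0 <= r <= pi -> G (r, long a k) = side k r.
Proof.
move=> rI; have eA0 := eA_bounds; have [_ _ _ _ psi0] := psi_chart.
have kI := long_bounds k.
have [r0|rN0] := eqVneq r 0.
  by rewrite lune_exp_north// -psi_rays r0; [rewrite psi0 | near_lra].
have [rpi|rNpi] := eqVneq r pi.
  rewrite lune_exp_south//.
  have [th [e [psiD [[e0 th0] [_ _ _ _ psiD0] H _]]]] := dg_D dg.
  have [|] := H 0; first by near_lra.
  by rewrite subr0 rpi => E1 E0; case: (k); rewrite -?E1 -?E0 psiD0//; near_lra.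
have rI' : 0 < r < pi by rewrite !lt_neqAle eq_sym rN0 rNpi.
pose c := Num.min (eA / 2) r.
have c1 : c <= eA / 2 by rewrite ge_min lexx.
have c2 : c <= r by rewrite ge_min lexx orbT.
have c0 : 0 < c by rewrite lt_min; apply/andP; split; near_lra.
have cS : {within `[0, r], continuous (side k)}.
  have /within_continuousP cf := @dg_side_cont _ _ _ _ dg k; apply/within_continuousP => t.
  rewrite /= in_itv/= => tI e e0; have [|d d0 H] := cf t _ e e0; first by rewrite /= in_itv/=; near_lra.
  by exists d => // t'; rewrite /= in_itv/= => tI'; apply: H; rewrite /= in_itv/=; near_lra.
apply: esym; apply: (@lune_exp_unique_ray _ (side k) r kI rI' cS _ c); [|near_lra| |near_lra].
  by move=> u uI; have [|? _ ?] := @dg_side _ _ _ _ dg k u; first by near_lra.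
by rewrite lune_exp_chart ?psi_rays//=; [near_lra | split=> /=; near_lra].
Qed.

(** Two points with the same image lie over the same point of the sphere, so they
    have the same distance to the north pole and their rays the same development.
    By uniqueness of lifts the rays coincide back to the chart at (0, 0), where
    distinct rays are distinct. *)
Lemma lune_exp_injective p q : lune a p -> lune a q -> G p = G q ->
  [\/ p = q, p.1 = 0 /\ q.1 = 0 | p.1 = pi /\ q.1 = pi].
Proof.
move=> lp lq E; have [Sp Ep] := lune_exp_square_dev lp; have [Sq Eq] := lune_exp_square_dev lq.
have [p1 p2] := lp; have [q1 q2] := lq; have eA0 := eA_bounds.
have Epq : polar p.1 p.2 = polar q.1 q.2 by rewrite -Ep -Eq E.
have [r12 pq2] := polar_inj p1 q1 Epq.
have [p0|pN0] := eqVneq p.1 0; first by apply: Or32; rewrite -r12.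
have [ppi|pNpi] := eqVneq p.1 pi; first by apply: Or33; rewrite -r12.
have p1' : 0 < p.1 < pi by rewrite !lt_neqAle eq_sym pN0 pNpi.
case: pq2 => [|[c2 s2]]; first by have := sin_gt0_pi p1'; near_lra.
apply: Or31; rewrite [p]surjective_pairing [q]surjective_pairing -r12; congr (_, _).
pose c := Num.min (eA / 2) p.1.
have c1 : c <= eA / 2 by rewrite ge_min lexx.
have c2' : c <= p.1 by rewrite ge_min lexx orbT.
have c0 : 0 < c by rewrite lt_min; apply/andP; split; near_lra.
have cG := @lune_exp_ray q.2 0 p.1 q2 (lexx 0) ltac:(near_lra).
have lu s phi : 0 <= phi <= a -> 0 < s <= p.1 -> lune a (s, phi).
  by move=> ? ?; split=> /=; near_lra.
have H : G (c, q.2) = G (c, p.2).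
  apply: (@lune_exp_unique_ray p.2 (fun u => G (u, q.2)) p.1 p2 p1' cG _ p.1); [ |near_lra| |near_lra].
    move=> u uI; have [? ->] := lune_exp_square_dev (lu u q.2 q2 uI); split=> //=.
    by apply: row3P; rewrite !polarE ?c2 ?s2.
  by rewrite [in LHS]r12 -!surjective_pairing.
have [_ _ _ psiI _] := psi_chart.
have sp : sector eA a (c, p.2) by split=> //=; near_lra.
have sq : sector eA a (c, q.2) by split=> //=; near_lra.
move: H; rewrite !lune_exp_chart//= => H.
by have [_ []] := psiI _ _ _ _ sp sq (esym H); [near_lra|].
Qed.

Lemma digon_unit x : square x -> dot (dev x) (dev x) = 1.
Proof.
move=> Sx; have [[k o]|o] := sideP x.
  have [r rI ->] := dg_side_surj dg Sx o.
  by have [_ _ ->] := dg_side dg k rI; exact: dot_polar_unit.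
have [Q [ray F]] := dg_int dg Sx o; have p0 := pi_gt0 R.
have [|_ ->] := fan_center _ F; first by near_lra.
by have [rQ _] := F; rewrite dot_rotation// dot_polar_unit.
Qed.

Lemma side_pi k : side k pi = (1, 1).
Proof. by rewrite -lune_exp_sides ?lune_exp_south// lexx pi_ge0. Qed.

(** A limit point of the rays other than (1, 1) would be an interior point x over
    the south pole. Close to it, a small parallel lifts to a closed curve around
    x, which by uniqueness of lifts contains the image of that parallel under the
    exponential map. But the end points of this image are on the sides. *)
Lemma lune_exp_to_south e : 0 < e -> exists2 d, 0 < d &
  forall p, lune a p -> pi - d < p.1 < pi -> ball ((1, 1) : R * R) e (G p).
Proof.
move=> e0; apply: contrapT => nd; have p0 := pi_gt0 R; have a0 := dg_gt0 dg.
pose S d x := exists p, [/\ lune a p, pi - d < p.1 < pi, x = G p & ~ ball ((1, 1) : R * R) e x].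
have [||x Sx Hx] := @compact_cluster R _ _ S (@compact_square R).
- by move=> d d' y dd' [p [lp pd yE nb]]; exists p; split=> //; near_lra.
- move=> d d0; apply: contrapT => nx; apply: nd; exists d => // p lp pd.
  apply: contrapT => nb; apply: nx; exists (G p); first by case: (lune_exp_square_dev lp).
  by exists p.
have xN : x <> (1, 1).
  by move=> xE; have [y [Sy [p [_ _ _ nb]] xy]] := Hx e e0; apply: nb; rewrite -xE.
have near b : 0 < b -> exists2 d, 0 < d & forall r, pi - d < r < pi ->
    `|sin r| < b /\ `|cos r + 1| < b.
  move=> b0; have [d1 d10 H1] := continuous_ball (@continuous_sin R pi) b0.
  have [d2 d20 H2] := continuous_ball (@continuous_cos R pi) b0.
  have [d [d0 dd1 dd2 _ _]] := min4 d10 d20 d10 d20.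
  exists d => // r rI; have h : `|pi - r| < d by rewrite ger0_norm; near_lra.
  split; first by rewrite -normrN -sub0r -(@sinpi R); apply: H1; near_lra.
  by rewrite -normrN opprD addrC -(@cospi R); apply: H2; near_lra.
have z1 : dev x 0 c2 = -1.
  apply/eqP; rewrite -subr_eq0 -normr_eq0; apply/negPn/negP => n0.
  have b0 : 0 < `|dev x 0 c2 - -1| / 2 by rewrite divr_gt0// lt_neqAle eq_sym n0 normr_ge0.
  have [d1 d10 H1] := dg_cont dg Sx b0; have [d2 d20 H2] := near _ b0.
  have [d [d0 dd1 dd2 _ _]] := min4 d10 d20 d10 d20.
  have [y [Sy [p [lp pd yE nb]] xy]] := Hx d d0.
  have [_ Ep] := lune_exp_square_dev lp.
  have [_ /(_ 0 c2)] := H1 y Sy (ballS dd1 xy); rewrite /ball/= yE Ep polarE => h1.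
  have [|_ h2] := H2 p.1; first by near_lra.
  have := ler_normD (dev x 0 c2 - cos p.1) (cos p.1 + 1).
  have -> : dev x 0 c2 - cos p.1 + (cos p.1 + 1) = dev x 0 c2 - -1 by ring.
  by near_lra.
have cN1 r : 0 <= r <= pi -> cos r = -1 -> r = pi.
  by move=> rI cr; apply: cos_inj; rewrite ?in_itv/= ?lexx ?(ltW p0)// cr cospi.
have o k : ~ on k x.
  move=> o; have [r rI xE] := dg_side_surj dg Sx o.
  have [_ _] := dg_side dg k rI; rewrite -xE => E; move: z1; rewrite E polarE => /(cN1 _ rI) rE.
  by apply: xN; rewrite xE rE side_pi.
have := digon_unit Sx; rewrite dotE z1 => x1.
have x00 : dev x 0 c0 = 0 by nra.
have x01 : dev x 0 c1 = 0 by nra.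
have [eta eta0 inj] := interior_injective_near dg Sx o.
have [d0 d00 Hd0] := off_side Sx (o false); have [d1 d10 Hd1] := off_side Sx (o true).
have heta : 0 < eta / 2 by near_lra.
have [m [m0 meta md0 md1 _]] := min4 heta d00 d10 d10.
have [Q [ray F]] := dg_int dg Sx o.
have twopi : 0 <= 2 * pi :> R by near_lra.
have [d2 d20 Hd2] := fan_surj F twopi m0.
have [d3 d30 Hd3] := near _ d20.
have [d4 [d40 d4m d43 d4pi _]] := min4 m0 d30 p0 d30.
have [y [Sy [p [lp pd yE nb]] xy]] := Hx d4 d40.
have [|sr cr] := Hd3 p.1; first by near_lra.
have [lp1 lp2] := lp.
have loop th : exists z, [/\ square z, ball x m z & dev z = polar p.1 th].
  apply: Hd2; [exact: dot_polar_unit | | by left].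
  split=> // i j; rewrite ord1 /ball/=.
  case: (ord3P j) => ->; rewrite ?x00 ?x01 ?z1 polarE ?sub0r ?normrN ?normrM.
  - by apply: le_lt_trans sr; rewrite ler_piMr// cos_max.
  - by apply: le_lt_trans sr; rewrite ler_piMr// sin_max.
  - by rewrite -normrN opprB opprK.
have [c Hc] := choice loop.
have agree z th : square z -> ball x eta z -> dev z = polar p.1 th -> z = c th.
  move=> Sz xz Ez; have [Sc xc Ec] := Hc th; apply: inj => //; last by rewrite Ec.
  by apply: ballS xc; near_lra.
have cC : {within `[0, a], continuous c}.
  apply/within_continuousP => th _ eps eps0.
  have [Sc xc Ec] := Hc th.
  have [Q' [ray' F']] := dg_int dg Sc
    ltac:(by case; [exact: (Hd1 _ (ballS md1 xc)) | exact: (Hd0 _ (ballS md0 xc))]).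
  have [m' [m'0 m'e m'eta _ _]] := min4 eps0 heta eps0 heta.
  have [d5 d50 Hd5] := fan_surj F' twopi m'0.
  have [d6 d60 Hd6] := polar_ball (p.1, th) d50.
  exists d6 => // th' _ tt'.
  have [|||z [Sz cz Ez]] := Hd5 (polar p.1 th').
  - exact: dot_polar_unit.
  - by rewrite Ec; apply: (Hd6 (p.1, th')); split=> //=; exact: ballxx.
  - by left.
  rewrite -(agree z th')//; first exact: ballS cz.
  exact: (ball2_half (ballS meta xc) (ballS m'eta cz)).
have p1 : 0 < p.1 < pi by near_lra.
have [_ Ep] := lune_exp_square_dev lp.
have E : forall u, 0 <= u <= a -> G (p.1, u) = c u.
  apply: (@unique_lift _ dev (@square R) (fun u => G (p.1, u)) c 0 a p.2 _ cC) => //.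
  - by apply: lune_exp_parallel; near_lra.
  - move=> u uI; have [|? _] := @lune_exp_square_dev (p.1, u); first by split=> //=; near_lra.
    by split=> //; case: (Hc u).
  - move=> u uI; have [|_ ->] := @lune_exp_square_dev (p.1, u); first by split=> //=; near_lra.
    by case: (Hc u).
  - by move=> u uI; apply: lune_exp_injective_near => /=; near_lra.
  rewrite -surjective_pairing; apply: agree => //; first by case: (lune_exp_square_dev lp).
  by rewrite -yE; apply: ballS xy; near_lra.
have [Sc xc Ec] := Hc 0.
apply: (Hd0 _ (ballS md0 xc)); rewrite -E; last by near_lra.
rewrite (lune_exp_sides false); last by near_lra.
by have [|_ ? _] := @dg_side _ _ _ _ dg false p.1; first by near_lra.
Qed.

Lemma lune_exp_continuous_everywhere p : lune a p -> forall e, 0 < e ->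
  exists2 d, 0 < d & forall q, lune a q -> ball p d q -> ball (G p) e (G q).
Proof.
move=> lp e e0; have [p1 p2] := lp.
have [ppi|ppi] := ltP p.1 pi; first exact: lune_exp_continuous.
have pE : p.1 = pi by near_lra.
have [d d0 H] := lune_exp_to_south e0; exists d => // q lq [pq _].
move: pq; rewrite /ball/= ltr_norml pE => pq; rewrite lune_exp_south//.
have [q1 q2] := lq; have [qpi|qpi] := ltP q.1 pi; first by apply: H => //; near_lra.
by rewrite lune_exp_south; [exact: ballxx | near_lra].
Qed.

(** Along a side through G p the region is a half disc ([side_half]), which bounds
    the longitude on that side. *)
Lemma longitude_near p : lune a p -> 0 < p.1 < pi ->
  exists2 e, 0 < e & forall q y, square y -> ball (G p) e y -> ball p e q -> 0 < q.1 < pi ->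
    dev y = polar q.1 q.2 -> 0 <= q.2 <= a.
Proof.
move=> lp p1'; have [p1 p2] := lp; have pi0 := pi_gt0 R; have a0 := dg_gt0 dg.
have [Sp Ep] := lune_exp_square_dev lp; have [_ _ _ _ h] := lune_exp_adm p1' p2.
have [[k o]|o] := sideP (G p).
  have [_ xE _ _] := on_polar dg Sp o p1' Ep; have p2k := h k o.
  have [ray0 [ray1 [Q [F half]]]] := side_half dg k p1'; rewrite -xE in F.
  have [e4 e40 H4] := fan_half F.
  have [e3 [e30 e3a e3pi e34 _]] := min4 a0 pi0 e40 a0.
  exists e3 => // q y Sy py [_ pq] q1 Ey.
  move: pq; rewrite /ball/= p2k ltr_norml => pq.
  have := H4 y Sy (ballS e34 py); rewrite Ey half pmulr_rge0 ?sin_gt0_pi// => sq.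
  have neg u : - pi < u < 0 -> sin u < 0.
    by move=> uI; rewrite -oppr_gt0 -sinN; apply: sin_gt0_pi; near_lra.
  case: (k) pq sq => /= pq sq; (apply/andP; split; try near_lra); rewrite leNgt; apply/negP => q2.
    by have := neg (a - q.2) ltac:(near_lra); near_lra.
  by have := neg q.2 ltac:(near_lra); near_lra.
have p2' : 0 < p.2 < a.
  have onside (p' : R) : G p = G (p.1, p') -> forall k, p' = long a k -> on k (G p).
    move=> -> k ->; rewrite lune_exp_sides//.
    by have [] := @dg_side _ _ _ _ dg k _ p1.
  rewrite !lt_neqAle; case/andP: p2 => -> ->; rewrite !andbT; apply/andP; split.
    by apply/eqP => p20; apply: (o false); apply: (onside 0); rewrite // p20 -surjective_pairing.
  by apply/eqP => p2a; apply: (o true); apply: (onside a); rewrite // -p2a -surjective_pairing.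
have [e3 [e30 e3a e3pi _ _]] := @min4 _ p.2 (a - p.2) 1 1 ltac:(near_lra) ltac:(near_lra) ltac:(near_lra) ltac:(near_lra).
exists e3 => // q y Sy py [_ pq] q1 Ey.
by move: pq; rewrite /ball/= ltr_norml => pq; near_lra.
Qed.

Lemma lune_exp_open_south : exists2 e, 0 < e &
  forall y, square y -> ball ((1, 1) : R * R) e y -> exists2 q, lune a q & G q = y.
Proof.
have eA0 := eA_bounds; have pi0 := pi_gt0 R; have a0 := dg_gt0 dg.
have [th [eD [psiD [[eD0 th0] [psiC psiS [d d0 H] psiI psi0] psiR psiDev]]]] := dg_D dg.
exists d => // y Sy py; have := H y Sy py; move=> [r [phi [s yE]]]; have [/= s1' s2'] := s.
have [rz|rz] := eqVneq r 0.
  exists (pi, 0); first by split=> /=; near_lra.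
  by rewrite lune_exp_south// -yE rz psi0.
have r0 : 0 < r by rewrite lt_neqAle eq_sym rz; case/andP: s1'.
pose m := Num.min phi a.
have m1 : m <= phi by rewrite ge_min lexx.
have m2 : m <= a by rewrite ge_min lexx orbT.
have m0 : 0 <= m by rewrite le_min; apply/andP; split; near_lra.
have sec u : 0 <= u <= m -> sector eD th (r, u) by move=> uI; split=> //=; near_lra.
have lu u : 0 <= u <= m -> lune a (pi - r, a - u) by move=> uI; split=> /=; near_lra.
have E : forall u, 0 <= u <= m -> psiD (r, u) = G (pi - r, a - u).
  apply: (@unique_lift _ dev (@square R) (fun u => psiD (r, u))
    (fun u => G (pi - r, a - u)) 0 m 0).
  - apply/within_continuousP => u; rewrite /= in_itv/= => uI e e0.
    have [d1 d10 H1] := (within_continuousP _ _).1 psiC _ (sec u uI) e e0.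
    exists d1 => // u'; rewrite /= in_itv/= => uI' uu'; apply: H1; first exact: sec.
    by split=> //=; exact: ballxx.
  - have /within_continuousP GC := @lune_exp_parallel (pi - r) ltac:(near_lra).
    apply/within_continuousP => u; rewrite /= in_itv/= => uI e e0.
    have [|d1 d10 H1] := GC (a - u) _ e e0; first by rewrite /= in_itv/=; near_lra.
    exists d1 => // u'; rewrite /= in_itv/= => uI' uu'; apply: H1.
      by rewrite /= in_itv/=; near_lra.
    by move: uu'; rewrite /ball/= -normrN; congr (`|_| < _); ring.
  - by move=> u uI; split; [exact/psiS/sec | case: (lune_exp_square_dev (lu u uI))].
  - by move=> u uI; rewrite psiDev; [case: (lune_exp_square_dev (lu u uI)) => _ -> | exact: sec].
  - move=> u uI; apply: (@polar_injective_near _ _ _ _ dg _ (pi - r) (a - u)).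
    + exact/psiS/sec.
    + near_lra.
    + by apply: psiDev; exact: sec.
  - by rewrite lexx.
  - have [|-> _] := psiR r; first by near_lra.
    by rewrite subr0 (lune_exp_sides true)//; near_lra.
have [pa|ap] := leP phi a.
  exists (pi - r, a - phi); first by split=> /=; near_lra.
  have pm : phi <= m by rewrite le_min lexx.
  by rewrite -yE E//; near_lra.
have ma : m = a by apply/eqP; rewrite eq_le m2 le_min lexx (ltW ap).
have := E a; rewrite ma lexx ltW// => /(_ isT); rewrite subrr.
rewrite (lune_exp_sides false); last by near_lra.
have [|_ <-] := psiR r; first by near_lra.
have sa : sector eD th (r, a) by split=> //=; near_lra.
have st : sector eD th (r, th) by split=> //=; near_lra.
by move=> /(psiI _ _ _ _ sa st)[_ []]; [move/eqP: rz|near_lra].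
Qed.

(** At the two poles this is read off in the charts there; elsewhere nearby points
    develop to points with polar coordinates in the lune. *)
Lemma lune_exp_open p : lune a p -> exists2 e, 0 < e &
  forall y, square y -> ball (G p) e y -> exists2 q, lune a q & G q = y.
Proof.
move=> lp; have [p1 p2] := lp; have eA0 := eA_bounds; have pi0 := pi_gt0 R.
have a0 := dg_gt0 dg; have [Sp Ep] := lune_exp_square_dev lp.
have [pz|pz] := eqVneq p.1 0.
  have [_ _ [d d0 H] _ _] := psi_chart.
  have ce : cos (eA / 2) < 1 by apply: cos_lt1; near_lra.
  have [d1 d10 H1] := dg_cont dg Sp (e := 1 - cos (eA / 2)) ltac:(near_lra).
  have [e [e0 ed ed1 _ _]] := min4 d0 d10 d0 d10.
  have gp : G p = (0, 0) by rewrite lune_exp_north.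
  exists e => // y Sy py; have := H y Sy; rewrite -gp.
  move=> /(_ (ballS ed py)) [r [phi [s yE]]].
  have [_ /(_ 0 c2)] := H1 y Sy (ballS ed1 py).
  rewrite /ball/= Ep -yE (psi_dev s) !polarE pz cos0 ltr_norml => cr.
  have [/= s1' s2'] := s.
  have re : r <= eA / 2.
    rewrite leNgt; apply/negP => er.
    have : cos r < cos (eA / 2) by rewrite ltr_cos// in_itv/=; near_lra.
    by near_lra.
  by exists (r, phi); [split=> /=; near_lra | rewrite lune_exp_chart].
have [ppi|ppi] := eqVneq p.1 pi.
  by rewrite lune_exp_south//; exact: lune_exp_open_south.
have p1' : 0 < p.1 < pi by rewrite !lt_neqAle eq_sym pz ppi.
have [eta eta0 inj] := lune_exp_injective_near p1' p2.
have [d1 d10 H1] := lune_exp_continuous_everywhere lp eta0.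
have [e3 e30 H4] := longitude_near lp p1'.
have [m [m0 md1 me3 mp mpi]] := @min4 _ d1 e3 p.1 (pi - p.1) d10 e30 ltac:(near_lra) ltac:(near_lra).
have [d2 d20 H2] := polar_local_inverse p1' m0.
have [d3 d30 H3] := dg_cont dg Sp d20.
have [e [e0 ee ed3 ee4 _]] := min4 eta0 d30 e30 d30.
exists e => // y Sy py.
have [|q [pq yE]] := H2 (dev y) (digon_unit Sy).
  by rewrite -Ep; apply: H3 => //; exact: ballS py.
have [pq1 _] := pq; move: pq1; rewrite /ball/= ltr_norml => pq1.
have q1 : 0 < q.1 < pi by near_lra.
have q2 := H4 q y Sy (ballS ee4 py) (ballS me3 pq) q1 yE.
have lq : lune a q by split=> //; near_lra.
have [Sq Eq] := lune_exp_square_dev lq.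
exists q => //; apply: inj => //; last by rewrite Eq yE.
  by apply: H1 => //; exact: ballS pq.
exact: ballS py.
Qed.

(** Real induction along the segment from (0, 0) to x: the image is closed, the
    lune being compact, and open. *)
Lemma lune_exp_onto x : square x -> exists2 p, lune a p & G p = x.
Proof.
move=> Sx; have pi0 := pi_gt0 R; have a0 := dg_gt0 dg; have [x1 x2] := Sx.
have St u : 0 <= u <= 1 -> square (u * x.1, u * x.2) by move=> uI; split=> /=; nra.
suff H : forall t, 0 <= t <= 1 -> exists2 p, lune a p & G p = (t * x.1, t * x.2).
  have [|p lp E] := H 1; first by rewrite ler01 lexx.
  by exists p => //; rewrite E !mul1r -surjective_pairing.
apply: real_induction => t tI IH.
have step u : `|t - u| <= `|t - u| * 1 by rewrite mulr1.
have close e u : 0 < e -> `|t - u| < e -> ball (t * x.1, t * x.2) e (u * x.1, u * x.2).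
  move=> e0 tu; split; rewrite /ball/= -mulrBl normrM;
    (apply: le_lt_trans tu; rewrite ler_piMr// ger0_norm; near_lra).
have [p lp E] : exists2 p, lune a p & G p = (t * x.1, t * x.2).
  have [->|tz] := eqVneq t 0.
    by exists (0, 0); [split=> /=; near_lra | rewrite lune_exp_north// !mul0r].
  have t0 : 0 < t by rewrite lt_neqAle eq_sym tz; case/andP: tI.
  pose S e p := exists u, [/\ t - e < u < t, 0 <= u & G p = (u * x.1, u * x.2)].
  have [||p lp Hp] := @compact_cluster R _ _ S (@compact_lune R a).
  - by move=> e e' p ee' [u [uI u0 pE]]; exists u; split=> //; near_lra.
  - move=> e e0; pose u := Num.max 0 (t - e / 2).
    have u0 : 0 <= u by rewrite le_max lexx.
    have u2 : t - e / 2 <= u by rewrite le_max lexx orbT.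
    have u3 : u < t by rewrite gt_max t0/=; near_lra.
    have [|p lp pE] := IH u; first by near_lra.
    by exists p => //; exists u; split=> //; near_lra.
  exists p => //; apply: ball2_eq => e e0.
  have he : 0 < e / 2 by near_lra.
  have [d d0 H] := lune_exp_continuous_everywhere lp he.
  have [d' [d'0 d'd d'e _ _]] := min4 d0 he d0 he.
  have [q [lq [u [uI u0 qE]] pq]] := Hp d' d'0.
  apply: (@ball2_half _ _ (G q)); first exact/H/(ballS d'd).
  by rewrite qE; apply: ball_sym; apply: close => //; rewrite ger0_norm; near_lra.
split; first by exists p.
have [e e0 H] := lune_exp_open lp.
exists e => // u ut u1; have uI : 0 <= u <= 1 by near_lra.
by apply: H; [exact: St | rewrite E; apply: close => //; rewrite distrC ger0_norm; near_lra].
Qed.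


End Exponential.

(** A parametrization of a digon by the lune of the same angle; it collapses the
    edges of the lune that stand for the poles. *)
Record lune_map (R : realType) (a : R) (dev : R * R -> 'rV[R]_3) (side : bool -> R -> R * R)
    (G : R * R -> R * R) : Prop := LuneMap {
  lm_square : forall p, lune a p -> square (G p);
  lm_dev : forall p, lune a p -> dev (G p) = polar p.1 p.2;
  lm_continuous : forall p, lune a p -> forall e, 0 < e -> exists2 d, 0 < d &
    forall q, lune a q -> ball p d q -> ball (G p) e (G q);
  lm_onto : forall x, square x -> exists2 p, lune a p & G p = x;
  lm_inj : forall p q, lune a p -> lune a q -> G p = G q ->
    [\/ p = q, p.1 = 0 /\ q.1 = 0 | p.1 = pi /\ q.1 = pi];
  lm_side : forall k r, 0 <= r <= pi -> G (r, long a k) = side k r;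
  lm_north : forall p, p.1 = 0 -> G p = (0, 0);
  lm_south : forall p, p.1 = pi -> G p = (1, 1) }.

Lemma digon_lune (R : realType) (a : R) (dev : R * R -> 'rV[R]_3) (side : bool -> R -> R * R) :
  digon a dev side -> exists G, lune_map a dev side G.
Proof.
move=> dg; have [e [psi [e0 ch rays pdev]]] := dg_A dg.
exists (lune_exp a dev e psi); split.
- by move=> p lp; case: (lune_exp_square_dev dg e0 ch rays pdev lp).
- by move=> p lp; case: (lune_exp_square_dev dg e0 ch rays pdev lp).
- by move=> p lp; exact: (lune_exp_continuous_everywhere dg e0 ch rays pdev lp).
- exact: (lune_exp_onto dg e0 ch rays pdev).
- exact: (lune_exp_injective dg e0 ch rays pdev).
- exact: (lune_exp_sides dg e0 ch rays pdev).
- by move=> p; exact: lune_exp_north.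
- by move=> p; exact: lune_exp_south.
Qed.

(** * Two triangles with straight corners form a digon *)

Section Fans.
Variable R : realType.
Implicit Types (r phi th s t u c e d b : R) (v w : 'rV[R]_3) (P Q M : 'M[R]_3).
Implicit Types (x y p q : R * R) (D : set (R * R)).

Lemma fan_mulmx D dev x th ray0 ray1 Q M : rotation M -> fan D dev x th ray0 ray1 Q ->
  fan D (fun y => dev y *m M) x th ray0 ray1 (Q *m M).
Proof.
move=> rM [rQ [e [psi [e0 [H1 H2 H3 H4 H5]]]]].
split; first exact: rotationM.
exists e, psi; split=> //; split=> // r phi s; have [Dy ->] := H1 r phi s.
by rewrite mulmxA.
Qed.

(** Only the germ of the region and of its development matters. *)
Lemma fan_extend D D' dev dev' x th ray0 ray1 Q :
  (forall y, D y -> D' y /\ dev y = dev' y) ->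
  (exists2 d, 0 < d & forall y, D' y -> ball x d y -> D y) ->
  fan D dev x th ray0 ray1 Q -> fan D' dev' x th ray0 ray1 Q.
Proof.
move=> HD [d d0 Hd] [rQ [e [psi [e0 [H1 [d1 d10 H2] H3 H4 H5]]]]].
split=> //; exists e, psi; split=> //; split=> //.
  by move=> r phi s; have [Dy <-] := H1 r phi s; have [D'y <-] := HD _ Dy.
have [d2 [d20 d21 d22 _ _]] := min4 d0 d10 d0 d10.
exists d2 => // y D'y xy; apply: H2; last exact: ballS xy.
by apply: Hd => //; exact: ballS xy.
Qed.

Lemma fan_rays D dev x th ray0 ray1 ray0' ray1' Q :
  (forall r, ray0 r = ray0' r) -> (forall r, ray1 r = ray1' r) ->
  fan D dev x th ray0 ray1 Q -> fan D dev x th ray0' ray1' Q.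
Proof.
move=> E0 E1 [rQ [e [psi [e0 [H1 H2 H3 H4 H5]]]]].
by split=> //; exists e, psi; split=> //; split=> // r rI; rewrite -E0 -E1; exact: H5.
Qed.

Definition flip x := (1 - x.1, 1 - x.2).

Lemma flipK x : flip (flip x) = x.
Proof. by case: x => x1 x2; rewrite /flip /=; congr (_, _); ring. Qed.

Lemma ball_flip x e y : ball x e y -> ball (flip x) e (flip y).
Proof.
by move=> [b1 b2]; split; move: b1 b2; rewrite /ball/= => b1 b2;
  [move: b1 | move: b2]; rewrite -normrN; congr (`|_| < _); ring.
Qed.

Lemma fan_flip D dev x th ray0 ray1 Q : fan D dev x th ray0 ray1 Q ->
  fan [set y | D (flip y)] (fun y => dev (flip y)) (flip x) th
    (fun r => flip (ray0 r)) (fun r => flip (ray1 r)) Q.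
Proof.
move=> [rQ [e [psi [e0 [H1 [d d0 H2] H3 H4 H5]]]]].
split=> //; exists e, (fun q => flip (psi q)); split=> //; split.
- by move=> r phi s; rewrite /= flipK; exact: H1.
- exists d => // y Dy xy; have := ball_flip xy; rewrite flipK => xy'.
  by have [r [phi [s E]]] := H2 (flip y) Dy xy'; exists r, phi; rewrite E flipK.
- move=> d' d'0; have [d2 d20 H] := H3 d' d'0; exists d2 => // r phi s rd.
  exact/ball_flip/H.
- by move=> phi phiI; rewrite H4.
- by move=> r rI; have [-> ->] := H5 r rI.
Qed.

(** A point near x develops near dev x, so it is at a small distance r on its ray. *)
Lemma fan_shrink D dev x th ray0 ray1 Q e psi b : rotation Q -> 0 < e < pi ->
  (forall eps, 0 < eps -> exists2 d, 0 < d &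
    forall y, D y -> ball x d y -> ball (dev x) eps (dev y)) ->
  dev x = polar 0 0 *m Q -> 0 < b ->
  fan_map D dev x th ray0 ray1 Q e psi ->
  exists2 d, 0 < d & forall y, D y -> ball x d y ->
        exists r phi, [/\ sector e th (r, phi), r < b & psi (r, phi) = y].
Proof.
move=> rQ e0 cdev devx b0 [H1 [d d0 H2] H3 H4 H5]; have p0 := pi_gt0 R.
pose c := Num.min b (pi / 2).
have c0 : 0 < c by rewrite lt_min b0 divr_gt0.
have cb : c <= b by rewrite ge_min lexx.
have cpi : c <= pi / 2 by rewrite ge_min lexx orbT.
have cc : cos c < 1 by apply: cos_lt1; near_lra.
have [d1 d10 Hd1] := @close_dot R (1 - cos c) ltac:(near_lra).
have [d2 d20 Hd2] := cdev d1 d10.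
have [d3 [d30 d3d d32 _ _]] := min4 d0 d20 d0 d20.
exists d3 => // y Dy xy; have [r [phi [s E]]] := H2 y Dy (ballS d3d xy).
exists r, phi; split=> //; rewrite ltNge; apply/negP => br.
have [_ Ey] := H1 r phi s; have [/= sr _] := s.
have : 1 - (1 - cos c) < dot (dev x) (dev y).
  apply: Hd1; last exact/Hd2/(ballS d32).
    by rewrite devx dot_rotation// dot_polar_unit.
  by rewrite -E Ey dot_rotation// dot_polar_unit.
rewrite devx -E Ey dot_rotation// dot_polar_center.
have : cos r <= cos c.
  have [->//|rc] := eqVneq r c.
  have cr : c < r by rewrite lt_neqAle eq_sym rc; near_lra.
  by apply/ltW; rewrite ltr_cos// in_itv/=; near_lra.
by near_lra.
Qed.

(** The two charts may have different radii. By [fan_shrink] the rays of both that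
    are shorter than the smaller radius still fill a neighbourhood of x. *)
Lemma fan_merge D1 D2 dev x th1 th2 ray0 ray1 ray2 Q : 0 < th1 -> 0 < th2 ->
  (forall eps, 0 < eps -> exists2 d, 0 < d &
    forall y, (D1 `|` D2) y -> ball x d y -> ball (dev x) eps (dev y)) ->
  fan D1 dev x th1 ray0 ray1 Q -> fan D2 dev x th2 ray1 ray2 (Zrot th1 *m Q) ->
  fan (D1 `|` D2) dev x (th1 + th2) ray0 ray2 Q.
Proof.
move=> th10 th20 cdev F1 F2.
have [_ devx1] := fan_center (ltW th10) F1; have [_ devx2] := fan_center (ltW th20) F2.
have c1' eps : 0 < eps -> exists2 d, 0 < d &
    forall y, D1 y -> ball x d y -> ball (dev x) eps (dev y).
  by move=> /cdev[d d0 H]; exists d => // y Dy; apply: H; left.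
have c2' eps : 0 < eps -> exists2 d, 0 < d &
    forall y, D2 y -> ball x d y -> ball (dev x) eps (dev y).
  by move=> /cdev[d d0 H]; exists d => // y Dy; apply: H; right.
have [rQ [e [psi [e0 F1']]]] := F1; have [rQ' [e' [psi' [e'0 F2']]]] := F2.
pose m := Num.min e e'.
have me : m <= e by rewrite ge_min lexx.
have me' : m <= e' by rewrite ge_min lexx orbT.
have m0 : 0 < m by rewrite lt_min; apply/andP; split; near_lra.
have [d d0 H2] := fan_shrink rQ e0 c1' devx1 m0 F1'.
have [d' d'0 H2'] := fan_shrink rQ' e'0 c2' devx2 m0 F2'.
have [H1 _ H3 H4 H5] := F1'; have [H1' _ H3' H4' H5'] := F2'.
have sL r phi : sector m (th1 + th2) (r, phi) -> phi <= th1 -> sector e th1 (r, phi).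
  by move=> [/= ? ?] ?; split=> /=; near_lra.
have sR r phi : sector m (th1 + th2) (r, phi) -> th1 < phi -> sector e' th2 (r, phi - th1).
  by move=> [/= ? ?] ?; split=> /=; near_lra.
split=> //; exists m, (fun q => if q.2 <= th1 then psi q else psi' (q.1, q.2 - th1)).
split; first by near_lra.
split=> /=.
- move=> r phi s; case: leP => h; first by have [? ?] := H1 _ _ (sL _ _ s h); split=> //; left.
  have [? ->] := H1' _ _ (sR _ _ s h); split; first by right.
  by rewrite mulmxA polar_Zrot subrK.
- have [d3 [d30 d3d d3d' _ _]] := min4 d0 d'0 d0 d'0.
  exists d3 => // y [] Dy xy.
    have [r [phi [s rm E]]] := H2 y Dy (ballS d3d xy); have [/= ? ?] := s.
    exists r, phi; have -> : phi <= th1 by near_lra.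
    by split=> //; split=> /=; near_lra.
  have [r [phi [s rm E]]] := H2' y Dy (ballS d3d' xy); have [/= ? ?] := s.
  have [phi0|phi0] := eqVneq phi 0.
    exists r, th1; rewrite lexx; split; first by split=> /=; near_lra.
    have [|_ ->] := H5 r; first by near_lra.
    have [|<- _] := H5' r; first by near_lra.
    by rewrite -phi0.
  have phigt : 0 < phi by rewrite lt_neqAle eq_sym phi0; near_lra.
  exists r, (th1 + phi); split; first by split=> /=; near_lra.
  by rewrite leNgt (_ : th1 < th1 + phi) /= ?(addrC th1) ?addrK//; near_lra.
- move=> eps eps0; have [b b0 Hb] := H3 eps eps0; have [b' b'0 Hb'] := H3' eps eps0.
  have [b3 [b30 b3b b3b' _ _]] := min4 b0 b'0 b0 b'0.
  exists b3 => // r phi s rb; case: leP => h.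
    by apply: Hb; [exact: sL | near_lra].
  by apply: Hb'; [exact: sR | near_lra].
- by move=> phi phiI; case: leP => h; [apply: H4 | apply: H4']; near_lra.
move=> r rI; rewrite (ltW th10) leNgt (_ : th1 < th1 + th2) /=; last by near_lra.
have [|-> _] := H5 r; first by near_lra.
by have [|_ <-] := H5' r; [near_lra | rewrite (addrC th1) addrK].
Qed.

End Fans.

Section Sides.
Variable R : realType.
Implicit Types (r s e : R) (x y : R * R).

Lemma side_point_c0 s : side_point (R := R) c0 s = (s, 0).
Proof. by rewrite /side_point /vertex /=; congr (_, _); ring. Qed.

Lemma side_point_c1 s : side_point (R := R) c1 s = (1 - s, s).
Proof. by rewrite /side_point /vertex /=; congr (_, _); ring. Qed.

Lemma side_point_c2 s : side_point (R := R) c2 s = (0, 1 - s).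
Proof. by rewrite /side_point /vertex /=; congr (_, _); ring. Qed.

Lemma flip_side1 s : flip (side_point (R := R) c1 s) = side_point c1 (1 - s).
Proof. by rewrite /flip /side_point /vertex /=; congr (_, _); ring. Qed.

Lemma simplex_square x : simplex x -> square x /\ x.1 + x.2 <= 1.
Proof. by move=> [? ? ?]; split=> //; split; lra. Qed.

Lemma square_simplex x : square x -> x.1 + x.2 <= 1 -> simplex x.
Proof. by move=> [? ?] ?; split; lra. Qed.

Lemma flip_simplex_square x : simplex (flip x) -> square x /\ 1 <= x.1 + x.2.
Proof. by move=> [/= ? ? ?]; split; [split; lra | lra]. Qed.

Lemma square_flip_simplex x : square x -> 1 <= x.1 + x.2 -> simplex (flip x).
Proof. by move=> [? ?] ?; split=> /=; lra. Qed.

Variables (l m : R).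
Hypotheses (l_gt0 : 0 < l) (m_gt0 : 0 < m).

(** The square is cut along its second diagonal into two triangles; the sides
    of the digon run along the legs of both, of lengths l and m. *)
Definition legs (k : bool) r : R * R :=
  let u := Num.min (r / l) 1 in let v := Num.max 0 ((r - l) / m) in
  if k then (v, u) else (u, v).

Lemma legs_first k r : r <= l -> legs k r = if k then (0, r / l) else (r / l, 0).
Proof.
move=> rl; rewrite /legs.
have -> : Num.min (r / l) 1 = r / l by apply/min_idPl; rewrite ler_pdivrMr// mul1r.
have -> // : Num.max 0 ((r - l) / m) = 0.
by apply/max_idPl; rewrite pmulr_lle0 ?invr_gt0//; lra.
Qed.

Lemma legs_second k r : l <= r ->
  legs k r = if k then ((r - l) / m, 1) else (1, (r - l) / m).
Proof.
move=> rl; rewrite /legs.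
have -> : Num.min (r / l) 1 = 1 by apply/min_idPr; rewrite ler_pdivlMr// mul1r.
have -> // : Num.max 0 ((r - l) / m) = (r - l) / m.
by apply/max_idPr; rewrite divr_ge0 ?subr_ge0// ltW.
Qed.

Lemma legs_continuous k : {within `[0, pi], continuous (legs k)}.
Proof.
apply/within_continuousP => r _ e e0; exists (Num.min (e * l) (e * m)).
  by rewrite lt_min !mulr_gt0.
move=> r' _; rewrite /ball/= lt_min => /andP[h1 h2].
have k1 : `|r / l - r' / l| < e.
  by rewrite -mulrBl normrM normfV (gtr0_norm l_gt0) ltr_pdivrMr.
have k2 : `|(r - l) / m - (r' - l) / m| < e.
  rewrite -mulrBl normrM normfV (gtr0_norm m_gt0) ltr_pdivrMr//.
  by have -> : r - l - (r' - l) = r - r' by ring.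
move: k1 k2; rewrite /legs; set X := r / l; set X' := r' / l.
set Y := (r - l) / m; set Y' := (r' - l) / m; rewrite !ltr_norml => k1 k2.
have X1 : `|Num.min X 1 - Num.min X' 1| < e.
  by rewrite ltr_norml; case: (leP X 1) => ?; case: (leP X' 1) => ?; lra.
have Y1 : `|Num.max 0 Y - Num.max 0 Y'| < e.
  by rewrite ltr_norml; case: (leP 0 Y) => ?; case: (leP 0 Y') => ?; lra.
by case: k; split.
Qed.

Lemma first_fraction r : 0 <= r <= l -> 0 <= r / l <= 1.
Proof.
move=> ?; apply/andP; split; first by apply: divr_ge0; lra.
by rewrite ler_pdivrMr// mul1r; lra.
Qed.

End Sides.

Section TwoTriangles.
Variable R : realType.
Implicit Types (r phi th s t u c e d b : R) (v w : 'rV[R]_3) (P Q M : 'M[R]_3).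
Implicit Types (x y p q : R * R) (D : set (R * R)).
Variables (S T : triangle R) (l m : R).
Hypothesis S0 : tlen S c0 = l.
Hypothesis S2 : tlen S c2 = l.
Hypothesis S1T1 : tlen S c1 = tlen T c1.
Hypothesis T0 : tlen T c0 = m.
Hypothesis T2 : tlen T c2 = m.
Hypothesis lm : l + m = pi.
Hypothesis corner1 : tang S c1 + tang T c2 = pi.
Hypothesis corner2 : tang S c2 + tang T c1 = pi.
Let a := tang S c0.

Let l_gt0 : 0 < l. Proof. by rewrite -S0; exact: tlen_gt0. Qed.
Let m_gt0 : 0 < m. Proof. by rewrite -T0; exact: tlen_gt0. Qed.

(** The apices of S and T are sent to the north and the south pole. The frames NT
    of T are fixed by the common side; that the corners at its ends add up to pi
    makes the legs of T continue those of S along the meridians 0 and a. *)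
Lemma two_triangle_frames : exists NS NT (QS QT : 'I_3 -> 'M[R]_3),
  [/\ and4 (rotation NS) (rotation NT) (forall k, rotation (QS k)) (forall k, rotation (QT k)),
      and3 (QS c0 *m NS = 1%:M) (QS c1 *m NS = Zrot (- tang S c1) *m Eflip l)
        (QS c2 *m NS = Eflip l *m Zrot a),
      and3 (QT c0 *m NT = Eflip pi *m Zrot a)
        (QT c1 *m NT = Zrot (tang S c2) *m (Eflip l *m Zrot a)) (QT c2 *m NT = Yrot l),
      QT c1 *m NT = Eflip (tlen S c1) *m (QS c1 *m NS) &
      and4
      (forall k, (exists e psi, vertex_chart S k e (QS k) psi) /\
                 (exists e psi, vertex_chart T k e (QT k) psi))
      (forall k r, 0 <= r <= tlen S k -> tdev S (side_point k (r / tlen S k)) = polar r 0 *m QS k)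
      (forall k r, 0 <= r <= tlen T k -> tdev T (side_point k (r / tlen T k)) = polar r 0 *m QT k)
      (forall k s, 0 < s < 1 ->
        (fan (@simplex R) (tdev S) (side_point k s) pi
          (fun r => side_point k (s + r / tlen S k))
          (fun r => side_point k (s - r / tlen S k)) (Yrot (s * tlen S k) *m QS k)) /\
        (fan (@simplex R) (tdev T) (side_point k s) pi
          (fun r => side_point k (s + r / tlen T k))
          (fun r => side_point k (s - r / tlen T k)) (Yrot (s * tlen T k) *m QT k)))].
Proof.
have [QS [rS cS gS fS hS]] := triangle_frames S.
have [QT [rT cT gT fT hT]] := triangle_frames T.
pose NS := (QS c0)^T.
have S00 : QS c0 *m NS = 1%:M by case: (rS c0).
have rNS : rotation NS by exact: rotation_tr.
pose e := tlen S c1.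
pose NT := (QT c1)^T *m (Eflip e *m (QS c1 *m NS)).
have T11 : QT c1 *m NT = Eflip e *m (QS c1 *m NS).
  by rewrite /NT mulmxA; case: (rT c1) => -> _; rewrite mul1mx.
have rNT : rotation NT.
  apply: rotationM; first exact: rotation_tr.
  apply: rotationM; first exact: rotation_Eflip.
  exact: rotationM.
have o1 : ordS c0 = c1 :> 'I_3 by exact: val_inj.
have o2 : ordS c1 = c2 :> 'I_3 by exact: val_inj.
have o0 : ordS c2 = c0 :> 'I_3 by exact: val_inj.
have fS0 := fS c0; have fS1 := fS c1; have fS2 := fS c2.
have fT0 := fT c0; have fT1 := fT c1; have fT2 := fT c2.
rewrite o1 S0 in fS0; rewrite o2 in fS1; rewrite o0 S2 -/a in fS2.
rewrite o1 T0 in fT0; rewrite o2 -S1T1 in fT1; rewrite o0 T2 in fT2.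
have S11 : QS c1 *m NS = Zrot (- tang S c1) *m Eflip l.
  transitivity (Zrot (- tang S c1) *m (Zrot (tang S c1) *m QS c1) *m NS).
    by rewrite mulmxA ZrotNK mul1mx.
  by rewrite -fS0 -!mulmxA S00 mulmx1.
have S22 : QS c2 *m NS = Eflip l *m Zrot a.
  transitivity (Eflip l *m (Eflip l *m QS c2) *m NS); first by rewrite mulmxA EflipK mul1mx.
  by rewrite fS2 -!mulmxA S00 mulmx1.
have T11' : QT c1 *m NT = Zrot (tang S c2) *m (Eflip l *m Zrot a).
  by rewrite T11 mulmxA fS1 -mulmxA S22.
have Zpi : Zrot (- pi) = Zrot pi :> 'M[R]_3.
  by rewrite /Zrot cosN sinN sinpi !oppr0.
have T22 : QT c2 *m NT = Yrot l.
  transitivity (Zrot (- tang T c2) *m (Zrot (tang T c2) *m QT c2) *m NT).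
    by rewrite mulmxA ZrotNK mul1mx.
  rewrite -fT1 -!mulmxA T11 (mulmxA (Eflip e) (Eflip e)) EflipK mul1mx S11.
  by rewrite mulmxA ZrotD -opprD addrC corner1 Zpi Zrot_pi_flip.
have T00 : QT c0 *m NT = Eflip pi *m Zrot a.
  transitivity (Eflip m *m (Eflip m *m QT c0) *m NT); first by rewrite mulmxA EflipK mul1mx.
  rewrite fT0 -!mulmxA T11' (mulmxA (Zrot _) (Zrot _)) ZrotD addrC.
  rewrite [tang S c2 + _]corner2 !mulmxA -(mulmxA _ (Zrot pi)) Zrot_pi_flip.
  by rewrite Eflip_Yrot addrC lm.
by exists NS, NT, QS, QT; split=> //; split=> // k s s01; split; [exact: hS | exact: hT].
Qed.

Definition glued_dev NS NT x : 'rV[R]_3 :=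
  if x.1 + x.2 <= 1 then tdev S x *m NS else tdev T (flip x) *m NT.

Lemma glued_dev_upper NS NT :
  (forall x, square x -> x.1 + x.2 = 1 -> tdev S x *m NS = tdev T (flip x) *m NT) ->
  forall x, simplex (flip x) -> glued_dev NS NT x = tdev T (flip x) *m NT.
Proof.
move=> agree x /flip_simplex_square[Sx h]; rewrite /glued_dev; case: leP => // h'.
by apply: agree => //; lra.
Qed.

(** Frames as provided by [two_triangle_frames]. *)
Variables (NS NT : 'M[R]_3) (QS QT : 'I_3 -> 'M[R]_3).
Hypotheses (rNS : rotation NS) (rNT : rotation NT).
Hypothesis S00 : QS c0 *m NS = 1%:M.
Hypothesis S11 : QS c1 *m NS = Zrot (- tang S c1) *m Eflip l.
Hypothesis S22 : QS c2 *m NS = Eflip l *m Zrot a.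
Hypothesis T00 : QT c0 *m NT = Eflip pi *m Zrot a.
Hypothesis T11 : QT c1 *m NT = Zrot (tang S c2) *m (Eflip l *m Zrot a).
Hypothesis T22 : QT c2 *m NT = Yrot l.
Hypothesis T1S1 : QT c1 *m NT = Eflip (tlen S c1) *m (QS c1 *m NS).
Hypothesis chS : forall k, exists e psi, vertex_chart S k e (QS k) psi.
Hypothesis chT : forall k, exists e psi, vertex_chart T k e (QT k) psi.
Hypothesis gS : forall k r, 0 <= r <= tlen S k ->
  tdev S (side_point k (r / tlen S k)) = polar r 0 *m QS k.
Hypothesis gT : forall k r, 0 <= r <= tlen T k ->
  tdev T (side_point k (r / tlen T k)) = polar r 0 *m QT k.
Hypothesis fS : forall k s, 0 < s < 1 ->
  fan (@simplex R) (tdev S) (side_point k s) pi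
    (fun r => side_point k (s + r / tlen S k)) (fun r => side_point k (s - r / tlen S k))
    (Yrot (s * tlen S k) *m QS k).
Hypothesis fT : forall k s, 0 < s < 1 ->
  fan (@simplex R) (tdev T) (side_point k s) pi
    (fun r => side_point k (s + r / tlen T k)) (fun r => side_point k (s - r / tlen T k))
    (Yrot (s * tlen T k) *m QT k).
Local Notation dev := (glued_dev NS NT).

Lemma diagonal_dev x : square x -> x.1 + x.2 = 1 -> tdev S x *m NS = tdev T (flip x) *m NT.
Proof.
move=> [x1 x2] x12; have := tlen_gt0 S c1; set e := tlen S c1 => e0.
have xE : x = side_point c1 (x.2 * e / e).
  by rewrite mulfK ?gt_eqF// side_point_c1 [LHS]surjective_pairing; congr (_, _); lra.
have xE' : flip x = side_point c1 ((e - x.2 * e) / tlen T c1).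
  rewrite -S1T1 -/e (_ : (e - x.2 * e) / e = 1 - x.2); last by field; rewrite gt_eqF.
  by rewrite side_point_c1 /flip; congr (_, _); lra.
rewrite xE' gT -?S1T1 -/e; last by nra.
rewrite -mulmxA T1S1 -/e mulmxA polar_Eflip {1}xE gS -/e; last by nra.
by rewrite -mulmxA; congr (polar _ _ *m _); ring.
Qed.

Lemma glued_devS x : simplex x -> dev x = tdev S x *m NS.
Proof. by move=> /simplex_square[_ h]; rewrite /glued_dev h. Qed.

Lemma glued_devT x : simplex (flip x) -> dev x = tdev T (flip x) *m NT.
Proof. exact: (glued_dev_upper diagonal_dev). Qed.

Lemma glued_dev_continuous x : square x -> forall e, 0 < e -> exists2 d, 0 < d &
  forall y, square y -> ball x d y -> ball (dev x) e (dev y).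
Proof.
move=> Sx e e0.
have contS : simplex x -> exists2 d, 0 < d & forall y, simplex y -> ball x d y ->
    ball (dev x) e (dev y).
  move=> Hx; have [d1 d10 H1] := @mulmx_ball R NS e e0.
  have [d d0 H] := (within_continuousP _ _).1 (@tdev_continuous _ S) x Hx d1 d10.
  by exists d => // y Hy xy; rewrite !glued_devS//; exact/H1/H.
have contT : simplex (flip x) -> exists2 d, 0 < d & forall y, simplex (flip y) -> ball x d y ->
    ball (dev x) e (dev y).
  move=> Hx; have [d1 d10 H1] := @mulmx_ball R NT e e0.
  have [d d0 H] := (within_continuousP _ _).1 (@tdev_continuous _ T) _ Hx d1 d10.
  by exists d => // y Hy xy; rewrite !glued_devT//; apply/H1/H => //; exact: ball_flip.
have [d1 d10 H1] : exists2 d, 0 < d & forall y, simplex y -> ball x d y ->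
    ball (dev x) e (dev y).
  have [h|h] := leP (x.1 + x.2) 1; first exact/contS/square_simplex.
  exists ((x.1 + x.2 - 1) / 2); first by lra.
  by move=> y [_ _ h'] [b1 b2]; move: b1 b2; rewrite /ball/= !ltr_norml => b1 b2; exfalso; lra.
have [d2 d20 H2] : exists2 d, 0 < d & forall y, simplex (flip y) -> ball x d y ->
    ball (dev x) e (dev y).
  have [h|h] := leP 1 (x.1 + x.2); first exact/contT/square_flip_simplex.
  exists ((1 - (x.1 + x.2)) / 2); first by lra.
  move=> y /flip_simplex_square[_ h'] [b1 b2]; move: b1 b2.
  by rewrite /ball/= !ltr_norml => b1 b2; exfalso; lra.
have [d [d0 dd1 dd2 _ _]] := min4 d10 d20 d10 d20.
exists d => // y Sy xy; have [h|h] := leP (y.1 + y.2) 1.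
  by apply: H1; [exact: square_simplex | exact: ballS xy].
by apply: H2; [apply: square_flip_simplex => //; exact: ltW | exact: ballS xy].
Qed.

Lemma fan_in_S x th ray0 ray1 Q : x.1 + x.2 < 1 ->
  fan (@simplex R) (tdev S) x th ray0 ray1 Q ->
  fan (@square R) dev x th ray0 ray1 (Q *m NS).
Proof.
move=> h /(fan_mulmx rNS); apply: fan_extend.
  by move=> y Sy; rewrite glued_devS//; case: (simplex_square Sy).
exists ((1 - (x.1 + x.2)) / 2); first by lra.
move=> y Sy [b1 b2]; move: b1 b2; rewrite /ball/= !ltr_norml => b1 b2.
by apply: square_simplex => //; lra.
Qed.

Lemma fan_in_T x th ray0 ray1 Q : x.1 + x.2 < 1 ->
  fan (@simplex R) (tdev T) x th ray0 ray1 Q ->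
  fan (@square R) dev (flip x) th (fun r => flip (ray0 r)) (fun r => flip (ray1 r)) (Q *m NT).
Proof.
move=> h /(fan_mulmx rNT)/fan_flip; apply: fan_extend.
  by move=> y /= Sy; rewrite glued_devT//; case: (flip_simplex_square Sy).
exists ((1 - (x.1 + x.2)) / 2); first by lra.
move=> y Sy [b1 b2]; move: b1 b2; rewrite /ball/= !ltr_norml => b1 b2.
by apply: square_flip_simplex => //; lra.
Qed.

Let square_halves : @simplex R `|` [set y | simplex (flip y)] = @square R.
Proof.
apply/seteqP; split=> y; first by case=> [/simplex_square[]|/flip_simplex_square[]].
by move=> Sy; case: (leP (y.1 + y.2) 1) => h; [left; exact: square_simplex |
  right; apply: square_flip_simplex => //; exact: ltW].
Qed.

Lemma fan_across_ST x th1 th2 ray0 ray1 ray2 ray3 P Q : square x -> 0 < th1 -> 0 < th2 ->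
  fan (@simplex R) (tdev S) x th1 ray0 ray1 P ->
  fan (@simplex R) (tdev T) (flip x) th2 ray2 ray3 Q ->
  (forall r, flip (ray2 r) = ray1 r) -> Q *m NT = Zrot th1 *m (P *m NS) ->
  fan (@square R) dev x (th1 + th2) ray0 (fun r => flip (ray3 r)) (P *m NS).
Proof.
move=> Sx t1 t2 /(fan_mulmx rNS) F1 /(fan_mulmx rNT)/fan_flip F2 E EQ.
rewrite -square_halves; apply: (@fan_merge _ _ _ _ _ _ _ ray0 ray1) => //.
- by move=> e e0; rewrite square_halves; exact: glued_dev_continuous.
- by apply: fan_extend F1 => [y Sy|]; [rewrite glued_devS | exists 1].
rewrite -EQ; move: F2; rewrite flipK => F2.
apply: (@fan_rays _ _ _ _ _ (fun r => flip (ray2 r)) (fun r => flip (ray3 r))) => //.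
by apply: fan_extend F2 => [y Sy|]; [rewrite glued_devT | exists 1].
Qed.

Lemma fan_across_TS x th1 th2 ray0 ray1 ray2 ray3 P Q : square x -> 0 < th1 -> 0 < th2 ->
  fan (@simplex R) (tdev T) (flip x) th1 ray0 ray1 P ->
  fan (@simplex R) (tdev S) x th2 ray2 ray3 Q ->
  (forall r, ray2 r = flip (ray1 r)) -> Q *m NS = Zrot th1 *m (P *m NT) ->
  fan (@square R) dev x (th1 + th2) (fun r => flip (ray0 r)) ray3 (P *m NT).
Proof.
move=> Sx t1 t2 /(fan_mulmx rNT)/fan_flip F1 /(fan_mulmx rNS) F2 E EQ.
rewrite -square_halves setUC.
apply: (@fan_merge _ _ _ _ _ _ _ (fun r => flip (ray0 r)) (fun r => flip (ray1 r))) => //.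
- by move=> e e0; rewrite setUC square_halves; exact: glued_dev_continuous.
- by move: F1; rewrite flipK; apply: fan_extend => [y Sy|]; [rewrite glued_devT | exists 1].
rewrite -EQ; apply: (@fan_rays _ _ _ _ _ ray2 ray3) => //.
by apply: fan_extend F2 => [y Sy|]; [rewrite glued_devS | exists 1].
Qed.

Let ang (U : triangle R) k : 0 < tang U k. Proof. exact: tang_gt0. Qed.

Let vfan (U : triangle R) k Q : (exists e psi, vertex_chart U k e Q psi) ->
  fan (@simplex R) (tdev U) (vertex R k) (tang U k)
    (fun r => side_point k (r / tlen U k))
    (fun r => side_point (ord_pred k) (1 - r / tlen U (ord_pred k))) Q.
Proof. by move=> [e [psi H]]; apply: (chart_fan _ H); exact: ltW. Qed.

Let opred2 : ord_pred c2 = c1 :> 'I_3. Proof. exact: val_inj. Qed.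
Let opred0 : ord_pred c0 = c2 :> 'I_3. Proof. exact: val_inj. Qed.

Lemma glued_interior x : square x -> (forall k, ~ on k x) ->
  exists Q ray, fan (@square R) dev x (2 * pi) ray ray Q.
Proof.
have Zpi k : Zrot pi *m Yrot k = Eflip k :> 'M[R]_3.
  rewrite -Zrot_pi_flip mulmxA ZrotD.
  have -> : Zrot (pi + pi) = Zrot 0 :> 'M[R]_3.
    by rewrite /Zrot -mulr2n cos2pi sin2pi cos0 sin0.
  by rewrite Zrot0 mul1mx.
move: x => [x1 x2] /= [/= h1 h2] n.
have i1 : 0 < x1 by rewrite lt_neqAle eq_sym; case/andP: h1 => -> _; rewrite andbT; apply/eqP => E; apply: (n true); left.
have i2 : 0 < x2 by rewrite lt_neqAle eq_sym; case/andP: h2 => -> _; rewrite andbT; apply/eqP => E; apply: (n false); left.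
have i3 : x1 < 1 by rewrite lt_neqAle; case/andP: h1 => _ ->; rewrite andbT; apply/eqP => E; apply: (n false); right.
have i4 : x2 < 1 by rewrite lt_neqAle; case/andP: h2 => _ ->; rewrite andbT; apply/eqP => E; apply: (n true); right.
have p0 := pi_gt0 R; have twopi : 0 <= 2 * pi :> R by lra.
have [hlt|hgt|heq] := ltgtP (x1 + x2) 1.
+ have [ray [e [Q [psi H]]]] := t_interior S (x := (x1, x2)) ltac:(split=> /=; lra).
  exists (Q *m NS), ray; apply: fan_in_S => //.
  exact: chart_fan H.
+ have [ray [e [Q [psi H]]]] := t_interior T (x := flip (x1, x2)) ltac:(split=> /=; lra).
  exists (Q *m NT), (fun r => flip (ray r)); rewrite -[(x1, x2)]flipK.
  apply: fan_in_T => /=; first by lra.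
  exact: chart_fan H.
have x2I : 0 < x2 < 1 by rewrite i2 i4.
have x2I' : 0 < 1 - x2 < 1 by lra.
have xE : (x1, x2) = side_point c1 x2 by rewrite side_point_c1; congr (_, _); lra.
have xE' : flip (x1, x2) = side_point c1 (1 - x2) by rewrite xE flip_side1.
have F1 := fS c1 x2I; have F2 := fT c1 x2I'.
rewrite -xE in F1; rewrite -xE' in F2.
have := @fan_across_ST (x1, x2) pi pi _ _ _ _ _ _ _ p0 p0 F1 F2.
rewrite (_ : pi + pi = 2 * pi); last by ring.
move=> H; exists (Yrot (x2 * tlen S c1) *m QS c1 *m NS), (fun r => side_point c1 (x2 + r / tlen S c1)).
apply: (fan_rays _ _ (H _ _ _)) => // [r|r|].
+ by rewrite flip_side1 -S1T1; congr side_point; ring.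
+ by rewrite flip_side1 -S1T1; congr side_point; ring.
+ rewrite -!mulmxA T1S1 !mulmxA -S1T1 Zpi Yrot_Eflip; congr (_ *m _ *m _).
  by congr Eflip; ring.
Qed.

Lemma glued_side k r : 0 <= r <= pi ->
  [/\ square (legs l m k r), on k (legs l m k r) & dev (legs l m k r) = polar r (long a k)].
Proof.
move=> rI; have hl := l_gt0; have hm := m_gt0; have hlm := lm; case: k.
  have [rl|lr] := leP r l.
    rewrite legs_first//; have rl' : 0 <= r / l <= 1 by apply: first_fraction => //; lra.
    split; [by split=> /=; lra | by left |].
    rewrite glued_devS; last by split=> /=; lra.
    have := @gS c2 (l - r); rewrite S2 side_point_c2.
    have -> : 1 - (l - r) / l = r / l by field; rewrite gt_eqF.
    move=> ->; last by lra.
    by rewrite -mulmxA S22 mulmxA polar_Eflip polar_Zrot add0r; congr polar; ring.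
  rewrite legs_second//; last exact: ltW.
  have rl' : 0 <= (r - l) / m <= 1 by apply: first_fraction => //; lra.
  split; [by split=> /=; lra | by right |].
  rewrite glued_devT; last by split=> /=; lra.
  have := @gT c0 (pi - r); rewrite T0 side_point_c0.
  have -> : flip ((r - l) / m, 1) = ((pi - r) / m, 0).
    rewrite /flip /=; congr (_, _); last by ring.
    by rewrite -lm; field; rewrite gt_eqF.
  move=> ->; last by lra.
  rewrite -mulmxA T00 mulmxA polar_Eflip_pi polar_Zrot oppr0 add0r.
  by congr polar; ring.
have [rl|lr] := leP r l.
    rewrite legs_first//; have rl' : 0 <= r / l <= 1 by apply: first_fraction => //; lra.
    split; [by split=> /=; lra | by left |].
    rewrite glued_devS; last by split=> /=; lra.
    have := @gS c0 r; rewrite S0 side_point_c0 => ->; last by lra.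
    by rewrite -mulmxA S00 mulmx1.
  rewrite legs_second//; last exact: ltW.
  have rl' : 0 <= (r - l) / m <= 1 by apply: first_fraction => //; lra.
  split; [by split=> /=; lra | by right |].
  rewrite glued_devT; last by split=> /=; lra.
  have := @gT c2 (r - l); rewrite T2 side_point_c2.
  have -> : flip (1, (r - l) / m) = (0, 1 - (r - l) / m) by rewrite /flip /=; congr (_, _); ring.
  move=> ->; last by lra.
  by rewrite -mulmxA T22 polar_Yrot subrK.
Qed.

(** Where the legs of S and T meet, the corners of the two triangles merge into a
    half disc, because their angles add up to pi. *)
Lemma glued_side_fan k r : 0 < r < pi -> exists ray0 ray1,
  fan (@square R) dev (legs l m k r) pi ray0 ray1 (if k then Eflip r *m Zrot a else Yrot r).
Proof.
move=> rI; have hl := l_gt0; have hm := m_gt0; have hlm := lm.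
have Zcorner : Zrot (- tang S c1) *m Eflip l = Zrot (tang T c2) *m Yrot l.
  have -> : - tang S c1 = tang T c2 - pi by rewrite -corner1; ring.
  have -> : Zrot (tang T c2 - pi) = Zrot (tang T c2) *m Zrot pi *m Zrot (- (pi + pi)) :> 'M[R]_3.
    by rewrite !ZrotD; congr Zrot; ring.
  have -> : Zrot (- (pi + pi)) = Zrot 0 :> 'M[R]_3.
    by rewrite /Zrot cosN sinN -mulr2n cos2pi sin2pi cos0 sin0 !oppr0.
  by rewrite Zrot0 mulmx1 -mulmxA Zrot_pi_flip.
case: k.
  have [rl|lr|rE] := ltgtP r l.
  + have sI : 0 < 1 - r / l < 1.
      have : 0 < r / l < 1 by apply/andP; split; [apply: divr_gt0; lra | rewrite ltr_pdivrMr// mul1r; lra].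
      by lra.
    have F := fS c2 sI.
    have := @fan_in_S _ _ _ _ _ _ F.
    rewrite side_point_c2 S2 legs_first ?(ltW rl)//= subKr -mulmxA S22 mulmxA Yrot_Eflip.
    have -> : l - (1 - r / l) * l = r by field; rewrite gt_eqF.
    by move=> H; do 2 eexists; apply: H => /=; lra.
  + have sI : 0 < (pi - r) / m < 1.
      by apply/andP; split; [apply: divr_gt0; lra | rewrite ltr_pdivrMr// mul1r; lra].
    have F := fT c0 sI.
    have := @fan_in_T _ _ _ _ _ _ F.
    rewrite side_point_c0 T0 legs_second ?(ltW lr)//= -mulmxA T00 mulfVK ?gt_eqF//.
    rewrite mulmxA Yrot_Eflip subKr /flip /= subr0.
    have -> : 1 - (pi - r) / m = (r - l) / m by rewrite -lm; field; rewrite gt_eqF.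
    by move=> H; do 2 eexists; apply: H => /=; lra.
  have F1 := vfan (chS c2); have F2 := vfan (chT c1).
  rewrite opred2 in F1.
  have xE : legs l m true r = (0, 1) by rewrite legs_first ?rE ?divff ?gt_eqF.
  have v2 : vertex R c2 = (0, 1) by [].
  have v1 : vertex R c1 = flip (0, 1) by rewrite /vertex /flip /= subrr subr0.
  rewrite v2 in F1; rewrite v1 in F2.
  have := @fan_across_ST (0, 1) _ _ _ _ _ _ _ _ _ (ang S c2) (ang T c1) F1 F2.
  rewrite xE rE corner2 S22 T11 /= => H; do 2 eexists; apply: H => //.
    by split=> /=; lra.
  by move=> k; rewrite flip_side1 -S1T1.
have [rl|lr|rE] := ltgtP r l.
  + have rl' : 0 < r / l < 1 by apply/andP; split; [apply: divr_gt0; lra | rewrite ltr_pdivrMr// mul1r; lra].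
    have F := fS c0 rl'.
    have := @fan_in_S _ _ _ _ _ _ F.
    rewrite side_point_c0 S0 legs_first ?(ltW rl)// -mulmxA S00 mulmx1 mulfVK ?gt_eqF//.
    by move=> H; do 2 eexists; apply: H => /=; lra.
  + have sI : 0 < (r - l) / m < 1.
      by apply/andP; split; [apply: divr_gt0; lra | rewrite ltr_pdivrMr// mul1r; lra].
    have F := fT c2 sI.
    have := @fan_in_T _ _ _ _ _ _ F.
    rewrite side_point_c2 T2 legs_second ?(ltW lr)// -mulmxA T22 mulfVK ?gt_eqF// YrotD subrK.
    rewrite /flip /= subr0 subKr.
    by move=> H; do 2 eexists; apply: H => /=; lra.
  have F1 := vfan (chT c2); have F2 := vfan (chS c1).
  rewrite opred2 in F1.
  have xE : legs l m false r = (1, 0) by rewrite legs_first ?rE ?divff ?gt_eqF.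
  have v2 : vertex R c2 = flip (1, 0) by rewrite /vertex /flip /= subrr subr0.
  have v1 : vertex R c1 = (1, 0) by [].
  rewrite v2 in F1; rewrite v1 in F2.
  have := @fan_across_TS (1, 0) _ _ _ _ _ _ _ _ _ (ang T c2) (ang S c1) F1 F2.
  rewrite xE rE (addrC (tang T c2)) corner1 T22 S11 => H; do 2 eexists; apply: H => //.
    by split=> /=; lra.
  by move=> k; rewrite flip_side1 -S1T1; congr side_point; ring.
Qed.

Lemma glued_north : exists e psi, [/\ 0 < e < pi, corner_chart (0, 0) a e psi,
  forall k r, 0 <= r < e -> psi (r, long a k) = legs l m k r &
  forall r phi, sector e a (r, phi) -> dev (psi (r, phi)) = polar r phi].
Proof.
have hl := l_gt0; have [e [psi H]] := (chS c0); have [[eI rQ] psiC [psiS psiN] psiI [psi0 psiR psiD]] := H.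
exists e, psi; split=> //.
+ split=> //.
  * by move=> r phi s; apply: (simplex_square (psiS _ _)).1; exists (r, phi).
  * have [_ [e' [psi' _]]] := vfan (chS c0).
    move/nbhs_ballP: psiN => [d /= d0 Hd].
    have [b [bgt bd b1' _ _]] := @min4 _ d (1 / 2) 1 1 d0 ltac:(lra) ltac:(lra) ltac:(lra).
    exists b => // y Sy xy; have := xy => -[]; rewrite /ball/= /vertex/= !ltr_norml => y1 y2.
    have Sy' : simplex y by apply: square_simplex => //; lra.
    by have [[r phi] s E] := Hd y (ballS bd xy) Sy'; exists r, phi.
  * by move=> r phi r' phi' s s' /(psiI _ _ _ _ s s').1[-> []]; [split=> //; left | case=> [->|[]//]; split=> //; right].
+ move=> k r rI; have [E0 E1] := psiR r rI.
  have sr : sector e (tang S c0) (r, 0) by split=> //=; rewrite lexx ltW.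
  have rl : r <= l.
    have : simplex (psi (r, 0)) by apply: psiS; exists (r, 0).
    by rewrite E0 S0 side_point_c0 => -[/= _ _]; rewrite addr0 ler_pdivrMr// mul1r.
  case: k; rewrite legs_first//= ?E0 ?E1 ?opred0 ?S0 ?S2.
    by rewrite side_point_c2 subKr.
  by rewrite side_point_c0.
by move=> r phi s; rewrite glued_devS ?psiD// -?mulmxA ?S00 ?mulmx1//; apply: psiS; exists (r, phi).
Qed.

Lemma glued_south : exists th e psi, [/\ 0 < e < pi /\ 0 < th, corner_chart (1, 1) th e psi,
  forall r, 0 <= r < e ->
    psi (r, 0) = legs l m true (pi - r) /\ psi (r, th) = legs l m false (pi - r) &
  forall r phi, sector e th (r, phi) -> dev (psi (r, phi)) = polar (pi - r) (a - phi)].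
Proof.
have hm := m_gt0; have hlm := lm.
have [e [psi H]] := (chT c0); have [[eI rQ] psiC [psiS psiN] psiI [psi0 psiR psiD]] := H.
exists (tang T c0), e, (fun q => flip (psi q)); split=> //.
+ split=> //.
  * move/within_continuousP: psiC => psiC; apply/within_continuousP => x sx eps eps0.
    by have [d d0 Hd] := psiC x sx eps eps0; exists d => // y sy xy; apply: ball_flip; exact: Hd.
  * move=> r phi s; apply: (flip_simplex_square _).1; rewrite flipK.
    by apply: psiS; exists (r, phi).
  * move/nbhs_ballP: psiN => [d /= d0 Hd].
    have [b [bgt bd b1' _ _]] := @min4 _ d (1 / 2) 1 1 d0 ltac:(lra) ltac:(lra) ltac:(lra).
    exists b => // y Sy xy; have := xy => -[]; rewrite /ball/= !ltr_norml => y1 y2.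
    have Sy' : simplex (flip y) by apply: square_flip_simplex => //; lra.
    have xy' : ball (vertex R c0) d (flip y).
      have -> : vertex R c0 = flip (1, 1) by rewrite /vertex /flip /= subrr.
      by apply: ball_flip; exact: ballS xy.
    by have [[r phi] s E] := Hd (flip y) xy' Sy'; exists r, phi; rewrite E flipK.
  * move=> r phi r' phi' s s' /(congr1 (@flip R)); rewrite !flipK.
    by move=> /(psiI _ _ _ _ s s').1[-> []]; [split=> //; left | case=> [->|[]//]; split=> //; right].
  * by move=> phi phiI; rewrite psi0// /flip /vertex /= subr0.
+ move=> r rI; have [-> ->] := psiR r rI.
  have sr : sector e (tang T c0) (r, 0) by split=> //=; rewrite lexx ltW.
  have rm : r <= m.
    have : simplex (psi (r, 0)) by apply: psiS; exists (r, 0).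
    have [-> _] := psiR r rI; rewrite T0 side_point_c0 => -[/= _ _].
    by rewrite addr0 ler_pdivrMr// mul1r.
  have lr : l <= pi - r by rewrite lerBrDr -lm lerD2l.
  have E : (pi - r - l) / m = 1 - r / m.
    have -> : pi - r - l = m - r by rewrite -lm; ring.
    by rewrite mulrBl divff// gt_eqF.
  by rewrite !legs_second//= E opred0 T0 T2 side_point_c0 side_point_c2 /flip /= !subr0 subKr.
move=> r phi s; rewrite glued_devT ?flipK ?psiD//; last by apply: psiS; exists (r, phi).
by rewrite -mulmxA T00 mulmxA polar_Eflip_pi polar_Zrot (addrC (- phi)).
Qed.

Lemma glued_digon : digon a dev (legs l m).
Proof.
have hl := l_gt0; have hm := m_gt0; have hlm := lm.
split.
- exact: tang_gt0.
- exact: glued_dev_continuous.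
- exact: glued_interior.
- exact: glued_side.
- exact: legs_continuous.
- move=> k [x1 x2] [/= h1 h2] ox.
  have [z|z] : (if k then x1 else x2) = 0 \/ (if k then x2 else x1) = 1 by case: k ox => -[] /= ->; [left|right|left|right].
    exists ((if k then x2 else x1) * l); first by case: k {ox} z => z; nra.
    rewrite legs_first ?mulfK ?gt_eqF//; last by case: k {ox} z => z; nra.
    by case: k {ox} z => ->.
  exists (l + (if k then x1 else x2) * m); first by case: k {ox} z => z; nra.
  rewrite legs_second//; last by case: k {ox} z => z; nra.
  by rewrite addrAC subrr add0r mulfK ?gt_eqF//; case: k {ox} z => ->.
- exact: glued_side_fan.
- exact: glued_north.
- exact: glued_south.
Qed.

End TwoTriangles.

Lemma two_triangles_digon (R : realType) (S T : triangle R) l m :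
  tlen S c0 = l -> tlen S c2 = l -> tlen S c1 = tlen T c1 ->
  tlen T c0 = m -> tlen T c2 = m -> l + m = pi ->
  tang S c1 + tang T c2 = pi -> tang S c2 + tang T c1 = pi ->
  exists NS NT, [/\ rotation NS, rotation NT,
    forall x, square x -> x.1 + x.2 = 1 -> tdev S x *m NS = tdev T (flip x) *m NT &
    digon (tang S c0) (glued_dev S T NS NT) (legs l m)].
Proof.
move=> S0 S2 S1T1 T0 T2 lm corner1 corner2.
have [NS [NT [QS [QT [[rNS rNT rQS rQT] [S00 S11 S22] [T00 T11 T22] T1S1 [ch gS gT hfan]]]]]] :=
  two_triangle_frames S0 S2 S1T1 T0 T2 lm corner1 corner2.
have chS k := (ch k).1; have chT k := (ch k).2.
have fS k s s01 := (hfan k s s01).1; have fT k s s01 := (hfan k s s01).2.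
exists NS, NT; split=> //; first exact: (diagonal_dev S1T1 T1S1 gS gT).
by eapply glued_digon; eassumption.
Qed.

(** * Broken geodesics *)

Section BrokenGeodesics.
Variable R : realType.
Implicit Types (X Y : surface R) (a b r phi s t e d L M : R).

Lemma dot_combination (v w : 'rV[R]_3) (x1 y1 x2 y2 : R) :
  dot v v = 1 -> dot w w = 1 -> dot v w = 0 ->
  dot (x1 *: v + y1 *: w) (x2 *: v + y2 *: w) = x1 * x2 + y1 * y2.
Proof.
rewrite !dotE !mxE => v1 w1 vw.
set v0 := v 0 c0 in v1 vw *; set v1' := v 0 c1 in v1 vw *; set v2 := v 0 c2 in v1 vw *.
set w0 := w 0 c0 in w1 vw *; set w1' := w 0 c1 in w1 vw *; set w2 := w 0 c2 in w1 vw *.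
transitivity (x1 * x2 * (v0 * v0 + v1' * v1' + v2 * v2) +
  y1 * y2 * (w0 * w0 + w1' * w1' + w2 * w2) +
  (x1 * y2 + y1 * x2) * (v0 * w0 + v1' * w1' + v2 * w2)); first by ring.
by rewrite v1 w1 vw; ring.
Qed.

Lemma geodesic_sym (D : set (R * R)) dev p q L :
  geodesic D dev p q L -> geodesic D dev q p L.
Proof.
move=> [L0 [g [v [w [gC gD [g0 gL] [v1 w1 vw] gE]]]]]; split=> //.
exists (fun s => g (L - s)), (cos L *: v + sin L *: w), (sin L *: v + (- cos L) *: w).
have sub s : 0 <= s <= L -> 0 <= L - s <= L by near_lra.
split.
- move/within_continuousP: gC => gC; apply/within_continuousP => s.
  rewrite /= in_itv/= => sI e e0.
  have [|d d0 H] := gC (L - s) _ e e0; first by rewrite /= in_itv/=; exact: sub.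
  exists d => // t; rewrite /= in_itv/= => tI st; apply: H.
    by rewrite /= in_itv/=; exact: sub.
  by move: st; rewrite /ball/= -normrN; congr (`|_| < _); ring.
- by move=> s /sub; exact: gD.
- by rewrite subr0 subrr.
- have cs := cos2Dsin2 L.
  by split; rewrite dot_combination//; near_lra.
move=> s /sub /gE ->; rewrite cosB sinB.
by apply/rowP => j; rewrite !mxE; ring.
Qed.

Definition great_arc (D : set (R * R)) (dev : R * R -> 'rV[R]_3) (g : R -> R * R)
    (v w : 'rV[R]_3) (a b : R) : Prop :=
  [/\ {within `[a, b], continuous g}, forall s, a <= s <= b -> D (g s),
      [/\ dot v v = 1, dot w w = 1 & dot v w = 0] &
      forall s, a <= s <= b -> dev (g s) = cos s *: v + sin s *: w].

Lemma arc_dot D dev g v w a b s t : great_arc D dev g v w a b ->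
  a <= s <= b -> a <= t <= b -> dot (dev (g s)) (dev (g t)) = cos (s - t).
Proof. by move=> [_ _ [v1 w1 vw] gE] sI tI; rewrite !gE// dot_combination// cosB. Qed.

Lemma arc_rotation D dev g v w a b (Q : 'M[R]_3) : rotation Q -> great_arc D dev g v w a b ->
  great_arc D (fun x => dev x *m Q) g (v *m Q) (w *m Q) a b.
Proof.
move=> rM [gC gD [v1 w1 vw] gE]; split; rewrite ?dot_rotation// => s sI.
by rewrite gE// mulmxDl -!scalemxAl.
Qed.

Lemma arc_geodesic D dev g v w a b : a <= b -> great_arc D dev g v w a b ->
  geodesic D dev (g a) (g b) (b - a).
Proof.
move=> ab [/within_continuousP gC gD [v1 w1 vw] gE]; split; first by near_lra.
have sub s : 0 <= s <= b - a -> a <= a + s <= b by near_lra.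
exists (fun s => g (a + s)), (cos a *: v + sin a *: w), (- sin a *: v + cos a *: w).
have ca := cos2Dsin2 a; split.
- apply/within_continuousP => s; rewrite /= in_itv/= => sI e e0.
  have [|d d0 H] := gC (a + s) _ e e0; first by rewrite /= in_itv/=; exact: sub.
  exists d => // t; rewrite /= in_itv/= => tI st; apply: H.
    by rewrite /= in_itv/=; exact: sub.
  by move: st; rewrite /ball/=; congr (`|_| < _); ring.
- by move=> s /sub; exact: gD.
- by rewrite addr0 addrC subrK.
- by split; rewrite dot_combination//; near_lra.
move=> s /sub /gE ->; rewrite cosD sinD.
by apply/rowP => j; rewrite !mxE; ring.
Qed.

Section Surface.
Variable X : surface R.
Implicit Types (x y z : spoint X).

Lemma bg_len x y L M : broken_geodesic x y L -> L = M -> broken_geodesic x y M.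
Proof. by move=> H <-. Qed.

Lemma bg_trans x y z L M :
  broken_geodesic x y L -> broken_geodesic y z M -> broken_geodesic x z (L + M).
Proof.
move=> H; elim: H z M => {x y L} [x z M|i p q y L K gpq _ IH z M yz|x y z K g _ IH w M yw].
- by rewrite add0r.
- by rewrite -addrA; apply: bg_step gpq _; exact: IH.
- by apply: bg_glue g _; exact: IH.
Qed.

Lemma bg_geodesic i p q L : geodesic (sdom i) (sdev (s:=X) i) p q L ->
  broken_geodesic (i, p) (i, q) L.
Proof. by move=> g; rewrite -(addr0 L); apply: bg_step g _; exact: bg_nil. Qed.

Lemma bg_glue1 x y : sglue x y \/ sglue y x -> broken_geodesic x y 0.
Proof. by move=> g; apply: bg_glue g _; exact: bg_nil. Qed.

Lemma bg_sym x y L : broken_geodesic x y L -> broken_geodesic y x L.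
Proof.
elim=> {x y L} [x|i p q y L K gpq _ IH|x y z K g _ IH].
- exact: bg_nil.
- by rewrite addrC; apply: bg_trans IH _; apply: bg_geodesic; exact: geodesic_sym.
- by rewrite -(addr0 K); apply: bg_trans IH _; apply: bg_glue1; case: g; [right|left].
Qed.

Lemma bg_ge0 x y L : broken_geodesic x y L -> 0 <= L.
Proof. by elim=> // {x y L} i p q y L K [L0 _] _ K0; exact: addr_ge0. Qed.

Lemma bg_eq0 x y : x = y -> broken_geodesic x y 0.
Proof. by move=> ->; exact: bg_nil. Qed.

(** By real induction on the time, the local pieces add up; this spares the choice
    of a subdivision. *)
Lemma bg_chain (f : R -> spoint X) L :
  (forall s, 0 <= s <= L -> exists2 e, 0 < e & forall t, 0 <= t <= L -> `|s - t| < e ->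
     broken_geodesic (f s) (f t) `|s - t|) ->
  0 <= L -> broken_geodesic (f 0) (f L) L.
Proof.
move=> H L0; suff : forall s, 0 <= s <= L -> broken_geodesic (f 0) (f s) s.
  by apply; rewrite L0 lexx.
apply: real_induction => s sI IH.
have [e e0 He] := H s sI.
have Qs : broken_geodesic (f 0) (f s) s.
  have [->|sN] := eqVneq s 0; first exact: bg_nil.
  have s0 : 0 < s by rewrite lt_neqAle eq_sym sN; case/andP: sI.
  pose c := Num.max 0 (s - e / 2).
  have h1 : 0 <= c by rewrite le_max lexx.
  have h2 : s - e / 2 <= c by rewrite le_max lexx orbT.
  have h3 : c < s by rewrite gt_max s0/=; near_lra.
  have h4 : `|s - c| = s - c by rewrite ger0_norm; near_lra.
  have Hc : broken_geodesic (f s) (f c) (s - c) by rewrite -h4; apply: He; near_lra.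
  have Ic : broken_geodesic (f 0) (f c) c by apply: IH; near_lra.
  by apply: (bg_len (bg_trans Ic (bg_sym Hc))); ring.
split=> //; exists e => // t st tL.
have h : `|s - t| = t - s by rewrite distrC ger0_norm; near_lra.
have Ht : broken_geodesic (f s) (f t) (t - s) by rewrite -h; apply: He; near_lra.
by apply: (bg_len (bg_trans Qs Ht)); ring.
Qed.

End Surface.

(** If arcs go to paths that are locally broken geodesics of the same length, then
    [bg_chain] applies to the image of every geodesic. *)
Lemma bg_transfer X Y (F : spoint X -> spoint Y) :
  (forall (i : piece X) g v w L, great_arc (@sdom _ X i) (@sdev _ X i) g v w 0 L ->
     forall s, 0 <= s <= L -> exists2 e, 0 < e & forall t, 0 <= t <= L -> `|s - t| < e ->
       broken_geodesic (F (i, g s)) (F (i, g t)) `|s - t|) ->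
  (forall x y, sglue x y -> broken_geodesic (F x) (F y) 0) ->
  forall x y L, broken_geodesic x y L -> broken_geodesic (F x) (F y) L.
Proof.
move=> Hloc Hglue x y L; elim=> {x y L} [x|i p q y L K gpq _ IH|x y z K g _ IH].
- exact: bg_nil.
- apply: bg_trans IH; have [L0 [g [v [w [gC gD [<- <-] vw gE]]]]] := gpq.
  by apply: (@bg_chain _ (fun s => F (i, g s))) => //; apply: (Hloc i g v w).
rewrite -(add0r K); apply: bg_trans IH.
by case: g => /Hglue //; exact: bg_sym.
Qed.

(** The distance on the sphere between the developments of two nearby points of a
    geodesic is the length of the arc between them. *)
Lemma local_along_arcs X Y (F : spoint X -> spoint Y) (i : piece X) :
  (forall p, sdom i p -> exists2 e, 0 < e & forall q, sdom i q -> ball p e q ->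
     broken_geodesic (F (i, p)) (F (i, q)) (acos (dot (sdev i p) (sdev i q)))) ->
  forall g v w L, great_arc (@sdom _ X i) (@sdev _ X i) g v w 0 L ->
  forall s, 0 <= s <= L -> exists2 e, 0 < e & forall t, 0 <= t <= L -> `|s - t| < e ->
    broken_geodesic (F (i, g s)) (F (i, g t)) `|s - t|.
Proof.
move=> Hloc g v w L arc s sI; have [gC gD _ _] := arc; have p0 := pi_gt0 R.
have [e e0 He] := Hloc (g s) (gD s sI).
have sI' : (`[0, L]%classic : set R) s by rewrite /= in_itv.
have [d d0 Hd] := (within_continuousP _ _).1 gC s sI' e e0.
exists (Num.min d pi); first by rewrite lt_min d0.
move=> t tI; rewrite lt_min => /andP[st stpi].
have tI' : (`[0, L]%classic : set R) t by rewrite /= in_itv.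
apply: bg_len (He (g t) (gD t tI) (Hd t tI' st)) _.
by rewrite (arc_dot arc)// acos_cos_norm// ltW.
Qed.

(** Both maps are distance nonincreasing, and they are inverse to each other up to
    the identifications. *)
Lemma isometric_of_transfer X Y (F : spoint X -> spoint Y) (G : spoint Y -> spoint X) :
  (forall x, spoints x -> spoints (F x)) -> (forall y, spoints y -> spoints (G y)) ->
  (forall x x' L, broken_geodesic x x' L -> broken_geodesic (F x) (F x') L) ->
  (forall y y' L, broken_geodesic y y' L -> broken_geodesic (G y) (G y') L) ->
  (forall x, spoints x -> broken_geodesic (G (F x)) x 0) ->
  (forall y, spoints y -> broken_geodesic (F (G y)) y 0) ->
  isometric X Y.
Proof.
move=> FS GS bF bG GF FG; exists F; split=> //.
  move=> x x' Sx Sx'; rewrite /sdist; congr (ereal_inf [set _ | _ in _]).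
  apply/seteqP; split=> L /= H; last exact: bF.
  rewrite -(add0r L) -(addr0 (0 + L)); apply: bg_trans (GF x' Sx').
  by apply: bg_trans (bG _ _ _ H); apply: bg_sym; exact: GF.
move=> y Sy; exists (G y); first exact: GS.
apply/eqP; rewrite eq_le; apply/andP; split.
  by apply: ereal_inf_lbound; exists 0 => //=; exact: FG.
by apply: le_ereal_inf_tmp => _ [L /= /bg_ge0 L0 <-]; rewrite lee_fin.
Qed.

Lemma meridian_geodesic a r t phi : 0 <= r -> r <= t <= pi -> 0 <= phi <= a ->
  geodesic (lune a) (@lune_dev R) (r, phi) (t, phi) (t - r).
Proof.
move=> r0 rt phiI; split; first by near_lra.
exists (fun s => (r + s, phi)), (polar r phi), (polar (r + pi / 2) phi); split.
- apply/within_continuousP => s _ e e0; exists e => // s' _ ss'.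
  split; rewrite /ball/= ?subrr ?normr0//.
  by have -> : r + s - (r + s') = s - s' by ring.
- by move=> s sI; split=> /=; near_lra.
- by rewrite addr0 addrC subrK.
- split; rewrite ?dot_polar_unit// dot_polar subrr cos0 mulr1.
  by rewrite cosDpihalf sinDpihalf; ring.
move=> s _; rewrite /lune_dev /=.
by apply: row3P; rewrite !mxE/= ?cosDpihalf ?sinDpihalf ?sinD ?cosD; ring.
Qed.

End BrokenGeodesics.

(** * The isometry *)

Section Isometry.
Variable R : realType.
Implicit Types (r phi s t e d : R) (x y p q : R * R) (i j : football).
Variables (h : triangulated R) (alpha beta l m : R).
Variables (NS NT : football -> 'M[R]_3) (G : football -> R * R -> R * R).

Definition lower_face i := match i with footballA => faceA | footballB => faceB end.
Definition upper_face i := match i with footballA => faceD1 | footballB => faceD2 end.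

Local Notation X := (triangulated_surface h).
Local Notation Y := (glued_footballs alpha beta m).
Local Notation S i := (htri h (lower_face i)).
Local Notation T i := (htri h (upper_face i)).
Local Notation ang := (football_angle alpha beta).

Hypothesis l0 : 0 < l.
Hypothesis m0 : 0 < m.
Hypothesis lm_pi : l + m = pi.
Hypothesis rNS : forall i, rotation (NS i).
Hypothesis rNT : forall i, rotation (NT i).
Hypothesis agree : forall i x, square x -> x.1 + x.2 = 1 ->
  tdev (S i) x *m NS i = tdev (T i) (flip x) *m NT i.
Hypothesis hG : forall i,
  lune_map (ang i) (glued_dev (S i) (T i) (NS i) (NT i)) (legs l m) (G i).
Hypothesis ang0 : forall i, 0 < ang i.

Definition lune_point i x : R * R := xget (0, 0) [set p | lune (ang i) p /\ G i p = x].

Definition to_lunes (x : spoint X) : spoint Y :=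
  match x.1 with
  | faceA => (footballA, lune_point footballA x.2)
  | faceD1 => (footballA, lune_point footballA (flip x.2))
  | faceB => (footballB, lune_point footballB x.2)
  | faceD2 => (footballB, lune_point footballB (flip x.2))
  end.

Definition to_triangles (y : spoint Y) : spoint X :=
  let x := G y.1 y.2 in
  if x.1 + x.2 <= 1 then (lower_face y.1, x) else (upper_face y.1, flip x).

Let mkX f x : spoint X := (f, x).
Let mkY i p : spoint Y := (i, p).

Lemma to_lunes_lower i x : to_lunes (mkX (lower_face i) x) = mkY i (lune_point i x).
Proof. by case: i. Qed.

Lemma to_lunes_upper i x : to_lunes (mkX (upper_face i) x) = mkY i (lune_point i (flip x)).
Proof. by case: i. Qed.

Lemma faceP f : exists i, f = lower_face i \/ f = upper_face i.
Proof.
by case: f; [exists footballA; left | exists footballA; right |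
  exists footballB; left | exists footballB; right].
Qed.

Lemma lune_pointP i x : square x -> lune (ang i) (lune_point i x) /\ G i (lune_point i x) = x.
Proof.
move=> Sx; have [p lp E] := lm_onto (hG i) Sx.
by rewrite /lune_point; case: xgetP => [q -> //|/(_ p)]; case.
Qed.

Lemma simplex_flip_square x : simplex x -> square (flip x).
Proof. by move=> Sx; apply: (flip_simplex_square _).1; rewrite flipK. Qed.

Lemma bg_same_image i p q : lune (ang i) p -> lune (ang i) q -> G i p = G i q ->
  broken_geodesic (mkY i p) (mkY i q) 0.
Proof.
move=> lp lq E; have [_ p2] := lp; have [_ q2] := lq.
case: (lm_inj (hG i) lp lq E) => [->|[e1 e2]|[e1 e2]]; first exact: bg_nil.
  apply: bg_glue1; left; rewrite /mkY [p]surjective_pairing [q]surjective_pairing e1 e2.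
  by apply: fg_pole => //; left.
apply: bg_glue1; left; rewrite /mkY [p]surjective_pairing [q]surjective_pairing e1 e2.
by apply: fg_pole => //; right.
Qed.

Lemma bg_to_lunes_at i x p : square x -> lune (ang i) p -> G i p = x ->
  broken_geodesic (mkY i (lune_point i x)) (mkY i p) 0.
Proof.
by move=> Sx lp E; have [lx Ex] := lune_pointP i Sx; apply: bg_same_image => //; rewrite Ex.
Qed.

Lemma lune_sides i r : 0 <= r <= pi -> lune (ang i) (r, 0) /\ lune (ang i) (r, ang i).
Proof. by move=> rI; have a0 := ang0 i; split; split=> //=; near_lra. Qed.

Let mulI (b s : R) : 0 < b -> 0 <= s <= 1 -> 0 <= s * b <= b.
Proof. by move=> b0 sI; apply/andP; split; nra. Qed.

Lemma lower_side0 i s : 0 <= s <= 1 -> G i (s * l, 0) = side_point c0 s.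
Proof.
move=> sI; have hl := l0; have hm := m0; have hlm := lm_pi; have h1 := mulI l0 sI; rewrite (lm_side (hG i) false); last by near_lra.
by rewrite legs_first ?mulfK ?gt_eqF ?side_point_c0//; near_lra.
Qed.

Lemma lower_side2 i s : 0 <= s <= 1 -> G i ((1 - s) * l, ang i) = side_point c2 s.
Proof.
move=> sI; have hl := l0; have hm := m0; have hlm := lm_pi; have h1 := @mulI l (1 - s) l0 ltac:(near_lra); rewrite (lm_side (hG i) true); last by near_lra.
by rewrite legs_first ?mulfK ?gt_eqF ?side_point_c2//; near_lra.
Qed.

Lemma upper_side0 i s : 0 <= s <= 1 -> G i (pi - s * m, ang i) = flip (side_point c0 s).
Proof.
move=> sI; have hl := l0; have hm := m0; have hlm := lm_pi; have h1 := mulI m0 sI; rewrite (lm_side (hG i) true); last by near_lra.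
rewrite legs_second//; last by near_lra.
rewrite side_point_c0 /flip /= subr0; congr (_, _).
by rewrite -lm_pi; field; rewrite gt_eqF.
Qed.

Lemma upper_side2 i s : 0 <= s <= 1 -> G i (l + s * m, 0) = flip (side_point c2 s).
Proof.
move=> sI; have hl := l0; have hm := m0; have hlm := lm_pi; have h1 := mulI m0 sI; rewrite (lm_side (hG i) false); last by near_lra.
rewrite legs_second//; last by near_lra.
rewrite side_point_c2 /flip /= subr0 subKr; congr (_, _).
by rewrite addrAC subrr add0r mulfK ?gt_eqF.
Qed.

Lemma side_point_simplex k s : 0 <= s <= 1 -> simplex (side_point (R := R) k s).
Proof.
move=> sI; case: (ord3P k) => ->; rewrite ?side_point_c0 ?side_point_c1 ?side_point_c2;
  by split=> /=; near_lra.
Qed.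

(** The points C1 and C2 lie at distance l = pi - m from the north pole, where the
    slit starts: hence the sides e1, e2 are glued along the closed up meridians
    and e3, e4 along the slit, while e5 and e6 are inside the lunes. *)
Lemma to_lunes_glue (x y : spoint X) : sglue (s:=X) x y -> broken_geodesic (to_lunes x) (to_lunes y) 0.
Proof.
case=> f k f' k' s ne; rewrite /face_edge.
have hl := l0; have hm := m0; have hlm := lm_pi; have pi0 := pi_gt0 R.
have lpi : pi - m = l by rewrite -lm_pi; ring.
have tolow i k0 s0 p : 0 <= s0 <= 1 -> lune (ang i) p -> G i p = side_point k0 s0 ->
    broken_geodesic (to_lunes (mkX (lower_face i) (side_point k0 s0))) (mkY i p) 0.
  move=> sI lp E; rewrite to_lunes_lower; apply: bg_to_lunes_at => //.
  by case: (simplex_square (side_point_simplex k0 sI)).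
have toup i k0 s0 p : 0 <= s0 <= 1 -> lune (ang i) p -> G i p = flip (side_point k0 s0) ->
    broken_geodesic (to_lunes (mkX (upper_face i) (side_point k0 s0))) (mkY i p) 0.
  move=> sI lp E; rewrite to_lunes_upper; apply: bg_to_lunes_at => //.
  exact/simplex_flip_square/side_point_simplex.
have via (u v : spoint X) (p q : spoint Y) :
    broken_geodesic (to_lunes u) p 0 -> broken_geodesic (to_lunes v) q 0 ->
    broken_geodesic p q 0 -> broken_geodesic (to_lunes u) (to_lunes v) 0.
  move=> Hu Hv Hpq; apply: (bg_len (bg_trans Hu (bg_trans Hpq (bg_sym Hv)))).
  by rewrite !addr0.
have lunes i r : 0 <= r <= pi -> lune (ang i) (r, 0) /\ lune (ang i) (r, ang i).
  exact: lune_sides.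
have edge_legs i s0 : 0 <= s0 <= 1 -> broken_geodesic
    (to_lunes (mkX (lower_face i) (side_point c0 s0)))
    (to_lunes (mkX (lower_face i) (side_point c2 (1 - s0)))) 0.
  move=> sI; have h1 := mulI l0 sI; have sI' : 0 <= 1 - s0 <= 1 by near_lra.
  have [|L0 La] := lunes i (s0 * l); first by near_lra.
  apply: (via _ _ _ _ (tolow _ _ _ _ sI L0 (lower_side0 _ sI))
    (tolow i c2 (1 - s0) (s0 * l, ang i) sI' La _)).
    by have := lower_side2 i sI'; rewrite subKr.
  by apply: bg_glue1; left; apply: fg_meridian; rewrite lpi.
have edge_diag i s0 : broken_geodesic
    (to_lunes (mkX (lower_face i) (side_point c1 s0)))
    (to_lunes (mkX (upper_face i) (side_point c1 (1 - s0)))) 0.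
  by rewrite to_lunes_lower to_lunes_upper flip_side1 subKr; exact: bg_nil.
have edge_slit i j s0 : i <> j -> 0 <= s0 <= 1 -> broken_geodesic
    (to_lunes (mkX (upper_face i) (side_point c0 s0)))
    (to_lunes (mkX (upper_face j) (side_point c2 (1 - s0)))) 0.
  move=> ij sI; have h1 := mulI m0 sI; have sI' : 0 <= 1 - s0 <= 1 by near_lra.
  have [|_ La] := lunes i (pi - s0 * m); first by near_lra.
  have [|L0 _] := lunes j (pi - s0 * m); first by near_lra.
  apply: (via _ _ _ _ (toup _ _ _ _ sI La (upper_side0 _ sI))
    (toup j c2 (1 - s0) (pi - s0 * m, 0) sI' L0 _)).
    rewrite -(upper_side2 j sI'); congr (G j (_, _)).
    by rewrite -lm_pi; ring.
  by apply: bg_glue1; left; apply: fg_slit => //; near_lra.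
have rev (u v : R -> spoint X) : (forall s0, 0 <= s0 <= 1 ->
    broken_geodesic (to_lunes (u s0)) (to_lunes (v (1 - s0))) 0) ->
    forall s0, 0 <= s0 <= 1 -> broken_geodesic (to_lunes (v s0)) (to_lunes (u (1 - s0))) 0.
  move=> H s0 sI; have := H (1 - s0) ltac:(near_lra); rewrite subKr; exact: bg_sym.
have AB : footballA <> footballB by [].
have BA : footballB <> footballA by [].
have slit_AB s0 := @edge_slit footballA footballB s0 AB.
have slit_BA s0 := @edge_slit footballB footballA s0 BA.
have diag i s0 (_ : 0 <= s0 <= 1) := edge_diag i s0.
move: ne; case: (ord3P k) => ->; case: (ord3P k') => ->; case: f; case: f' => //= ne _ sI.
- exact: (edge_legs footballA).
- exact: slit_AB.
- exact: (edge_legs footballB).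
- exact: slit_BA.
- exact: (edge_diag footballA).
- exact: (rev (fun s0 => mkX faceA (side_point c1 s0)) (fun s0 => mkX faceD1 (side_point c1 s0)) (diag footballA)).
- exact: (edge_diag footballB).
- exact: (rev (fun s0 => mkX faceB (side_point c1 s0)) (fun s0 => mkX faceD2 (side_point c1 s0)) (diag footballB)).
- exact: (rev (fun s0 => mkX faceA (side_point c0 s0)) (fun s0 => mkX faceA (side_point c2 s0)) (edge_legs footballA)).
- exact: (rev (fun s0 => mkX faceD2 (side_point c0 s0)) (fun s0 => mkX faceD1 (side_point c2 s0)) slit_BA).
- exact: (rev (fun s0 => mkX faceB (side_point c0 s0)) (fun s0 => mkX faceB (side_point c2 s0)) (edge_legs footballB)).
- exact: (rev (fun s0 => mkX faceD1 (side_point c0 s0)) (fun s0 => mkX faceD2 (side_point c2 s0)) slit_AB).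
Qed.

Lemma to_triangles_lower i p : simplex (G i p) ->
  to_triangles (mkY i p) = mkX (lower_face i) (G i p).
Proof. by move=> /simplex_square[_ H]; rewrite /to_triangles /= H. Qed.

Lemma to_triangles_upper i p : simplex (flip (G i p)) ->
  broken_geodesic (to_triangles (mkY i p)) (mkX (upper_face i) (flip (G i p))) 0.
Proof.
move=> Hs; have [Sx H] := flip_simplex_square Hs; rewrite /to_triangles /=.
case: leP => H'; last exact: bg_nil.
have xE : G i p = side_point c1 (G i p).2.
  by rewrite side_point_c1 [LHS]surjective_pairing; congr (_, _); near_lra.
have [_ s01] := Sx.
apply: bg_glue1; left; rewrite /mkX xE flip_side1.
by apply: (@tg_edge _ (lower_face i) c1 (upper_face i) c1) => //; case: (i).
Qed.

Lemma to_triangles_glue (y z : spoint Y) : sglue (s:=Y) y z ->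
  broken_geodesic (to_triangles y) (to_triangles z) 0.
Proof.
have hl := l0; have hm := m0; have hlm := lm_pi.
have via (u v w z' : spoint X) : broken_geodesic u v 0 -> broken_geodesic z' w 0 ->
    broken_geodesic v w 0 -> broken_geodesic u z' 0.
  move=> H1 H2 H3; apply: (bg_len (bg_trans H1 (bg_trans H3 (bg_sym H2)))).
  by rewrite !addr0.
case=> [i r phi phi' rE phiI phiI'|i r rI|i j r ij rI].
- apply: bg_eq0; rewrite /to_triangles /=; suff -> : G i (r, phi) = G i (r, phi') by [].
  by case: rE => rE; [rewrite !(lm_north (hG i))|rewrite !(lm_south (hG i))].
- have sI : 0 <= r / l <= 1.
    by apply/andP; split; [apply: divr_ge0; near_lra | rewrite ler_pdivrMr// mul1r; near_lra].
  have sI' : 0 <= 1 - r / l <= 1 by near_lra.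
  have rE : r / l * l = r by rewrite mulfVK ?gt_eqF.
  have := lower_side0 i sI; have := lower_side2 i sI'; rewrite subKr rE => E2 E0.
  rewrite -/(mkY i (r, 0)) -/(mkY i (r, ang i)) !to_triangles_lower ?E0 ?E2;
    [|exact: side_point_simplex..].
  apply: bg_glue1; left; apply: (@tg_edge _ (lower_face i) c0 (lower_face i) c2) => //.
  by case: (i).
have sI : 0 <= (pi - r) / m <= 1.
  by apply/andP; split; [apply: divr_ge0; near_lra | rewrite ler_pdivrMr// mul1r; near_lra].
have sI' : 0 <= 1 - (pi - r) / m <= 1 by near_lra.
have rE : (pi - r) / m * m = pi - r by rewrite mulfVK ?gt_eqF.
have := upper_side0 i sI; have := upper_side2 j sI'.
rewrite mulrBl mul1r rE (_ : l + (m - (pi - r)) = r); last by near_lra.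
rewrite (_ : pi - (pi - r) = r); last by near_lra.
move=> E2 E0; apply: via (to_triangles_upper _) (to_triangles_upper _) _.
- by rewrite E0 flipK; exact: side_point_simplex.
- by rewrite E2 flipK; exact: side_point_simplex.
rewrite E0 E2 !flipK; apply: bg_glue1; left.
apply: (@tg_edge _ (upper_face i) c0 (upper_face j) c2) => //.
by move: ij; case: (i); case: (j).
Qed.

Local Notation gdev i := (glued_dev (S i) (T i) (NS i) (NT i)).

Lemma lune_point_dev i x : square x ->
  gdev i x = polar (lune_point i x).1 (lune_point i x).2.
Proof. by move=> Sx; have [lp {1}<-] := lune_pointP i Sx; rewrite (lm_dev (hG i)). Qed.

(** Compactness of the lune makes the inverse of the identification continuous
    where it is injective. *)
Lemma lune_point_continuous i x : square x -> 0 < (lune_point i x).1 < pi ->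
  forall d, 0 < d -> exists2 e, 0 < e & forall y, square y -> ball x e y ->
    ball (lune_point i x) d (lune_point i y).
Proof.
move=> Sx; have [lp Ep] := lune_pointP i Sx; set p := lune_point i x in lp Ep *.
move=> p1 d d0.
have [e e0 He] : exists2 e, 0 < e & forall q, lune (ang i) q -> ball x e (G i q) -> ball p d q.
  apply: contrapT => ne.
  pose Bad e q := ball x e (G i q) /\ ~ ball p d q.
  have [||q lq Hq] := @compact_cluster R _ _ Bad (@compact_lune R (ang i)).
  - by move=> e e' q ee' [b nb]; split=> //; exact: ballS b.
  - move=> e e0; apply: contrapT => nq; apply: ne; exists e => // q lq b.
    by apply: contrapT => nb; apply: nq; exists q.
  have Eq : G i q = x.
    apply/esym/ball2_eq => e e0; have he : 0 < e / 2 by near_lra.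
    have [d1 d10 H1] := lm_continuous (hG i) lq he.
    have [d2 [d20 d21 d2e _ _]] := min4 d10 he d10 he.
    have [q' [lq' [b _] qq']] := Hq d2 d20.
    apply: (ball2_half (ballS d2e b)); apply: ball_sym.
    by apply: H1 => //; exact: ballS qq'.
  have pq : p = q.
    have pq0 : G i p = G i q by rewrite Ep Eq.
    by case: (lm_inj (hG i) lp lq pq0) => // -[E _]; move: p1; rewrite E ltxx ?andbF.
  by have [q' [lq' [_ nb] qq']] := Hq d d0; apply: nb; rewrite pq.
exists e => // y Sy xy; have [lq Eq] := lune_pointP i Sy.
by apply: He => //; rewrite Eq.
Qed.

(** Away from the poles the arc lifts to the lune by continuity; a pole is joined
    to every point by a meridian. *)
Lemma lune_point_arc i g v w L : great_arc (@square R) (gdev i) g v w 0 L ->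
  forall s, 0 <= s <= L -> exists2 e, 0 < e & forall t, 0 <= t <= L -> `|s - t| < e ->
    broken_geodesic (mkY i (lune_point i (g s))) (mkY i (lune_point i (g t))) `|s - t|.
Proof.
move=> arc s sI; have [/within_continuousP gC gS vw gE] := arc; have pi0 := pi_gt0 R.
have [lp _] := lune_pointP i (gS s sI); set p := lune_point i (g s) in lp *.
have [p1 p2] := lp.
have meridian q r r' : 0 <= r <= pi -> lune (ang i) q -> r = 0 \/ r = pi ->
    0 <= r' <= pi -> q.1 = r' -> forall phi, 0 <= phi <= ang i ->
    broken_geodesic (mkY i (r, phi)) (mkY i q) `|r - r'|.
  move=> rI [q1 q2] rE r'I qE phi phiI.
  rewrite -(add0r `|_|); apply: bg_trans.
    apply: bg_glue1; left; exact: (fg_pole _ rE phiI q2).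
  rewrite /mkY [q]surjective_pairing qE.
  case: rE => rE; rewrite rE.
    rewrite sub0r normrN ger0_norm; last by near_lra.
    apply: bg_geodesic; have := @meridian_geodesic R (ang i) 0 r' q.2 (lexx 0) r'I q2.
    by rewrite subr0.
  rewrite ger0_norm; last by near_lra.
  apply: bg_sym; apply: bg_geodesic.
  by apply: meridian_geodesic => //; near_lra.
have [pz|pz] := pselect (p.1 = 0 \/ p.1 = pi).
  exists pi => // t tI st; have [lq _] := lune_pointP i (gS t tI).
  set q := lune_point i (g t) in lq *; have [q1 _] := lq.
  have E : cos (s - t) = cos (p.1 - q.1).
    rewrite -(arc_dot arc sI tI) (lune_point_dev i (gS s sI)) (lune_point_dev i (gS t tI)).
    rewrite dot_polar (cosB p.1) -/p -/q.
    by case: pz => ->; rewrite ?sin0 ?sinpi !mul0r.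
  have -> : `|s - t| = `|p.1 - q.1|.
    rewrite -acos_cos_norm; last exact: ltW.
    by rewrite E acos_cos_norm// ler_norml; near_lra.
  by rewrite [p]surjective_pairing; apply: meridian.
have p1' : 0 < p.1 < pi.
  by rewrite !lt_neqAle; case/andP: p1 => -> ->; rewrite !andbT; apply/andP; split;
    apply/eqP => E; apply: pz; [left | right].
have [d [d0 dp dp' _ _]] := @min4 R p.1 (pi - p.1) 1 1 ltac:(near_lra) ltac:(near_lra) ltac:(near_lra) ltac:(near_lra).
have [e e0 He] := lune_point_continuous (gS s sI) p1' d0.
have sI' : (`[0, L]%classic : set R) s by rewrite /= in_itv.
have [e' e'0 He'] := gC s sI' e e0.
have inner t : 0 <= t <= L -> `|s - t| < e' -> 0 < (lune_point i (g t)).1 < pi.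
  move=> tI st; have tI' : (`[0, L]%classic : set R) t by rewrite /= in_itv.
  have [b _] := He _ (gS t tI) (He' t tI' st).
  by move: b; rewrite /ball/= ltr_norml -/p; near_lra.
have lift b c : b <= c -> 0 <= b -> c <= L ->
    (forall t, b <= t <= c -> `|s - t| < e') ->
    broken_geodesic (mkY i (lune_point i (g b))) (mkY i (lune_point i (g c))) (c - b).
  move=> bc b0 cL near; apply: bg_geodesic.
  apply: (@arc_geodesic _ _ _ (fun t => lune_point i (g t)) v w) => //.
  have tL t : b <= t <= c -> 0 <= t <= L by near_lra.
  split=> //.
  - apply/within_continuousP => t; rewrite /= in_itv/= => tI k k0; have tI' := tL t tI.
    have [k1 k10 H1] := lune_point_continuous (gS t tI') (inner t tI' (near t tI)) k0.
    have tI2 : (`[0, L]%classic : set R) t by rewrite /= in_itv.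
    have [k2 k20 H2] := gC t tI2 k1 k10.
    exists k2 => // u; rewrite /= in_itv/= => /tL uI tu; apply: H1; first exact: gS.
    by apply: H2 => //; rewrite /= in_itv.
  - by move=> t /tL tI; case: (lune_pointP i (gS t tI)).
  by move=> t /tL tI; rewrite -gE// (lune_point_dev i (gS t tI)).
exists e' => // t tI st; have [ts|ts] := leP t s.
  rewrite ger0_norm ?subr_ge0//; apply: bg_sym; apply: lift; [by []|near_lra|near_lra|].
  by move=> u uI; move: st; rewrite !ger0_norm; near_lra.
rewrite distrC ger0_norm ?subr_ge0 ?ltW//; apply: lift; [exact: ltW|near_lra|near_lra|].
by move=> u uI; move: st; rewrite distrC [`|s - u|]distrC !ger0_norm; near_lra.
Qed.

Lemma to_lunes_along (f : face) g v w L :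
  great_arc (@simplex R) (tdev (htri h f)) g v w 0 L ->
  forall s, 0 <= s <= L -> exists2 e, 0 < e & forall t, 0 <= t <= L -> `|s - t| < e ->
    broken_geodesic (to_lunes (mkX f (g s))) (to_lunes (mkX f (g t))) `|s - t|.
Proof.
move=> arc; have [i [fE|fE]] := faceP f; rewrite fE in arc *.
  have [gC gD vw gE] := arc_rotation (rNS i) arc.
  have arc' : great_arc (@square R) (gdev i) g (v *m NS i) (w *m NS i) 0 L.
    split=> // s sI; first by case: (simplex_square (gD s sI)).
    by rewrite glued_devS ?gE//; exact: gD.
  by move=> s sI; have [e e0 He] := lune_point_arc arc' sI; exists e => // t tI st;
    rewrite !to_lunes_lower; exact: He.
have [gC gD vw gE] := arc_rotation (rNT i) arc.
have arc' : great_arc (@square R) (gdev i) (fun s => flip (g s)) (v *m NT i) (w *m NT i) 0 L.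
  split=> // [|s sI|s sI]; last by rewrite (glued_dev_upper (agree i)) flipK ?gE//; exact: gD.
    move/within_continuousP: gC => gC; apply/within_continuousP => s sI e e0.
    by have [d d0 Hd] := gC s sI e e0; exists d => // t tI st; apply: ball_flip; exact: Hd.
  exact: simplex_flip_square (gD s sI).
by move=> s sI; have [e e0 He] := lune_point_arc arc' sI; exists e => // t tI st;
  rewrite !to_lunes_upper; exact: He.
Qed.

Lemma glued_dev_dot i p q : lune (ang i) p -> lune (ang i) q ->
  dot (gdev i (G i p)) (gdev i (G i q)) = dot (polar p.1 p.2) (polar q.1 q.2).
Proof. by move=> lp lq; rewrite !(lm_dev (hG i)). Qed.

Lemma to_triangles_local i p : lune (ang i) p -> exists2 e, 0 < e &
  forall q, lune (ang i) q -> ball p e q ->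
  broken_geodesic (to_triangles (mkY i p)) (to_triangles (mkY i q))
    (acos (dot (lune_dev p) (lune_dev q))).
Proof.
move=> lp; set x := G i p; have Sx : square x by exact: lm_square (hG i) _ lp.
have [e1 e10 H1] : exists2 e, 0 < e & forall q, lune (ang i) q -> simplex (G i q) ->
    ball x e (G i q) -> broken_geodesic (to_triangles (mkY i p)) (to_triangles (mkY i q))
    (acos (dot (lune_dev p) (lune_dev q))).
  have [xs|xs] := leP (x.1 + x.2) 1.
    have Hx := square_simplex Sx xs; have [e e0 He] := triangle_geodesic (S i) Hx.
    exists e => // q lq Hq xq; rewrite !to_triangles_lower//.
    apply: bg_geodesic; have := He _ Hq xq.
    rewrite -(dot_rotation _ _ (rNS i)) -!(glued_devS (S i) (T i) (NS i) (NT i))//.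
    by rewrite glued_dev_dot.
  exists ((x.1 + x.2 - 1) / 2); first by near_lra.
  by move=> q lq [_ _ Hq] [b1 b2]; move: b1 b2; rewrite /ball/= !ltr_norml => b1 b2; exfalso; near_lra.
have [e2 e20 H2] : exists2 e, 0 < e & forall q, lune (ang i) q -> simplex (flip (G i q)) ->
    ball x e (G i q) -> broken_geodesic (to_triangles (mkY i p)) (to_triangles (mkY i q))
    (acos (dot (lune_dev p) (lune_dev q))).
  have [xs|xs] := leP 1 (x.1 + x.2).
    have Hx := square_flip_simplex Sx xs; have [e e0 He] := triangle_geodesic (T i) Hx.
    exists e => // q lq Hq xq.
    have G0 : broken_geodesic (mkX (upper_face i) (flip x)) (mkX (upper_face i) (flip (G i q)))
        (acos (dot (lune_dev p) (lune_dev q))).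
      apply: bg_geodesic; have := He _ Hq (ball_flip xq).
      rewrite -(dot_rotation _ _ (rNT i)) -!(glued_dev_upper (agree i))//.
      by rewrite glued_dev_dot.
    apply: (bg_len (bg_trans (to_triangles_upper Hx)
      (bg_trans G0 (bg_sym (to_triangles_upper Hq))))).
    by rewrite add0r addr0.
  exists ((1 - (x.1 + x.2)) / 2); first by near_lra.
  move=> q lq /flip_simplex_square[_ Hq] [b1 b2]; move: b1 b2.
  by rewrite /ball/= !ltr_norml => b1 b2; exfalso; near_lra.
have [m' [m'0 me1 me2 _ _]] := min4 e10 e20 e10 e20.
have [d d0 Hd] := lm_continuous (hG i) lp m'0.
exists d => // q lq pq; have xq := Hd q lq pq; have Sq := lm_square (hG i) lq.
have [qs|qs] := leP ((G i q).1 + (G i q).2) 1.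
  by apply: H1 => //; [exact: square_simplex | exact: ballS xq].
by apply: H2 => //; [apply: square_flip_simplex => //; exact: ltW | exact: ballS xq].
Qed.

Lemma lunes_isometric : isometric X Y.
Proof.
apply: (@isometric_of_transfer _ _ _ to_lunes to_triangles).
- move=> [f x] /= Sx; have [i [->|->]] := faceP f.
    rewrite -/(mkX (lower_face i) x) to_lunes_lower.
    by case: (lune_pointP i (simplex_square Sx).1).
  rewrite -/(mkX (upper_face i) x) to_lunes_upper.
  by case: (lune_pointP i (simplex_flip_square Sx)).
- move=> [i p] /= lp; have Sx := lm_square (hG i) lp; rewrite /to_triangles /=.
  case: leP => H; first exact: square_simplex.
  by apply: square_flip_simplex => //; exact: ltW.
- apply: bg_transfer; last exact: to_lunes_glue.
  by move=> f g v w L; exact: to_lunes_along.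
- apply: bg_transfer; last exact: to_triangles_glue.
  by move=> i; apply: local_along_arcs => p; exact: to_triangles_local.
- move=> [f x] /= Sx; have [i [->|->]] := faceP f.
    rewrite -/(mkX (lower_face i) x) to_lunes_lower.
    have [lq Eq] := lune_pointP i (simplex_square Sx).1.
    by rewrite to_triangles_lower Eq//; exact: bg_nil.
  rewrite -/(mkX (upper_face i) x) to_lunes_upper.
  have [lq Eq] := lune_pointP i (simplex_flip_square Sx).
  by have := @to_triangles_upper i (lune_point i (flip x)); rewrite Eq flipK; apply.
move=> [i p] /= lp; have Sx := lm_square (hG i) lp; rewrite /to_triangles /=.
case: leP => H.
  by rewrite -/(mkX (lower_face i) _) to_lunes_lower; exact: bg_to_lunes_at.
by rewrite -/(mkX (upper_face i) _) to_lunes_upper flipK; exact: bg_to_lunes_at.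
Qed.

End Isometry.

(** * The theorem *)

Lemma kite_lune (R : realType) (S T : triangle R) l m :
  tlen S c0 = l -> tlen S c2 = l -> tlen S c1 = tlen T c1 ->
  tlen T c0 = m -> tlen T c2 = m -> l + m = pi ->
  tang S c1 + tang T c2 = pi -> tang S c2 + tang T c1 = pi ->
  exists NS NT G, [/\ rotation NS, rotation NT,
    forall x, square x -> x.1 + x.2 = 1 -> tdev S x *m NS = tdev T (flip x) *m NT &
    lune_map (tang S c0) (glued_dev S T NS NT) (legs l m) G].
Proof.
move=> S0 S2 S1T1 T0 T2 lm h1 h2.
have [NS [NT [rNS rNT agree dg]]] := two_triangles_digon S0 S2 S1T1 T0 T2 lm h1 h2.
by have [G hG] := digon_lune dg; exists NS, NT, G.
Qed.

Theorem theorem1 (R : realType) (alpha beta t : R)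
  (alpha_gt0 : 0 < alpha) (beta_gt0 : 0 < beta)
  (alphaN : forall k : int, alpha <> 2 * pi * k%:~R)
  (betaN : forall k : int, beta <> 2 * pi * k%:~R)
  (alphabetaN : forall k : int, alpha + beta <> 2 * pi * k%:~R)
  (t_bounds : 0 < t < pi)
  (l : edge -> R) (l_gt : glued_footballs_lengths alpha beta t l) :
  exists delta : R, 0 < delta /\
    forall h : triangulated R,
      angleA h = alpha -> angleB h = beta ->
      angleD h = alpha + beta -> angleC h = 4 * pi ->
      (forall e : edge, `|elen h e - l e| < delta) ->
      exists s : R, 0 < s < pi /\
        isometric (triangulated_surface h) (glued_footballs alpha beta s).
Proof.
have notturn (a : R) : 0 < a -> (forall k : int, a <> 2 * pi * k%:~R) -> cos a != 1.
  by move=> a0 aN; apply/eqP => /(cos1_turn a0)[k]; exact: aN.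
have [d d0 Hd] := near_lengths_rigid t_bounds (notturn _ alpha_gt0 alphaN)
  (notturn _ beta_gt0 betaN) (notturn _ (addr_gt0 alpha_gt0 beta_gt0) alphabetaN).
exists d; split=> // h hA hB hD hC hl.
have [[le1 le2] [le3 le4] _ _] := l_gt.
have len f k : tlen (htri h f) k = elen h (face_edge f k) := elenE h f k.
have K1 : kite (elen h e1) (elen h e3) (elen h e4) alpha (tang (htri h faceD1) c0)
    (tang (htri h faceA) c1 + tang (htri h faceD1) c2)
    (tang (htri h faceA) c2 + tang (htri h faceD1) c1).
  rewrite -hA; have := @glued_triangles_kite R (htri h faceA) (htri h faceD1).
  by rewrite !len; apply.
have K2 : kite (elen h e2) (elen h e4) (elen h e3) beta (tang (htri h faceD2) c0)
    (tang (htri h faceB) c1 + tang (htri h faceD2) c2)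
    (tang (htri h faceB) c2 + tang (htri h faceD2) c1).
  rewrite -hB; have := @glued_triangles_kite R (htri h faceB) (htri h faceD2).
  by rewrite !len; apply.
have ang f k : 0 < tang (htri h f) k by exact: tang_gt0.
have sumC : tang (htri h faceA) c1 + tang (htri h faceD1) c2 +
    (tang (htri h faceA) c2 + tang (htri h faceD1) c1) +
    (tang (htri h faceB) c1 + tang (htri h faceD2) c2) +
    (tang (htri h faceB) c2 + tang (htri h faceD2) c1) = 4 * pi.
  by rewrite -hC /angleC big_mkcond sum3 /= add0r; ring.
have [m0 e43 e1E e2E [C1 C2 C3 C4]] : and5 (0 < elen h e3 < pi) (elen h e4 = elen h e3)
    (elen h e1 = pi - elen h e3) (elen h e2 = pi - elen h e3) (and4
    (tang (htri h faceA) c1 + tang (htri h faceD1) c2 = pi)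
    (tang (htri h faceA) c2 + tang (htri h faceD1) c1 = pi)
    (tang (htri h faceB) c1 + tang (htri h faceD2) c2 = pi)
    (tang (htri h faceB) c2 + tang (htri h faceD2) c1 = pi)).
  apply: (Hd _ _ _ _ _ _ _ _ _ _ _ _ _ _ _ _ _ _ K1 K2 hD sumC); try exact: addr_gt0.
  - by rewrite -le1.
  - by rewrite -le2.
  - by rewrite -le3.
  - by rewrite -le4.
exists (elen h e3); split=> //.
set m := elen h e3 in m0 e43 e1E e2E *.
have lm : pi - m + m = pi by ring.
have [NA [MA [GA [rNA rMA agA hGA]]]] : exists NS NT G, [/\ rotation NS, rotation NT,
    forall x, square x -> x.1 + x.2 = 1 ->
      tdev (htri h faceA) x *m NS = tdev (htri h faceD1) (flip x) *m NT &
    lune_map (tang (htri h faceA) c0) (glued_dev (htri h faceA) (htri h faceD1) NS NT)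
      (legs (pi - m) m) G].
  by apply: kite_lune => //; rewrite !len.
have [NB [MB [GB [rNB rMB agB hGB]]]] : exists NS NT G, [/\ rotation NS, rotation NT,
    forall x, square x -> x.1 + x.2 = 1 ->
      tdev (htri h faceB) x *m NS = tdev (htri h faceD2) (flip x) *m NT &
    lune_map (tang (htri h faceB) c0) (glued_dev (htri h faceB) (htri h faceD2) NS NT)
      (legs (pi - m) m) G].
  by apply: kite_lune => //; rewrite !len.
apply: (@lunes_isometric R h alpha beta (pi - m) m
  (fun i => match i with footballA => NA | footballB => NB end)
  (fun i => match i with footballA => MA | footballB => MB end)
  (fun i => match i with footballA => GA | footballB => GB end)) => //.
- by lra.
- by lra.
- by case.
- by case.
- by case.
- by case=> /=; [rewrite -hA | rewrite -hB].
- by case.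
Qed.
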